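(* (a) If $0<q<1$ and $q<p<\infty$, then $\mathcal M(\mathcal D^p_{p-1}\cap H^\infty,\ \mathcal D^q_{q-1}\cap H^\infty)=\{0\}$. (b) If $1\le q<2\le p<\infty$, then $\mathcal M(\mathcal D^p_{p-1}\cap H^\infty,\ \mathcal D^q_{q-1}\cap H^\infty)=\{0\}$.
   Context: $\mathbb D$ is the open unit disc, $dA=\frac1\pi dx\,dy$. For $0<p<\infty$, $\mathcal D^p_{p-1}$ is the space of analytic $f$ in $\mathbb D$ with $\int_{\mathbb D}(1-|z|)^{p-1}|f'(z)|^p\,dA(z)<\infty$. $H^\infty$ is the space of bounded analytic functions on $\mathbb D$. For spaces $X,Y$ of analytic functions, $\mathcal M(X,Y)=\{g\text{ analytic in }\mathbb D: fg\in Y\text{ for all }f\in X\}$. *)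

(* Defs.v *)
From Stdlib Require Import Reals.
Open Scope R_scope.

Definition Cplx : Type := (R * R)%type.
Definition Cadd (z w : Cplx) : Cplx := (fst z + fst w, snd z + snd w).
Definition Csub (z w : Cplx) : Cplx := (fst z - fst w, snd z - snd w).
Definition Cmul (z w : Cplx) : Cplx :=
  (fst z * fst w - snd z * snd w, fst z * snd w + snd z * fst w).
Definition C0 : Cplx := (0, 0).
Definition Cnorm (z : Cplx) : R := sqrt (fst z * fst z + snd z * snd z).

Definition inD (z : Cplx) : Prop := Cnorm z < 1.

Definition has_cderiv (f : Cplx -> Cplx) (z l : Cplx) : Prop :=
  forall eps, 0 < eps -> exists delta, 0 < delta /\
    forall h, Cnorm h < delta ->
      Cnorm (Csub (Csub (f (Cadd z h)) (f z)) (Cmul l h)) <= eps * Cnorm h.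

Definition analytic_D (f : Cplx -> Cplx) : Prop :=
  forall z, inD z -> exists l, has_cderiv f z l.

(* real power x^p for x >= 0, with 0^p = 0 (p > 0) *)
Definition rpow (x p : R) : R :=
  if Req_EM_T x 0 then 0 else Rpower x p.

Definition is_RInt (f : R -> R) (a b v : R) : Prop :=
  exists pr : Riemann_integrable f a b, RiemannInt pr = v.

(* The integral of F >= 0 over D w.r.t. dA = dx dy / pi is finite:
   via polar coordinates, the integrals over the discs of radius r < 1
   are uniformly bounded. *)
Definition disc_integral_finite (F : Cplx -> R) : Prop :=
  exists M, forall r, 0 < r < 1 ->
    exists G : R -> R,
      (forall rho, 0 <= rho <= r ->
         is_RInt (fun t => F (rho * cos t, rho * sin t) * rho) 0 (2 * PI) (G rho)) /\
      exists v, is_RInt G 0 r v /\ v / PI <= M.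

Definition Dspace (p : R) (f : Cplx -> Cplx) : Prop :=
  analytic_D f /\
  exists f' : Cplx -> Cplx,
    (forall z, inD z -> has_cderiv f z (f' z)) /\
    disc_integral_finite
      (fun z => rpow (1 - Cnorm z) (p - 1) * rpow (Cnorm (f' z)) p).

Definition Hinf (f : Cplx -> Cplx) : Prop :=
  analytic_D f /\ exists M, forall z, inD z -> Cnorm (f z) <= M.

Definition DpHinf (p : R) (f : Cplx -> Cplx) : Prop := Dspace p f /\ Hinf f.

Definition Mult (X Y : (Cplx -> Cplx) -> Prop) (g : Cplx -> Cplx) : Prop :=
  analytic_D g /\ forall f, X f -> Y (fun z => Cmul (f z) (g z)).

Definition zero_on_D (g : Cplx -> Cplx) : Prop := forall z, inD z -> g z = C0.

(* Main.v *)
Require Import Defs.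
From Stdlib Require Import Reals.
From Stdlib Require Import Lra Lia ClassicalEpsilon.
From Coquelicot Require Import Coquelicot.
Open Scope R_scope.

(* Let [g] be a multiplier with [g z0 <> 0]; the function 1 shows that [g] is bounded and lies in
   D^q. Put a_k = eps (k+1)^(-1/q) and n_k = 4^(k^2). The Rudin-Shapiro recursion
     P_(k+1) = P_k +- a_k z^n_k Q_k,   Q_(k+1) = z^n_k Q_k -+ a_k P_k
   multiplies |P|^2 + |Q|^2 by 1 + a_k^2 on the unit circle, so the P_k are uniformly bounded and
   converge to a bounded f. As |f'| is at most a constant times sum a_k n_k r^(n_k - 1) and (a_k)
   lies in l^s for s > q, f lies in D^p; here s = min(p, 1) in (a) and s = 2 in (b).
   On the annulus 1 - |z| ~ 1/n_k one has |f'| ~ a_k n_k |Q_k|, where |Q_k|^2 >= 1 - |P_k|^2 and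
   the mean of |P_k|^2 is at most a multiple of eps^2, while the mean of |g|^2 over circles is
   bounded below by Cauchy's theorem. Hence that annulus contributes at least c a_k^q, that is
   c' / (k+1), to the D^q integral of f' g, which diverges although f' g = (f g)' - f g' should
   have a finite one. *)

(** * Goursat's theorem on a rectangle *)


(** A plain lacunary series with coefficients [a_k] does not serve in (b): for [q >= 1] these
    coefficients are not summable, and a bounded lacunary series has summable coefficients. The
    factors [Q_k] buy boundedness, but [Q_k] may be small, or large only where [g] is small. Hence
    no pointwise lower bound is available on the annuli, and only quadratic means over whole circles
    are compared; squares bound q-th powers from below because [q <= 2] and the functions involved
    are bounded. The scale [eps] is chosen after [g], so that the mean of [|P_k|^2] is small against
    that of [|g|^2]. Analyticity means pointwise complex differentiability and the integrals are
    Riemann integrals in polar coordinates. Therefore Cauchy's theorem is derived by bisection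
    directly in the polar variables, the limit function is controlled by explicit second-order
    Taylor bounds, and upper bounds for radial integrals are certified by explicit primitives. *)

Lemma pow_le_one x n : 0 <= x <= 1 -> x ^ n <= 1.
Proof. intros Hx; rewrite <- (pow1 n); apply pow_incr; exact Hx. Qed.

Lemma exp_le_compat x y : x <= y -> exp x <= exp y.
Proof. intros [H| ->]; [left; apply exp_increasing; exact H|lra]. Qed.

Lemma nested_intervals (u v : nat -> R) :
  (forall n, u n <= u (S n)) -> (forall n, v (S n) <= v n) ->
  (forall n, u n <= v n) -> exists p, forall n, u n <= p <= v n.
Proof.
intros Hu Hv Huv.
assert (Hu' : forall n k, u n <= u (n + k)%nat).
{ intros n k; induction k as [|k IH]; [rewrite Nat.add_0_r; lra|].
  rewrite Nat.add_succ_r; specialize (Hu (n + k)%nat); lra. }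
assert (Hv' : forall n k, v (n + k)%nat <= v n).
{ intros n k; induction k as [|k IH]; [rewrite Nat.add_0_r; lra|].
  rewrite Nat.add_succ_r; specialize (Hv (n + k)%nat); lra. }
assert (Hx : forall n m, u n <= v m).
{ intros n m.
  specialize (Hu' n m); specialize (Hv' m n); specialize (Huv (n + m)%nat).
  rewrite (Nat.add_comm m n) in Hv'; lra. }
destruct (completeness (fun x => exists n, x = u n)) as [p [Hp1 Hp2]].
- exists (v 0%nat); intros x [n ->]; apply Hx.
- exists (u 0%nat), 0%nat; reflexivity.
- exists p; intros n; split.
  + apply Hp1; exists n; reflexivity.
  + apply Hp2; intros x [m ->]; apply Hx.
Qed.

Lemma continuity_2d_pt_snd (f : R -> R -> R) (x y : R) :
  continuity_2d_pt f x y -> continuous (f x) y.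
Proof.
intros H; apply continuity_2d_pt_filterlim in H.
apply (filterlim_comp _ _ _ (fun v => (x, v)) (fun z => f (fst z) (snd z)) _ (locally (x, y))); [|exact H].
intros P [d Hd]; exists d; intros v Hv; apply Hd; split; [apply ball_center | exact Hv].
Qed.

Lemma continuity_2d_pt_fst (f : R -> R -> R) (x y : R) :
  continuity_2d_pt f x y -> continuous (fun u => f u y) x.
Proof.
intros H; apply continuity_2d_pt_filterlim in H.
apply (filterlim_comp _ _ _ (fun u => (u, y)) (fun z => f (fst z) (snd z)) _ (locally (x, y))); [|exact H].
intros P [d Hd]; exists d; intros v Hv; apply Hd; split; [exact Hv | apply ball_center].
Qed.

(** The counterclockwise integral of the form [B dx + A dy] around the rectangle. A real form is
    enough because only one component of Cauchy's theorem is used. *)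
Definition circulation (A B : R -> R -> R) (a b c d : R) : R :=
  (RInt (A b) c d - RInt (A a) c d)
  - (RInt (fun x => B x d) a b - RInt (fun x => B x c) a b).

Section Goursat.
Variables (A B : R -> R -> R) (a b c d : R).
Hypothesis HA : forall x y, a <= x <= b -> c <= y <= d -> continuity_2d_pt A x y.
Hypothesis HB : forall x y, a <= x <= b -> c <= y <= d -> continuity_2d_pt B x y.

Lemma ex_RInt_vert x c' d' : a <= x <= b -> c <= c' -> c' <= d' -> d' <= d ->
  ex_RInt (A x) c' d'.
Proof.
intros Hx H1 H2 H3; apply (ex_RInt_continuous (V := R_CompleteNormedModule)).
intros z; rewrite Rmin_left, Rmax_right by lra; intros Hz.
apply continuity_2d_pt_snd, HA; lra.
Qed.

Lemma ex_RInt_horiz y a' b' : c <= y <= d -> a <= a' -> a' <= b' -> b' <= b ->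
  ex_RInt (fun x => B x y) a' b'.
Proof.
intros Hx H1 H2 H3; apply (ex_RInt_continuous (V := R_CompleteNormedModule)).
intros z; rewrite Rmin_left, Rmax_right by lra; intros Hz.
apply continuity_2d_pt_fst, HB; lra.
Qed.

Lemma circulation_split x0 x1 x2 y0 y1 y2 :
  a <= x0 -> x0 <= x1 -> x1 <= x2 -> x2 <= b ->
  c <= y0 -> y0 <= y1 -> y1 <= y2 -> y2 <= d ->
  circulation A B x0 x2 y0 y2 =
  circulation A B x0 x1 y0 y1 + circulation A B x1 x2 y0 y1 +
  (circulation A B x0 x1 y1 y2 + circulation A B x1 x2 y1 y2).
Proof.
intros; unfold circulation.
assert (HV : forall x, a <= x <= b -> RInt (A x) y0 y2 = RInt (A x) y0 y1 + RInt (A x) y1 y2).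
{ intros x Hx; symmetry; apply (RInt_Chasles (V := R_CompleteNormedModule));
    apply ex_RInt_vert; lra. }
assert (HH : forall y, c <= y <= d -> RInt (fun x => B x y) x0 x2 =
   RInt (fun x => B x y) x0 x1 + RInt (fun x => B x y) x1 x2).
{ intros y Hy; symmetry; apply (RInt_Chasles (V := R_CompleteNormedModule) (fun x => B x y));
    apply ex_RInt_horiz; lra. }
rewrite (HV x0), (HV x2), (HH y0), (HH y2) by lra; ring.
Qed.

(** The affine parts at [(p, q)] cancel because [A_x] and [B_y] share the value [l]: both contribute
    [l] times the area, with opposite signs. Only the error terms remain, at most [2 * e * K] per
    unit length. *)
Lemma circulation_local p q l m1 m2 e K x0 x1 y0 y1 :
  a <= x0 -> x0 <= x1 -> x1 <= b -> c <= y0 -> y0 <= y1 -> y1 <= d ->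
  (forall u v, x0 <= u <= x1 -> y0 <= v <= y1 ->
     Rabs (A u v - A p q - (l * (u - p) + m1 * (v - q))) <= e * K) ->
  (forall u v, x0 <= u <= x1 -> y0 <= v <= y1 ->
     Rabs (B u v - B p q - (m2 * (u - p) + l * (v - q))) <= e * K) ->
  Rabs (circulation A B x0 x1 y0 y1) <= 2 * e * K * ((x1 - x0) + (y1 - y0)).
Proof.
intros ? ? ? ? ? ? H1 H2; unfold circulation.
assert (E1 : RInt (A x1) y0 y1 - RInt (A x0) y0 y1 - l * (x1 - x0) * (y1 - y0)
   = RInt (fun y => A x1 y - A x0 y - l * (x1 - x0)) y0 y1).
{ rewrite (RInt_minus (V := R_CompleteNormedModule) (fun y => A x1 y - A x0 y) (fun _ => l * (x1 - x0))).
  - rewrite (RInt_minus (V := R_CompleteNormedModule) (A x1) (A x0)) by (apply ex_RInt_vert; lra).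
    rewrite RInt_const; unfold minus, plus, opp, scal; simpl; unfold mult; simpl; ring.
  - apply (ex_RInt_minus (V := R_CompleteNormedModule) (A x1) (A x0)); apply ex_RInt_vert; lra.
  - apply ex_RInt_const. }
assert (E2 : RInt (fun x => B x y1) x0 x1 - RInt (fun x => B x y0) x0 x1 - l * (y1 - y0) * (x1 - x0)
   = RInt (fun x => B x y1 - B x y0 - l * (y1 - y0)) x0 x1).
{ rewrite (RInt_minus (V := R_CompleteNormedModule) (fun x => B x y1 - B x y0) (fun _ => l * (y1 - y0))).
  - rewrite (RInt_minus (V := R_CompleteNormedModule) (fun x => B x y1) (fun x => B x y0)) by (apply ex_RInt_horiz; lra).
    rewrite RInt_const; unfold minus, plus, opp, scal; simpl; unfold mult; simpl; ring.
  - apply (ex_RInt_minus (V := R_CompleteNormedModule) (fun x => B x y1) (fun x => B x y0)); apply ex_RInt_horiz; lra.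
  - apply ex_RInt_const. }
assert (F1 : Rabs (RInt (fun y => A x1 y - A x0 y - l * (x1 - x0)) y0 y1) <= (y1 - y0) * (2 * e * K)).
{ apply abs_RInt_le_const; [lra| |].
  - apply (ex_RInt_minus (V := R_CompleteNormedModule) (fun y => A x1 y - A x0 y) (fun _ => l * (x1 - x0)));
      [|apply ex_RInt_const].
    apply (ex_RInt_minus (V := R_CompleteNormedModule) (A x1) (A x0)); apply ex_RInt_vert; lra.
  - intros t Ht.
    pose proof (H1 x1 t ltac:(lra) ltac:(lra)) as G1; pose proof (H1 x0 t ltac:(lra) ltac:(lra)) as G2.
    apply Rabs_le_between in G1; apply Rabs_le_between in G2; apply Rabs_le_between; lra. }
assert (F2 : Rabs (RInt (fun x => B x y1 - B x y0 - l * (y1 - y0)) x0 x1) <= (x1 - x0) * (2 * e * K)).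
{ apply abs_RInt_le_const; [lra| |].
  - apply (ex_RInt_minus (V := R_CompleteNormedModule) (fun x => B x y1 - B x y0) (fun _ => l * (y1 - y0)));
      [|apply ex_RInt_const].
    apply (ex_RInt_minus (V := R_CompleteNormedModule) (fun x => B x y1) (fun x => B x y0)); apply ex_RInt_horiz; lra.
  - intros t Ht.
    pose proof (H2 t y1 ltac:(lra) ltac:(lra)) as G1; pose proof (H2 t y0 ltac:(lra) ltac:(lra)) as G2.
    apply Rabs_le_between in G1; apply Rabs_le_between in G2; apply Rabs_le_between; lra. }
rewrite <- E1 in F1; rewrite <- E2 in F2.
apply Rabs_le_between in F1; apply Rabs_le_between in F2; apply Rabs_le_between.
lra.
Qed.

Hypothesis Hdiff : forall x y, a <= x <= b -> c <= y <= d ->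
  exists l m1 m2, differentiable_pt_lim A x y l m1 /\ differentiable_pt_lim B x y m2 l.

(** Goursat's bisection: the derivatives exist pointwise and need not be continuous, so Green's
    formula is not at hand. One of the four parts of a rectangle always keeps a quarter of the
    circulation, while near the common limit point [circulation_local] makes the circulation small
    against the square of the side. *)
Lemma goursat_rectangle : a <= b -> c <= d -> circulation A B a b c d = 0.
Proof.
intros Hab Hcd.
destruct (Req_dec (circulation A B a b c d) 0) as [|Hne]; [assumption|exfalso].
set (tau := Rabs (circulation A B a b c d)).
assert (Htau : 0 < tau) by (apply Rabs_pos_lt; exact Hne).
set (X := b - a); set (Y := d - c).
(* [s] is the lower left corner of a rectangle of generation [n]. *)
set (bad := fun (n : nat) (s : R * R) =>
  a <= fst s /\ fst s + X / 2 ^ n <= b /\ c <= snd s /\ snd s + Y / 2 ^ n <= d /\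
  tau / 4 ^ n <= Rabs (circulation A B (fst s) (fst s + X / 2 ^ n) (snd s) (snd s + Y / 2 ^ n))).
(* The implication stands under the existential so that choice yields a total successor map. *)
assert (Hstep : forall n s, exists s', bad n s -> bad (S n) s' /\
   fst s <= fst s' /\ fst s' + X / 2 ^ S n <= fst s + X / 2 ^ n /\
   snd s <= snd s' /\ snd s' + Y / 2 ^ S n <= snd s + Y / 2 ^ n).
{ intros n [x y].
  destruct (excluded_middle_informative (bad n (x, y))) as [Hb|Hb]; [|exists (x, y); intros; contradiction].
  destruct Hb as (B1 & B2 & B3 & B4 & B5); simpl in B1, B2, B3, B4, B5.
  assert (P2 : 0 < 2 ^ n) by (apply pow_lt; lra).
  assert (P4 : 0 < 4 ^ n) by (apply pow_lt; lra).
  set (hx := X / 2 ^ S n); set (hy := Y / 2 ^ S n).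
  assert (EX : X / 2 ^ n = hx + hx) by (unfold hx; simpl; field; lra).
  assert (EY : Y / 2 ^ n = hy + hy) by (unfold hy; simpl; field; lra).
  assert (Hhx : 0 <= hx) by (unfold hx, Rdiv; apply Rmult_le_pos; [unfold X; lra|left; apply Rinv_0_lt_compat, pow_lt; lra]).
  assert (Hhy : 0 <= hy) by (unfold hy, Rdiv; apply Rmult_le_pos; [unfold Y; lra|left; apply Rinv_0_lt_compat, pow_lt; lra]).
  rewrite EX, EY in *.
  rewrite (circulation_split x (x + hx) (x + (hx + hx)) y (y + hy) (y + (hy + hy))) in B5 by lra.
  assert (ET : tau / 4 ^ n = 4 * (tau / 4 ^ S n)) by (simpl; field; lra).
  rewrite ET in B5.
  set (t := tau / 4 ^ S n) in *.
  set (c1 := circulation A B x (x + hx) y (y + hy)) in *.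
  set (c2 := circulation A B (x + hx) (x + (hx + hx)) y (y + hy)) in *.
  set (c3 := circulation A B x (x + hx) (y + hy) (y + (hy + hy))) in *.
  set (c4 := circulation A B (x + hx) (x + (hx + hx)) (y + hy) (y + (hy + hy))) in *.
  assert (Hcase : t <= Rabs c1 \/ t <= Rabs c2 \/ t <= Rabs c3 \/ t <= Rabs c4).
  { destruct (Rle_lt_dec t (Rabs c1)); [tauto|].
    destruct (Rle_lt_dec t (Rabs c2)); [tauto|].
    destruct (Rle_lt_dec t (Rabs c3)); [tauto|].
    destruct (Rle_lt_dec t (Rabs c4)); [tauto|exfalso].
    pose proof (Rabs_triang (c1 + c2) (c3 + c4)); pose proof (Rabs_triang c1 c2);
    pose proof (Rabs_triang c3 c4); lra. }
  destruct Hcase as [Hc|[Hc|[Hc|Hc]]].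
  - exists (x, y); intros _; unfold bad; simpl fst; simpl snd; fold hx hy t; fold c1.
    repeat split; try lra; exact Hc.
  - exists (x + hx, y); intros _; unfold bad; simpl fst; simpl snd; fold hx hy t.
    replace (x + hx + hx) with (x + (hx + hx)) by ring; fold c2.
    repeat split; try lra; exact Hc.
  - exists (x, y + hy); intros _; unfold bad; simpl fst; simpl snd; fold hx hy t.
    replace (y + hy + hy) with (y + (hy + hy)) by ring; fold c3.
    repeat split; try lra; exact Hc.
  - exists (x + hx, y + hy); intros _; unfold bad; simpl fst; simpl snd; fold hx hy t.
    replace (x + hx + hx) with (x + (hx + hx)) by ring.
    replace (y + hy + hy) with (y + (hy + hy)) by ring; fold c4.
    repeat split; try lra; exact Hc. }
set (next := fun n s => proj1_sig (constructive_indefinite_description _ (Hstep n s))).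
set (st := fix st n := match n with O => (a, c) | S n => next n (st n) end).
assert (Hbad : forall n, bad n (st n)).
{ induction n as [|n IH].
  - unfold bad; simpl fst; simpl snd; simpl pow.
    replace (a + X / 1) with b by (unfold X; field).
    replace (c + Y / 1) with d by (unfold Y; field).
    fold tau; repeat split; lra.
  - change (st (S n)) with (next n (st n)); unfold next.
    destruct (constructive_indefinite_description _ (Hstep n (st n))) as [s' Hs']; simpl.
    apply Hs', IH. }
assert (Hmono : forall n, fst (st n) <= fst (st (S n)) /\
   fst (st (S n)) + X / 2 ^ S n <= fst (st n) + X / 2 ^ n /\
   snd (st n) <= snd (st (S n)) /\ snd (st (S n)) + Y / 2 ^ S n <= snd (st n) + Y / 2 ^ n).
{ intros n; change (st (S n)) with (next n (st n)); unfold next.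
  destruct (constructive_indefinite_description _ (Hstep n (st n))) as [s' Hs']; simpl proj1_sig.
  apply Hs', Hbad. }
assert (Hpos : forall (Z : R) n, 0 <= Z -> 0 <= Z / 2 ^ n).
{ intros Z n HZ; apply Rmult_le_pos; [lra|left; apply Rinv_0_lt_compat, pow_lt; lra]. }
assert (HX : 0 <= X) by (unfold X; lra). assert (HY : 0 <= Y) by (unfold Y; lra).
destruct (nested_intervals (fun n => fst (st n)) (fun n => fst (st n) + X / 2 ^ n)) as [p Hp].
{ intros n; apply Hmono. } { intros n; apply Hmono. } { intros n; specialize (Hpos X n HX); lra. }
destruct (nested_intervals (fun n => snd (st n)) (fun n => snd (st n) + Y / 2 ^ n)) as [q Hq].
{ intros n; apply Hmono. } { intros n; apply Hmono. } { intros n; specialize (Hpos Y n HY); lra. }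
destruct (Hdiff p q) as (l & m1 & m2 & D1 & D2).
{ specialize (Hp 0%nat); simpl in Hp; unfold X in Hp; lra. }
{ specialize (Hq 0%nat); simpl in Hq; unfold Y in Hq; lra. }
(* The summand 1 keeps [W] positive for degenerate rectangles. The tolerance [tau / (4 * W ^ 2)]
   turns the local bound at generation [n] into [tau / 4 ^ n / 2], half of what a bad rectangle must
   have. *)
set (W := X + Y + 1).
assert (HW : 0 < W) by (unfold W; lra).
assert (He : 0 < tau / (4 * W ^ 2)) by (apply Rdiv_lt_0_compat; [lra|]; assert (0 < W ^ 2) by (apply pow_lt; lra); lra).
destruct (D1 (mkposreal _ He)) as [d1 Hd1]; destruct (D2 (mkposreal _ He)) as [d2 Hd2]; simpl in Hd1, Hd2.
assert (Hd : 0 < Rmin d1 d2 / W).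
{ apply Rdiv_lt_0_compat; [|lra]. apply Rmin_case; [apply (cond_pos d1)|apply (cond_pos d2)]. }
destruct (pow_lt_1_zero (/ 2) ltac:(rewrite Rabs_right; lra) _ Hd) as [n Hn].
specialize (Hn n (Nat.le_refl n)).
rewrite Rabs_right in Hn by (apply Rle_ge, pow_le; lra).
rewrite pow_inv in Hn.
assert (P2 : 0 < 2 ^ n) by (apply pow_lt; lra).
assert (HWn : W / 2 ^ n < Rmin d1 d2).
{ apply (Rmult_lt_compat_r W) in Hn; [|lra]. unfold Rdiv in Hn |- *. rewrite Rmult_assoc, Rinv_l in Hn by lra. lra. }
pose proof (Rmin_l d1 d2) as M1; pose proof (Rmin_r d1 d2) as M2.
pose proof (Hbad n) as (B1 & B2 & B3 & B4 & B5).
specialize (Hp n); specialize (Hq n); cbv beta in Hp, Hq.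
destruct (st n) as [x y]; simpl in B1, B2, B3, B4, B5, Hp, Hq.
assert (HXW : X / 2 ^ n <= W / 2 ^ n).
{ unfold Rdiv; apply Rmult_le_compat_r; [left; apply Rinv_0_lt_compat; lra|unfold W; lra]. }
assert (HYW : Y / 2 ^ n <= W / 2 ^ n).
{ unfold Rdiv; apply Rmult_le_compat_r; [left; apply Rinv_0_lt_compat; lra|unfold W; lra]. }
assert (HXYW : X / 2 ^ n + Y / 2 ^ n < W / 2 ^ n).
{ unfold Rdiv; rewrite <- Rmult_plus_distr_r; apply Rmult_lt_compat_r; [apply Rinv_0_lt_compat; lra|unfold W; lra]. }
pose proof (Hpos X n HX); pose proof (Hpos Y n HY).
set (e := tau / (4 * W ^ 2)) in *.
assert (Hloc : Rabs (circulation A B x (x + X / 2 ^ n) y (y + Y / 2 ^ n)) <=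
   2 * e * (W / 2 ^ n) * ((x + X / 2 ^ n - x) + (y + Y / 2 ^ n - y))).
{ apply (circulation_local p q l m1 m2); try lra.
  - intros u v Hu Hv.
    assert (U1 : Rabs (u - p) <= W / 2 ^ n) by (apply Rabs_le_between; lra).
    assert (U2 : Rabs (v - q) <= W / 2 ^ n) by (apply Rabs_le_between; lra).
    eapply Rle_trans; [apply Hd1; lra|].
    apply Rmult_le_compat_l; [lra|apply Rmax_case; lra].
  - intros u v Hu Hv.
    assert (U1 : Rabs (u - p) <= W / 2 ^ n) by (apply Rabs_le_between; lra).
    assert (U2 : Rabs (v - q) <= W / 2 ^ n) by (apply Rabs_le_between; lra).
    eapply Rle_trans; [apply Hd2; lra|].
    apply Rmult_le_compat_l; [lra|apply Rmax_case; lra]. }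
assert (Hfin : 2 * e * (W / 2 ^ n) * ((x + X / 2 ^ n - x) + (y + Y / 2 ^ n - y)) <= tau / 4 ^ n / 2).
{ apply Rle_trans with (2 * e * (W / 2 ^ n) * (W / 2 ^ n)).
  - apply Rmult_le_compat_l; [|lra].
    apply Rmult_le_pos; [lra|left; apply Rdiv_lt_0_compat; lra].
  - right; unfold e. replace 4 with (2 * 2) at 2 by ring. rewrite Rpow_mult_distr. field; split; lra. }
assert (0 < tau / 4 ^ n) by (apply Rdiv_lt_0_compat; [lra|apply pow_lt; lra]).
lra.
Qed.

End Goursat.

(** * Complex derivatives and Cauchy's theorem in polar coordinates *)


Lemma Cnorm_Cmod z : Cnorm z = Cmod z.
Proof. unfold Cnorm, Cmod; f_equal; ring. Qed.

Lemma has_cderiv_at (f : C -> C) (z l : C) :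
  has_cderiv f z l <-> forall eps, 0 < eps -> exists d, 0 < d /\
    forall w, Cmod (w - z) < d -> Cmod (f w - f z - l * (w - z)) <= eps * Cmod (w - z).
Proof.
split; intros H eps He; destruct (H eps He) as [d [Hd Hf]]; exists d; split; auto.
- intros w Hw; specialize (Hf (w - z)%C); rewrite !Cnorm_Cmod in Hf.
  replace (Cadd z (w - z)%C) with w in Hf by (destruct w, z; unfold Cadd; simpl; f_equal; ring).
  exact (Hf Hw).
- intros h Hh; rewrite Cnorm_Cmod in Hh; rewrite !Cnorm_Cmod.
  specialize (Hf (Cadd z h)).
  replace (Cadd z h - z)%C with h in Hf
    by (destruct h, z; unfold Cadd, Cminus, Cplus, Copp; simpl; f_equal; ring).
  exact (Hf Hh).
Qed.

Lemma has_cderiv_ext (f f' : C -> C) (z l : C) : (forall w, f w = f' w) -> has_cderiv f z l -> has_cderiv f' z l.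
Proof.
intros E; rewrite !has_cderiv_at; intros H eps He; destruct (H eps He) as [d [Hd Hf]].
exists d; split; [exact Hd|]; intros w Hw; rewrite <- !E; auto.
Qed.

Lemma has_cderiv_const (c z : C) : has_cderiv (fun _ => c) z (RtoC 0).
Proof.
apply has_cderiv_at; intros eps He; exists 1; split; [lra|]; intros w _.
replace (c - c - 0 * (w - z))%C with (RtoC 0) by ring.
rewrite Cmod_0; apply Rmult_le_pos; [lra|apply Cmod_ge_0].
Qed.

Lemma has_cderiv_sub_const (f : C -> C) (c z l : C) : has_cderiv f z l -> has_cderiv (fun w => f w - c)%C z l.
Proof.
rewrite !has_cderiv_at; intros H eps He; destruct (H eps He) as [d [Hd Hf]].
exists d; split; [exact Hd|]; intros w Hw.
replace (f w - c - (f z - c) - l * (w - z))%C with (f w - f z - l * (w - z))%C by ring; auto.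
Qed.

Lemma has_cderiv_lip (f : C -> C) (z l : C) : has_cderiv f z l ->
  exists d, 0 < d /\ forall w, Cmod (w - z) < d -> Cmod (f w - f z) <= (Cmod l + 1) * Cmod (w - z).
Proof.
rewrite has_cderiv_at; intros H; destruct (H 1 Rlt_0_1) as [d [Hd Hf]].
exists d; split; [exact Hd|]; intros w Hw; specialize (Hf w Hw).
replace (f w - f z)%C with ((f w - f z - l * (w - z)) + l * (w - z))%C by ring.
eapply Rle_trans; [apply Cmod_triangle|]; rewrite Cmod_mult; lra.
Qed.

Lemma has_cderiv_mult (f g : C -> C) (z l m : C) : has_cderiv f z l -> has_cderiv g z m ->
  has_cderiv (fun w => f w * g w)%C z (l * g z + f z * m)%C.
Proof.
intros Hf Hg; destruct (has_cderiv_lip _ _ _ Hg) as [d0 [Hd0 Hlip]].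
rewrite has_cderiv_at in Hf, Hg; apply has_cderiv_at; intros eps He.
pose proof (Cmod_ge_0 (g z)) as P1; pose proof (Cmod_ge_0 (f z)) as P2.
pose proof (Cmod_ge_0 l) as P3; pose proof (Cmod_ge_0 m) as P4.
set (K := Cmod (g z) + Cmod m + 1).
assert (HK : 0 < K) by (unfold K; lra).
set (L := (Cmod l + 1) * (Cmod m + 1)).
assert (HL : 0 < L) by (unfold L; apply Rmult_lt_0_compat; lra).
destruct (Hf (eps / (3 * K))) as [d1 [Hd1 H1]]; [apply Rdiv_lt_0_compat; lra|].
destruct (Hg (eps / (3 * (Cmod (f z) + 1)))) as [d2 [Hd2 H2]]; [apply Rdiv_lt_0_compat; lra|].
exists (Rmin (Rmin d0 d1) (Rmin d2 (Rmin 1 (eps / (3 * L))))).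
split.
{ repeat apply Rmin_case; try lra; apply Rdiv_lt_0_compat; lra. }
intros w Hw.
apply Rmin_Rgt in Hw; destruct Hw as [Hw1 Hw2]; apply Rmin_Rgt in Hw1; destruct Hw1 as [Hw0 Hw1].
apply Rmin_Rgt in Hw2; destruct Hw2 as [Hw2 Hw3]; apply Rmin_Rgt in Hw3; destruct Hw3 as [Hw3 Hw4].
specialize (Hlip w Hw0); specialize (H1 w Hw1); specialize (H2 w Hw2).
pose proof (Cmod_ge_0 (w - z)) as P5.
set (h := Cmod (w - z)) in *.
replace (f w * g w - f z * g z - (l * g z + f z * m) * (w - z))%C with
  ((f w - f z - l * (w - z)) * (g z + (g w - g z)) + (l * (w - z) * (g w - g z)
   + f z * (g w - g z - m * (w - z))))%C by ring.
assert (Q1 : Cmod ((f w - f z - l * (w - z)) * (g z + (g w - g z))) <= eps / 3 * h).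
{ rewrite Cmod_mult.
  apply Rle_trans with (eps / (3 * K) * h * K); [|right; field; lra].
  apply Rmult_le_compat; try apply Cmod_ge_0; [exact H1|].
  eapply Rle_trans; [apply Cmod_triangle|]. unfold K.
  assert ((Cmod m + 1) * h <= (Cmod m + 1) * 1) by (apply Rmult_le_compat_l; lra). lra. }
assert (Q2 : Cmod (l * (w - z) * (g w - g z)) <= eps / 3 * h).
{ rewrite !Cmod_mult; fold h.
  apply Rle_trans with ((Cmod l + 1) * h * ((Cmod m + 1) * h)).
  - apply Rmult_le_compat; [apply Rmult_le_pos; lra|apply Cmod_ge_0| |exact Hlip].
    apply Rmult_le_compat_r; lra.
  - replace ((Cmod l + 1) * h * ((Cmod m + 1) * h)) with (L * h * h) by (unfold L; ring).
    apply Rmult_le_compat_r; [lra|].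
    apply Rle_trans with (L * (eps / (3 * L))); [apply Rmult_le_compat_l; lra|right; field; lra]. }
assert (Q3 : Cmod (f z * (g w - g z - m * (w - z))) <= eps / 3 * h).
{ rewrite Cmod_mult.
  apply Rle_trans with ((Cmod (f z) + 1) * (eps / (3 * (Cmod (f z) + 1)) * h)); [|right; field; lra].
  apply Rmult_le_compat; try apply Cmod_ge_0; [lra|exact H2]. }
eapply Rle_trans; [apply Cmod_triangle|].
pose proof (Cmod_triangle (l * (w - z) * (g w - g z))%C (f z * (g w - g z - m * (w - z)))%C).
lra.
Qed.

Lemma Cminus_neq_0 (z w : C) : z <> w -> (z - w)%C <> RtoC 0.
Proof.
intros H E; apply H. replace z with (z - w + w)%C by ring; rewrite E; ring.
Qed.

Lemma has_cderiv_inv_sub (z0 z : C) : z <> z0 ->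
  has_cderiv (fun w => / (w - z0))%C z (- / ((z - z0) * (z - z0)))%C.
Proof.
intros Hz; apply Cminus_neq_0 in Hz; apply has_cderiv_at; intros eps He.
set (u := Cmod (z - z0)).
assert (Hu : 0 < u) by (apply Cmod_gt_0; exact Hz).
assert (Hd : 0 < eps * u ^ 3 / 2) by (apply Rdiv_lt_0_compat; [apply Rmult_lt_0_compat; [lra|apply pow_lt; lra]|lra]).
exists (Rmin (u / 2) (eps * u ^ 3 / 2)); split.
{ apply Rmin_case; lra. }
intros w Hw; apply Rmin_Rgt in Hw; destruct Hw as [Hw1 Hw2].
assert (Hv : u / 2 <= Cmod (w - z0)).
{ pose proof (Cmod_triangle (w - z0)%C (- (w - z))%C) as T; rewrite Cmod_opp in T.
  replace (w - z0 + - (w - z))%C with (z - z0)%C in T by ring; fold u in T; lra. }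
assert (Hw0 : (w - z0)%C <> RtoC 0) by (apply Cmod_gt_0; lra).
replace (/ (w - z0) - / (z - z0) - - / ((z - z0) * (z - z0)) * (w - z))%C
  with ((w - z) * (w - z) * / ((z - z0) * (z - z0) * (w - z0)))%C by (field; split; assumption).
rewrite !Cmod_mult, Cmod_inv, !Cmod_mult.
2:{ apply Cmult_neq_0; [apply Cmult_neq_0|]; assumption. }
fold u; set (h := Cmod (w - z)) in *; assert (Hh : 0 <= h) by apply Cmod_ge_0.
assert (/ (u * u * Cmod (w - z0)) <= 2 / u ^ 3).
{ replace (2 / u ^ 3) with (/ (u * u * (u / 2))) by (field; lra).
  apply Rinv_le_contravar; [apply Rmult_lt_0_compat; nra|apply Rmult_le_compat_l; nra]. }
apply Rle_trans with (h * h * (2 / u ^ 3)); [apply Rmult_le_compat_l; nra|].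
replace (h * h * (2 / u ^ 3)) with ((h * (2 / u ^ 3)) * h) by ring.
apply Rmult_le_compat_r; [lra|].
apply Rle_trans with (eps * u ^ 3 / 2 * (2 / u ^ 3)); [|right; field; lra].
apply Rmult_le_compat_r; [|lra]. left; apply Rdiv_lt_0_compat; [lra|apply pow_lt; lra].
Qed.

(** Membership in [Dspace] only provides some derivative function; uniqueness identifies it with the
    one given by the product rule. Testing real increments suffices. *)
Lemma has_cderiv_unique (f : C -> C) (z l m : C) : has_cderiv f z l -> has_cderiv f z m -> l = m.
Proof.
rewrite !has_cderiv_at; intros H1 H2.
assert (HE : (l - m)%C = RtoC 0).
{ apply Cmod_eq_0. destruct (Rle_lt_or_eq_dec 0 (Cmod (l - m)) (Cmod_ge_0 _)) as [Hp|]; [exfalso|auto].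
  destruct (H1 (Cmod (l - m) / 4)) as [d1 [Hd1 K1]]; [lra|].
  destruct (H2 (Cmod (l - m) / 4)) as [d2 [Hd2 K2]]; [lra|].
  assert (Hd : 0 < Rmin d1 d2) by (apply Rmin_case; lra).
  set (h := Rmin d1 d2 / 2).
  assert (E : (z + RtoC h - z)%C = RtoC h) by ring.
  assert (Hh : Cmod (RtoC h) = h) by (rewrite Cmod_R; apply Rabs_right; unfold h; lra).
  pose proof (Rmin_l d1 d2); pose proof (Rmin_r d1 d2).
  specialize (K1 (z + RtoC h)%C); specialize (K2 (z + RtoC h)%C); rewrite E, Hh in K1, K2.
  specialize (K1 ltac:(unfold h; lra)); specialize (K2 ltac:(unfold h; lra)).
  pose proof (Cmod_triangle (f (z + RtoC h) - f z - m * RtoC h)%C (- (f (z + RtoC h) - f z - l * RtoC h))%C) as T.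
  rewrite Cmod_opp in T.
  replace (f (z + RtoC h) - f z - m * RtoC h + - (f (z + RtoC h) - f z - l * RtoC h))%C
    with ((l - m) * RtoC h)%C in T by ring.
  rewrite Cmod_mult, Hh in T. assert (0 < h) by (unfold h; lra). nra. }
replace l with (l - m + m)%C by ring; rewrite HE; ring.
Qed.

Definition polar (r t : R) : C := (r * cos t, r * sin t).

Lemma Cmod_polar r t : Cmod (polar r t) = Rabs r.
Proof.
unfold Cmod, polar; simpl fst; simpl snd.
replace ((r * cos t) ^ 2 + (r * sin t) ^ 2) with (Rsqr r).
- apply sqrt_Rsqr_abs.
- pose proof (sin2_cos2 t); unfold Rsqr in *.
  replace ((r * cos t) ^ 2 + (r * sin t) ^ 2) with (r * r * (sin t * sin t + cos t * cos t)) by ring.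
  rewrite H; ring.
Qed.

(** The Cauchy-Riemann equations. The factor [sqrt 2] passes between the modulus and the maximum
    norm of [differentiable_pt_lim]. *)
Lemma has_cderiv_differentiable (f : C -> C) x y (l : C) : has_cderiv f (x, y) l ->
  differentiable_pt_lim (fun u v => fst (f (u, v))) x y (fst l) (- snd l) /\
  differentiable_pt_lim (fun u v => snd (f (u, v))) x y (snd l) (fst l).
Proof.
rewrite has_cderiv_at; intros H.
assert (Hs : 0 < sqrt 2) by (apply sqrt_lt_R0; lra).
assert (K : forall eps : posreal, locally_2d (fun u v =>
   Cmod (f (u, v) - f (x, y) - l * ((u, v) - (x, y))) <= eps * Rmax (Rabs (u - x)) (Rabs (v - y))) x y).
{ intros eps; destruct (H (eps / sqrt 2)) as [d [Hd Hf]].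
  { apply Rdiv_lt_0_compat; [apply cond_pos|lra]. }
  assert (Hd' : 0 < d / sqrt 2) by (apply Rdiv_lt_0_compat; lra).
  exists (mkposreal _ Hd'); simpl; intros u v Hu Hv.
  pose proof (Cmod_2Rmax ((u, v) - (x, y))%C) as M; simpl in M.
  change (u + - x) with (u - x) in M; change (v + - y) with (v - y) in M.
  assert (M2 : Rmax (Rabs (u - x)) (Rabs (v - y)) < d / sqrt 2) by (apply Rmax_case; assumption).
  assert (M3 : Cmod ((u, v) - (x, y)) < d).
  { eapply Rle_lt_trans; [exact M|]. apply (Rmult_lt_compat_l (sqrt 2)) in M2; [|lra].
    replace (sqrt 2 * (d / sqrt 2)) with d in M2 by (field; lra). exact M2. }
  eapply Rle_trans; [apply Hf, M3|].
  replace (eps * Rmax (Rabs (u - x)) (Rabs (v - y))) with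
    (eps / sqrt 2 * (sqrt 2 * Rmax (Rabs (u - x)) (Rabs (v - y)))) by (field; lra).
  apply Rmult_le_compat_l; [|exact M].
  left; apply Rdiv_lt_0_compat; [apply cond_pos|lra]. }
split; intros eps; destruct (K eps) as [d Hd]; exists d; intros u v Hu Hv; specialize (Hd u v Hu Hv);
  (eapply Rle_trans; [|exact Hd]); pose proof (Rmax_Cmod (f (u, v) - f (x, y) - l * ((u, v) - (x, y)))%C) as M;
  (eapply Rle_trans; [|exact M]).
- eapply Rle_trans; [|apply Rmax_l]; right; f_equal; simpl; ring.
- eapply Rle_trans; [|apply Rmax_r]; right; f_equal; simpl; ring.
Qed.

Lemma differentiable_pt_lim_mult f g x y fx fy gx gy :
  differentiable_pt_lim f x y fx fy -> differentiable_pt_lim g x y gx gy ->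
  differentiable_pt_lim (fun u v => f u v * g u v) x y
    (g x y * fx + f x y * gx) (g x y * fy + f x y * gy).
Proof.
intros Hf Hg; apply (differentiable_pt_lim_comp (fun u v => u * v)); auto.
intros eps; exists eps; intros u v Hu Hv.
replace (u * v - f x y * g x y - (g x y * (u - f x y) + f x y * (v - g x y)))
  with ((u - f x y) * (v - g x y)) by ring.
rewrite Rabs_mult. apply Rmult_le_compat; try apply Rabs_pos; [lra|apply Rmax_r].
Qed.

Lemma differentiable_pt_lim_plus f g x y fx fy gx gy :
  differentiable_pt_lim f x y fx fy -> differentiable_pt_lim g x y gx gy ->
  differentiable_pt_lim (fun u v => f u v + g u v) x y (fx + gx) (fy + gy).
Proof.
intros Hf Hg.
replace (fx + gx) with (1 * fx + 1 * gx) by ring; replace (fy + gy) with (1 * fy + 1 * gy) by ring.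
apply (differentiable_pt_lim_comp (fun u v => u + v)); auto.
intros eps; exists eps; intros u v Hu Hv.
replace (u + v - (f x y + g x y) - (1 * (u - f x y) + 1 * (v - g x y))) with 0 by ring.
rewrite Rabs_R0; apply Rmult_le_pos; [left; apply cond_pos|].
eapply Rle_trans; [apply Rabs_pos|apply Rmax_l].
Qed.

Lemma differentiable_pt_lim_snd f x y l : derivable_pt_lim f y l ->
  differentiable_pt_lim (fun _ v => f v) x y 0 l.
Proof.
intros H.
assert (E : differentiable_pt_lim (fun u v : R => v) x y 0 1).
{ intros eps; exists eps; intros u v Hu Hv.
  replace (v - y - (0 * (u - x) + 1 * (v - y))) with 0 by ring.
  rewrite Rabs_R0; apply Rmult_le_pos; [left; apply cond_pos|].
  eapply Rle_trans; [apply Rabs_pos|apply Rmax_l]. }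
replace 0 with (l * 0 + 0 * 0) by ring; replace l with (l * 1 + 0 * 1) at 2 by ring.
apply (differentiable_pt_lim_comp (fun u _ => f u) (fun _ v => v) (fun _ v => v)); auto.
apply (differentiable_pt_lim_proj1_0 f); exact H.
Qed.

Lemma differentiable_pt_lim_radius x y : differentiable_pt_lim (fun u _ => u) x y 1 0.
Proof. apply (differentiable_pt_lim_proj1_0 (fun u => u)), derivable_pt_lim_id. Qed.

Lemma differentiable_polar (f : C -> C) r t (l : C) : has_cderiv f (polar r t) l ->
  differentiable_pt_lim (fun r t => fst (f (polar r t))) r t
    (fst l * cos t - snd l * sin t) (- (r * (fst l * sin t + snd l * cos t))) /\
  differentiable_pt_lim (fun r t => snd (f (polar r t))) r t
    (snd l * cos t + fst l * sin t) (r * (fst l * cos t - snd l * sin t)).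
Proof.
intros H; apply has_cderiv_differentiable in H; destruct H as [H1 H2].
pose proof (differentiable_pt_lim_mult _ _ _ _ _ _ _ _ (differentiable_pt_lim_radius r t)
  (differentiable_pt_lim_snd cos r t _ (derivable_pt_lim_cos t))) as X.
pose proof (differentiable_pt_lim_mult _ _ _ _ _ _ _ _ (differentiable_pt_lim_radius r t)
  (differentiable_pt_lim_snd sin r t _ (derivable_pt_lim_sin t))) as Y.
split.
- pose proof (differentiable_pt_lim_comp _ _ _ _ _ _ _ _ _ _ _ H1 X Y) as Z.
  match type of Z with differentiable_pt_lim _ _ _ ?a ?b =>
    replace (fst l * cos t - snd l * sin t) with a by ring;
    replace (- (r * (fst l * sin t + snd l * cos t))) with b by ring end.
  exact Z.
- pose proof (differentiable_pt_lim_comp _ _ _ _ _ _ _ _ _ _ _ H2 X Y) as Z.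
  match type of Z with differentiable_pt_lim _ _ _ ?a ?b =>
    replace (snd l * cos t + fst l * sin t) with a by ring;
    replace (r * (fst l * cos t - snd l * sin t)) with b by ring end.
  exact Z.
Qed.

Lemma differentiable_lim_continuity f x y lx ly : differentiable_pt_lim f x y lx ly -> continuity_2d_pt f x y.
Proof. intros H; apply differentiable_continuity_pt; exists lx, ly; exact H. Qed.

Lemma continuity_polar (f : C -> C) r t : (exists l, has_cderiv f (polar r t) l) ->
  continuity_2d_pt (fun r t => fst (f (polar r t))) r t /\
  continuity_2d_pt (fun r t => snd (f (polar r t))) r t.
Proof.
intros [l H]; apply differentiable_polar in H; destruct H as [H1 H2].
split; eapply differentiable_lim_continuity; eassumption.
Qed.

(** With [A] and [B] as in the proof, [B dr + A dt] is the imaginary part of [F dz] in polar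
    coordinates. On the rectangle of radii in [[0, r]] and angles in [[0, 2 * PI]], the side at
    radius 0 contributes nothing because [A] vanishes there, and the sides at angles 0 and [2 * PI]
    cancel by periodicity; Goursat's theorem leaves exactly the circle. *)
Lemma cauchy_polar (F : C -> C) r : 0 <= r < 1 ->
  (forall z, Cmod z < 1 -> exists l, has_cderiv F z l) ->
  RInt (fun t => Re (polar r t * F (polar r t))%C) 0 (2 * PI) = 0.
Proof.
intros Hr HF.
set (A := fun r t => r * cos t * fst (F (polar r t)) + - (r * sin t) * snd (F (polar r t))).
set (B := fun r t => cos t * snd (F (polar r t)) + sin t * fst (F (polar r t))).
assert (HD : forall x y, 0 <= x <= r -> exists l m1 m2,
  differentiable_pt_lim A x y l m1 /\ differentiable_pt_lim B x y m2 l).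
{ intros x y Hx. destruct (HF (polar x y)) as [l Hl].
  { rewrite Cmod_polar, Rabs_right; lra. }
  apply differentiable_polar in Hl; destruct Hl as [H1 H2].
  pose proof (differentiable_pt_lim_snd cos x y _ (derivable_pt_lim_cos y)) as Kc.
  pose proof (differentiable_pt_lim_snd sin x y _ (derivable_pt_lim_sin y)) as Ks.
  pose proof (differentiable_pt_lim_radius x y) as Kr.
  assert (Kn : differentiable_pt_lim (fun _ _ => -1) x y 0 0).
  { intros eps; exists eps; intros u v Hu Hv.
    replace (-1 - -1 - (0 * (u - x) + 0 * (v - y))) with 0 by ring.
    rewrite Rabs_R0; apply Rmult_le_pos; [left; apply cond_pos|].
    eapply Rle_trans; [apply Rabs_pos|apply Rmax_l]. }
  pose proof (differentiable_pt_lim_plus _ _ _ _ _ _ _ _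
    (differentiable_pt_lim_mult _ _ _ _ _ _ _ _ (differentiable_pt_lim_mult _ _ _ _ _ _ _ _ Kr Kc) H1)
    (differentiable_pt_lim_mult _ _ _ _ _ _ _ _
      (differentiable_pt_lim_mult _ _ _ _ _ _ _ _ Kn (differentiable_pt_lim_mult _ _ _ _ _ _ _ _ Kr Ks)) H2)) as ZA.
  pose proof (differentiable_pt_lim_plus _ _ _ _ _ _ _ _
    (differentiable_pt_lim_mult _ _ _ _ _ _ _ _ Kc H2)
    (differentiable_pt_lim_mult _ _ _ _ _ _ _ _ Ks H1)) as ZB.
  eexists _, _, _; split.
  - eapply differentiable_pt_lim_ext; [|exact ZA].
    apply locally_2d_forall; intros u v; unfold A; ring.
  (* Closedness of the form: the angular derivative of [B] agrees with the radial derivative found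
     for [A]. *)
  - refine (eq_ind _ (differentiable_pt_lim B x y _) ZB _ _); ring. }
assert (HA : forall x y, 0 <= x <= r -> 0 <= y <= 2 * PI -> continuity_2d_pt A x y).
{ intros x y Hx _; destruct (HD x y Hx) as (l & m1 & m2 & K1 & K2); eapply differentiable_lim_continuity, K1. }
assert (HB : forall x y, 0 <= x <= r -> 0 <= y <= 2 * PI -> continuity_2d_pt B x y).
{ intros x y Hx _; destruct (HD x y Hx) as (l & m1 & m2 & K1 & K2); eapply differentiable_lim_continuity, K2. }
pose proof PI_RGT_0.
pose proof (goursat_rectangle A B 0 r 0 (2 * PI) HA HB (fun x y Hx _ => HD x y Hx) ltac:(lra) ltac:(lra)) as G.
unfold circulation in G.
rewrite (RInt_ext (A 0) (fun _ => 0)) in G by (intros; change (A 0 x = 0); unfold A; ring).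
rewrite RInt_const in G.
rewrite (RInt_ext (fun x => B x (2 * PI)) (fun x => B x 0)) in G.
2:{ intros x _; unfold B, polar; rewrite cos_2PI, sin_2PI, cos_0, sin_0; reflexivity. }
rewrite (RInt_ext _ (A r)).
- unfold scal in G; simpl in G; unfold mult in G; simpl in G; lra.
- intros x _; unfold A, polar, Re, Cmult; simpl; ring.
Qed.

(** * Means of |g|^2 over circles *)


(** At [z0] the product vanishes whatever the inverse of 0 is, and the derivative there is
    [l0 * l0]. With [v] the linearisation error of [g], the remainder is
    [v * (2 * l0 + v / (w - z0))], whose second factor stays bounded. *)
Lemma has_cderiv_div_sub_sq (g : C -> C) (z0 z l l0 : C) :
  has_cderiv g z l -> has_cderiv g z0 l0 ->
  exists m, has_cderiv (fun w => (g w - g z0) * (g w - g z0) * / (w - z0))%C z m.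
Proof.
intros Hl Hl0; destruct (excluded_middle_informative (z = z0)) as [->|Hz].
- exists (l0 * l0)%C; apply has_cderiv_at; intros eps He.
  rewrite has_cderiv_at in Hl0.
  pose proof (Cmod_ge_0 l0) as P.
  set (e := Rmin 1 (eps / (2 * Cmod l0 + 1))).
  assert (He1 : 0 < e) by (apply Rmin_case; [lra|apply Rdiv_lt_0_compat; lra]).
  destruct (Hl0 e He1) as [d [Hd Hf]].
  exists d; split; [exact Hd|]; intros w Hw.
  destruct (excluded_middle_informative (w = z0)) as [->|Hw0].
  { replace ((g z0 - g z0) * (g z0 - g z0) * / (z0 - z0) -
      (g z0 - g z0) * (g z0 - g z0) * / (z0 - z0) - l0 * l0 * (z0 - z0))%C with (RtoC 0) by ring.
    rewrite Cmod_0; apply Rmult_le_pos; [lra|apply Cmod_ge_0]. }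
  specialize (Hf w Hw); apply Cminus_neq_0 in Hw0.
  set (v := (g w - g z0 - l0 * (w - z0))%C) in *.
  replace ((g z0 - g z0) * (g z0 - g z0) * / (z0 - z0))%C with (RtoC 0) by ring.
  replace ((g w - g z0) * (g w - g z0) * / (w - z0) - RtoC 0 - l0 * l0 * (w - z0))%C
    with (v * (RtoC 2 * l0 + v * / (w - z0)))%C by (unfold v; field; exact Hw0).
  set (h := Cmod (w - z0)) in *.
  assert (Hh : 0 < h) by (apply Cmod_gt_0; exact Hw0).
  rewrite Cmod_mult.
  assert (M : Cmod (RtoC 2 * l0 + v * / (w - z0)) <= 2 * Cmod l0 + 1).
  { eapply Rle_trans; [apply Cmod_triangle|]; rewrite !Cmod_mult, Cmod_inv, Cmod_R, Rabs_right by (try assumption; lra).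
    fold h; apply Rplus_le_compat_l.
    apply (Rmult_le_reg_r h); [exact Hh|]. rewrite Rmult_assoc, Rinv_l by lra.
    pose proof (Rmin_l 1 (eps / (2 * Cmod l0 + 1))) as Q; fold e in Q.
    assert (e * h <= 1 * h) by (apply Rmult_le_compat_r; lra). lra. }
  apply Rle_trans with (e * h * (2 * Cmod l0 + 1)).
  + apply Rmult_le_compat; try apply Cmod_ge_0; assumption.
  + pose proof (Rmin_r 1 (eps / (2 * Cmod l0 + 1))) as Q; fold e in Q.
    apply (Rmult_le_compat_r (2 * Cmod l0 + 1)) in Q; [|lra].
    replace (eps / (2 * Cmod l0 + 1) * (2 * Cmod l0 + 1)) with eps in Q by (field; lra).
    apply (Rmult_le_compat_r h) in Q; [|lra].
    replace (e * h * (2 * Cmod l0 + 1)) with (e * (2 * Cmod l0 + 1) * h) by ring; exact Q.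
- eexists; apply has_cderiv_mult; [apply has_cderiv_mult|apply has_cderiv_inv_sub, Hz];
    apply has_cderiv_sub_const; exact Hl.
Qed.

(** Twice this real part minus 1 is the Poisson kernel [(|z|^2 - |z0|^2) / |z - z0|^2], which is
    positive. *)
Lemma Re_poisson (z z0 : C) : Cmod z0 < Cmod z -> 1 / 2 <= Re (z * / (z - z0))%C.
Proof.
intros H.
assert (H2 : Cmod z0 ^ 2 < Cmod z ^ 2).
{ pose proof (Cmod_ge_0 z0); simpl; nra. }
rewrite !Cmod2_alt in H2.
destruct z as [x y], z0 as [a b]; unfold Re, Im in *; simpl in *.
assert (Hp : 0 < (x + - a) * ((x + - a) * 1) + (y + - b) * ((y + - b) * 1)).
{ destruct (Req_dec x a) as [->|Hx].
  - destruct (Req_dec y b) as [->|Hy]; [exfalso; lra|].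
    pose proof (Rsqr_pos_lt (y - b) ltac:(lra)) as S; unfold Rsqr in S; lra.
  - pose proof (Rsqr_pos_lt (x - a) ltac:(lra)) as S; pose proof (Rle_0_sqr (y - b)) as S';
    unfold Rsqr in S, S'; lra. }
set (D := (x + - a) * ((x + - a) * 1) + (y + - b) * ((y + - b) * 1)) in *.
apply (Rmult_le_reg_r D); [exact Hp|].
replace ((x * ((x + - a) / D) - y * (- (y + - b) / D)) * D) with (x * (x + - a) + y * (y + - b)) by (field; lra).
unfold D; nra.
Qed.

Lemma Re_ge_opp_Cmod (z : C) : - Cmod z <= Re z.
Proof. pose proof (re_le_Cmod z) as H; apply Rabs_le_between in H; lra. Qed.

Lemma Cmod2_polar_continuous (g : C -> C) r t : (exists l, has_cderiv g (polar r t) l) ->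
  continuity_2d_pt (fun r t => Cmod (g (polar r t)) ^ 2) r t.
Proof.
intros H; apply continuity_polar in H; destruct H as [H1 H2].
apply (continuity_2d_pt_ext (fun r t => fst (g (polar r t)) * fst (g (polar r t)) + snd (g (polar r t)) * snd (g (polar r t)))).
{ intros x y; rewrite Cmod2_alt; unfold Re, Im; ring. }
apply continuity_2d_pt_plus; apply continuity_2d_pt_mult; assumption.
Qed.

Lemma ex_RInt_continuity_2d (f : R -> R -> R) r a b :
  (forall t, continuity_2d_pt f r t) -> ex_RInt (f r) a b.
Proof.
intros H; apply (ex_RInt_continuous (V := R_CompleteNormedModule)); intros t _; apply continuity_2d_pt_snd, H.
Qed.

(* The square of [g - g z0] makes [(g - g z0)^2 / (z - z0)] differentiable at [z0] too, so that
   Cauchy's theorem applies to it; expanding the square bounds [|g z0|^4] by the mean of [|g|^2]. *)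
Lemma circle_mean_lower_bound (g : C -> C) (z0 : C) :
  (forall z, Cmod z < 1 -> exists l, has_cderiv g z l) -> Cmod z0 < 1 -> g z0 <> RtoC 0 ->
  exists c0 r0, 0 < c0 /\ 1 / 2 <= r0 < 1 /\
    forall r, r0 <= r < 1 -> c0 <= RInt (fun t => Cmod (g (polar r t)) ^ 2) 0 (2 * PI).
Proof.
intros Hg Hz0 Hne.
set (a := Cmod (g z0)).
assert (Ha : 0 < a) by (apply Cmod_gt_0; exact Hne).
(* [K] bounds the modulus of [z / (z - z0)] on circles of radius at least [(1 + Cmod z0) / 2].
   Below, [K2] is the coefficient of [|g|^2] once the cross term [2 K a^3 |g|] has been absorbed. *)
set (K := 2 / (1 - Cmod z0)).
assert (HK : 0 < K) by (apply Rdiv_lt_0_compat; lra).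
set (K2 := a ^ 2 * K + 4 * K ^ 2 * a ^ 2).
assert (Ha2 : 0 < a ^ 2) by (apply pow_lt; lra).
assert (HK2 : 0 < K2) by (unfold K2; apply Rplus_lt_0_compat; [|assert (0 < K ^ 2) by (apply pow_lt; lra)]; nra).
pose proof PI_RGT_0 as Hpi.
pose proof (Cmod_ge_0 z0) as Hz0'.
exists (a ^ 4 / 4 * (2 * PI) / K2), ((1 + Cmod z0) / 2); repeat split; try lra.
{ apply Rdiv_lt_0_compat; [|lra]. assert (0 < a ^ 4) by (apply pow_lt; lra). nra. }
intros r Hr.
(* This factor turns the constant term of the expanded square into [a ^ 4] times [z / (z - z0)],
   with real part at least [a ^ 4 / 2] by [Re_poisson]. *)
set (q := (Cconj (g z0) * Cconj (g z0))%C).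
set (F := fun w => (q * ((g w - g z0) * (g w - g z0) * / (w - z0)))%C).
assert (HF : forall z, Cmod z < 1 -> exists l, has_cderiv F z l).
{ intros z Hz; destruct (Hg z Hz) as [l Hl]; destruct (Hg z0 Hz0) as [l0 Hl0].
  destruct (has_cderiv_div_sub_sq g z0 z l l0 Hl Hl0) as [m Hm].
  eexists; apply (has_cderiv_mult (fun _ => q)); [apply has_cderiv_const|exact Hm]. }
pose proof (cauchy_polar F r ltac:(lra) HF) as HI.
assert (HM : Cmod q = a ^ 2) by (unfold q; rewrite Cmod_mult, Cmod_conj; fold a; ring).
assert (HP : forall t, a ^ 4 / 4 - K2 * Cmod (g (polar r t)) ^ 2 <= Re (polar r t * F (polar r t))%C).
{ intros t; set (z := polar r t).
  assert (Hz : Cmod z = r) by (unfold z; rewrite Cmod_polar, Rabs_right; lra).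
  set (k := (z * / (z - z0))%C).
  assert (Hzz : (z - z0)%C <> RtoC 0).
  { apply Cminus_neq_0; intros E; rewrite E in Hz; lra. }
  assert (Hk : Cmod k <= K).
  { unfold k; rewrite Cmod_mult, Cmod_inv, Hz by assumption.
    pose proof (Cmod_triangle (z - z0)%C z0) as T.
    replace (z - z0 + z0)%C with z in T by ring; rewrite Hz in T.
    unfold K. apply Rle_trans with (1 * / ((1 - Cmod z0) / 2)); [|right; field; lra].
    apply Rmult_le_compat; [lra|left; apply Rinv_0_lt_compat; lra|lra|].
    apply Rinv_le_contravar; lra. }
  assert (Hre : 1 / 2 <= Re k) by (apply Re_poisson; rewrite Hz; lra).
  set (v := g z); set (y := Cmod v).
  assert (E : (z * F z)%C = (RtoC (a ^ 4) * k + q * k * (v * v + RtoC (-2) * v * g z0))%C).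
  { unfold F; fold v.
    assert (Eq : (q * (g z0 * g z0))%C = RtoC (a ^ 4)).
    { unfold q. replace (Cconj (g z0) * Cconj (g z0) * (g z0 * g z0))%C
        with ((g z0 * Cconj (g z0)) * (g z0 * Cconj (g z0)))%C by ring.
      rewrite <- Cmod2_conj; fold a; rewrite <- RtoC_mult; f_equal; ring. }
    assert (E2 : RtoC (-2) = (- (RtoC 1 + RtoC 1))%C)
      by (unfold RtoC, Cplus, Copp; simpl; f_equal; ring).
    rewrite <- Eq, E2; unfold k; ring. }
  rewrite E.
  assert (Re1 : Re (RtoC (a ^ 4) * k + q * k * (v * v + RtoC (-2) * v * g z0))%C
    = a ^ 4 * Re k + Re (q * k * (v * v + RtoC (-2) * v * g z0))%C).
  { unfold Re, RtoC; simpl; ring. }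
  rewrite Re1.
  pose proof (Re_ge_opp_Cmod (q * k * (v * v + RtoC (-2) * v * g z0))%C) as L.
  assert (U : Cmod (q * k * (v * v + RtoC (-2) * v * g z0)) <= a ^ 2 * K * (y ^ 2 + 2 * y * a)).
  { rewrite !Cmod_mult, HM. apply Rmult_le_compat.
    - apply Rmult_le_pos; [lra|apply Cmod_ge_0].
    - apply Cmod_ge_0.
    - apply Rmult_le_compat_l; lra.
    - eapply Rle_trans; [apply Cmod_triangle|]. rewrite !Cmod_mult, Cmod_R.
      replace (Rabs (-2)) with 2 by (rewrite Rabs_left; lra). fold y a. right; ring. }
  assert (a ^ 4 * (1 / 2) <= a ^ 4 * Re k) by (apply Rmult_le_compat_l; [apply pow_le|]; lra).
  (* AM-GM: [2 K a^3 y <= a^4/4 + 4 K^2 a^2 y^2] *)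
  assert (0 <= a ^ 2 * (a / 2 - 2 * K * y) ^ 2) by (apply Rmult_le_pos; [lra|apply pow2_ge_0]).
  unfold K2; fold v y. nra. }
assert (HC : forall t, continuity_2d_pt (fun r t => Cmod (g (polar r t)) ^ 2) r t).
{ intros t; apply Cmod2_polar_continuous, Hg; rewrite Cmod_polar, Rabs_right; lra. }
pose proof (ex_RInt_continuity_2d (fun r t => Cmod (g (polar r t)) ^ 2) r 0 (2 * PI) HC) as HX.
set (I := RInt (fun t => Cmod (g (polar r t)) ^ 2) 0 (2 * PI)) in *.
assert (HL : RInt (fun t => a ^ 4 / 4 - K2 * Cmod (g (polar r t)) ^ 2) 0 (2 * PI) <= 0).
{ eapply Rle_trans; [|right; exact HI]. apply RInt_le; [lra| | |intros; apply HP].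
  - apply (ex_RInt_minus (V := R_CompleteNormedModule) (fun _ => a ^ 4 / 4) (fun t => K2 * Cmod (g (polar r t)) ^ 2)); [apply ex_RInt_const|].
    apply (ex_RInt_scal (V := R_CompleteNormedModule)); exact HX.
  - apply (ex_RInt_continuity_2d (fun r t => Re (polar r t * F (polar r t))%C)); intros t.
    destruct (HF (polar r t)) as [m Hm]; [rewrite Cmod_polar, Rabs_right; lra|].
    assert (Hid : has_cderiv (fun w : C => w) (polar r t) (RtoC 1)).
    { apply has_cderiv_at; intros eps He; exists 1; split; [lra|]; intros w _.
      replace (w - polar r t - RtoC 1 * (w - polar r t))%C with (RtoC 0) by ring.
      rewrite Cmod_0; apply Rmult_le_pos; [lra|apply Cmod_ge_0]. }
    pose proof (has_cderiv_mult _ _ _ _ _ Hid Hm) as HH.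
    apply (continuity_polar (fun w => (w * F w)%C)); eexists; exact HH. }
rewrite (RInt_minus (V := R_CompleteNormedModule) (fun _ => a ^ 4 / 4) (fun t => K2 * Cmod (g (polar r t)) ^ 2)) in HL.
2: apply ex_RInt_const.
2: apply (ex_RInt_scal (V := R_CompleteNormedModule)); exact HX.
rewrite RInt_const, (RInt_scal (V := R_CompleteNormedModule) (fun t => Cmod (g (polar r t)) ^ 2)) in HL by exact HX.
fold I in HL; unfold minus, plus, opp, scal in HL; simpl in HL; unfold mult in HL; simpl in HL.
apply (Rmult_le_reg_r K2); [exact HK2|].
unfold Rdiv at 1; rewrite (Rmult_assoc _ (/ K2)), Rinv_l by lra. simpl; lra.
Qed.

(** * The Rudin-Shapiro polynomials *)


(** [F'] plays the derivative; [L] bounds it and is also a Lipschitz constant, and [E] bounds the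
    second-order Taylor error. Such inequalities are stable under sums and products with explicit
    constants and pass to pointwise limits, so the limit function gets a derivative without any
    theory of uniform convergence. *)
Definition c2_bounded (F F' : C -> C) (R s L E : R) : Prop :=
  forall z w, Cmod z <= R -> Cmod w <= R ->
    Cmod (F z) <= s /\ Cmod (F' z) <= L /\ Cmod (F w - F z) <= L * Cmod (w - z) /\
    Cmod (F w - F z - F' z * (w - z)) <= E * Cmod (w - z) ^ 2.

Lemma c2_bounded_weaken F F' R s L E s' L' E' :
  c2_bounded F F' R s L E -> s <= s' -> L <= L' -> E <= E' -> c2_bounded F F' R s' L' E'.
Proof.
intros H Hs HL HE z w Hz Hw; destruct (H z w Hz Hw) as (H1 & H2 & H3 & H4).
pose proof (Cmod_ge_0 (w - z)) as P; pose proof (pow2_ge_0 (Cmod (w - z))) as P2.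
repeat split; try lra.
- eapply Rle_trans; [exact H3|apply Rmult_le_compat_r; assumption].
- eapply Rle_trans; [exact H4|apply Rmult_le_compat_r; assumption].
Qed.

Lemma c2_bounded_restrict F F' R R' s L E : R' <= R -> c2_bounded F F' R s L E -> c2_bounded F F' R' s L E.
Proof. intros HR H z w Hz Hw; apply H; lra. Qed.

Lemma c2_bounded_plus F F' G G' R s L E s' L' E' :
  c2_bounded F F' R s L E -> c2_bounded G G' R s' L' E' ->
  c2_bounded (fun z => F z + G z)%C (fun z => F' z + G' z)%C R (s + s') (L + L') (E + E').
Proof.
intros HF HG z w Hz Hw; destruct (HF z w Hz Hw) as (H1 & H2 & H3 & H4);
  destruct (HG z w Hz Hw) as (K1 & K2 & K3 & K4); repeat split.
- eapply Rle_trans; [apply Cmod_triangle|lra].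
- eapply Rle_trans; [apply Cmod_triangle|lra].
- replace (F w + G w - (F z + G z))%C with ((F w - F z) + (G w - G z))%C by ring.
  eapply Rle_trans; [apply Cmod_triangle|lra].
- replace (F w + G w - (F z + G z) - (F' z + G' z) * (w - z))%C
    with ((F w - F z - F' z * (w - z)) + (G w - G z - G' z * (w - z)))%C by ring.
  eapply Rle_trans; [apply Cmod_triangle|lra].
Qed.

Lemma c2_bounded_scal (b : R) F F' R s L E : c2_bounded F F' R s L E ->
  c2_bounded (fun z => RtoC b * F z)%C (fun z => RtoC b * F' z)%C R (Rabs b * s) (Rabs b * L) (Rabs b * E).
Proof.
intros HF z w Hz Hw; destruct (HF z w Hz Hw) as (H1 & H2 & H3 & H4); pose proof (Rabs_pos b) as Pb.
repeat split.
- rewrite Cmod_mult, Cmod_R; apply Rmult_le_compat_l; assumption.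
- rewrite Cmod_mult, Cmod_R; apply Rmult_le_compat_l; assumption.
- replace (b * F w - b * F z)%C with (b * (F w - F z))%C by ring.
  rewrite Cmod_mult, Cmod_R, Rmult_assoc; apply Rmult_le_compat_l; assumption.
- replace (b * F w - b * F z - b * F' z * (w - z))%C with (b * (F w - F z - F' z * (w - z)))%C by ring.
  rewrite Cmod_mult, Cmod_R, Rmult_assoc; apply Rmult_le_compat_l; assumption.
Qed.

Lemma c2_bounded_mult F F' G G' R s L E s' L' E' :
  c2_bounded F F' R s L E -> c2_bounded G G' R s' L' E' ->
  c2_bounded (fun z => F z * G z)%C (fun z => F' z * G z + F z * G' z)%C R
    (s * s') (L * s' + s * L') (E * s' + L * L' + s * E').
Proof.
intros HF HG z w Hz Hw; destruct (HF z w Hz Hw) as (H1 & H2 & H3 & H4);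
  destruct (HG z w Hz Hw) as (K1 & K2 & K3 & K4); destruct (HG w z Hw Hz) as (K5 & _).
set (h := Cmod (w - z)) in *.
repeat split.
- rewrite Cmod_mult; apply Rmult_le_compat; auto using Cmod_ge_0.
- eapply Rle_trans; [apply Cmod_triangle|]; rewrite !Cmod_mult.
  apply Rplus_le_compat; apply Rmult_le_compat; auto using Cmod_ge_0.
- replace (F w * G w - F z * G z)%C with ((F w - F z) * G w + F z * (G w - G z))%C by ring.
  eapply Rle_trans; [apply Cmod_triangle|]; rewrite !Cmod_mult.
  replace ((L * s' + s * L') * h) with (L * h * s' + s * (L' * h)) by ring.
  apply Rplus_le_compat; apply Rmult_le_compat; auto using Cmod_ge_0.
- replace (F w * G w - F z * G z - (F' z * G z + F z * G' z) * (w - z))%C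
    with ((F w - F z - F' z * (w - z)) * G w + (F' z * (w - z) * (G w - G z)
      + F z * (G w - G z - G' z * (w - z))))%C by ring.
  eapply Rle_trans; [apply Cmod_triangle|].
  eapply Rle_trans; [apply Rplus_le_compat_l, Cmod_triangle|]; rewrite !Cmod_mult; fold h.
  replace ((E * s' + L * L' + s * E') * h ^ 2) with (E * h ^ 2 * s' + (L * h * (L' * h) + s * (E' * h ^ 2))) by ring.
  apply Rplus_le_compat; [|apply Rplus_le_compat]; apply Rmult_le_compat; auto using Cmod_ge_0.
  + apply Rmult_le_pos; apply Cmod_ge_0.
  + apply Rmult_le_compat_r; [apply Cmod_ge_0|assumption].
Qed.

(** The natural second-order constant has [R ^ (n - 2)]; since [R >= 1 / 2], it is replaced by
    [4 * R ^ n], which keeps the induction free of that exponent. At [n = 0] the truncated [n - 1]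
    is harmless because of the factor [INR n]. *)
Lemma c2_bounded_pow n R : 1 / 2 <= R <= 1 ->
  c2_bounded (fun z => z ^ n)%C (fun z => RtoC (INR n) * z ^ (n - 1))%C R
    (R ^ n) (INR n * R ^ (n - 1)) (4 * INR n ^ 2 * R ^ n).
Proof.
intros HR; induction n as [|n IH].
- intros z w _ _; simpl. replace (1 - 1)%C with (RtoC 0) by ring.
  replace (0 - 0 * 1 * (w - z))%C with (RtoC 0) by ring.
  replace (0 * 1)%C with (RtoC 0) by ring.
  rewrite Cmod_0, Cmod_1; repeat split; lra.
- assert (HX : c2_bounded (fun z => z) (fun _ => RtoC 1) R R 1 0).
  { intros z w Hz Hw; rewrite Cmod_1.
    replace (w - z - 1 * (w - z))%C with (RtoC 0) by ring; rewrite Cmod_0; repeat split; lra. }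
  assert (HRn : forall m, 0 <= R ^ m) by (intros; apply pow_le; lra).
  assert (En : INR n * R ^ (n - 1) * R = INR n * R ^ n).
  { destruct n as [|n]; [simpl; ring|]. replace (S n - 1)%nat with n by lia; simpl pow; ring. }
  assert (Hn : 0 <= INR n) by apply pos_INR.
  pose proof (c2_bounded_mult _ _ _ _ _ _ _ _ _ _ _ IH HX) as HM.
  intros z w Hz Hw.
  assert (Ez : forall z : C, (INR n * z ^ (n - 1) * z)%C = (INR n * z ^ n)%C).
  { intros u; destruct n as [|n']; [simpl; ring|]. replace (S n' - 1)%nat with n' by lia; simpl Cpow; ring. }
  assert (HW := c2_bounded_weaken _ _ _ _ _ _ (R ^ S n) (INR (S n) * R ^ (S n - 1)) (4 * INR (S n) ^ 2 * R ^ S n) HM).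
  assert (HW' := HW ltac:(simpl; lra)); clear HW.
  replace (S n - 1)%nat with n in * by lia.
  specialize (HW' ltac:(rewrite S_INR; lra)).
  assert (HE : 4 * INR n ^ 2 * R ^ n * R + INR n * R ^ (n - 1) * 1 + R ^ n * 0 <= 4 * INR (S n) ^ 2 * R ^ S n).
  { rewrite S_INR; simpl pow.
    assert (INR n * R ^ (n - 1) <= 4 * INR n * (R * R ^ n)).
    { replace (4 * INR n * (R * R ^ n)) with (4 * (INR n * R ^ n) * R) by ring; rewrite <- En.
      assert (0 <= INR n * R ^ (n - 1)) by (apply Rmult_le_pos; [assumption|apply HRn]).
      assert (1 <= 4 * (R * R)) by nra. nra. }
    assert (0 <= R * R ^ n) by (apply Rmult_le_pos; [lra|apply HRn]). nra. }
  specialize (HW' HE z w Hz Hw); cbv beta in HW'.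
  rewrite Ez in HW'.
  replace (w ^ n * w)%C with (w ^ S n)%C in HW' by (simpl; ring).
  replace (z ^ n * z)%C with (z ^ S n)%C in HW' by (simpl; ring).
  replace (INR n * z ^ n + z ^ n * 1)%C with (INR (S n) * z ^ n)%C in HW' by (rewrite S_INR, RtoC_plus; ring).
  exact HW'.
Qed.

(** * Lipschitz functions in polar coordinates *)

Definition lipschitz_on_disc (F : C -> C) (R L : R) : Prop :=
  forall z w, Cmod z <= R -> Cmod w <= R -> Cmod (F w - F z) <= L * Cmod (w - z).

Lemma polar_continuous r t eps : 0 < eps -> exists d : posreal, forall r' t',
  Rabs (r' - r) < d -> Rabs (t' - t) < d -> Cmod (polar r' t' - polar r t) < eps.
Proof.
intros He; assert (Hs : 0 < sqrt 2) by (apply sqrt_lt_R0; lra).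
assert (He' : 0 < eps / sqrt 2) by (apply Rdiv_lt_0_compat; lra).
assert (Hc : continuity_2d_pt (fun r t => r * cos t) r t).
{ eapply differentiable_lim_continuity, differentiable_pt_lim_mult;
    [apply differentiable_pt_lim_radius|apply differentiable_pt_lim_snd, derivable_pt_lim_cos]. }
assert (Hn : continuity_2d_pt (fun r t => r * sin t) r t).
{ eapply differentiable_lim_continuity, differentiable_pt_lim_mult;
    [apply differentiable_pt_lim_radius|apply differentiable_pt_lim_snd, derivable_pt_lim_sin]. }
destruct (Hc (mkposreal _ He')) as [d1 H1]; destruct (Hn (mkposreal _ He')) as [d2 H2]; simpl in H1, H2.
assert (Hd : 0 < Rmin d1 d2) by (apply Rmin_case; [apply (cond_pos d1)|apply (cond_pos d2)]).
exists (mkposreal _ Hd); simpl; intros r' t' Hr Ht.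
pose proof (Rmin_l d1 d2); pose proof (Rmin_r d1 d2).
specialize (H1 r' t' ltac:(lra) ltac:(lra)); specialize (H2 r' t' ltac:(lra) ltac:(lra)).
eapply Rle_lt_trans; [apply Cmod_2Rmax|].
replace eps with (sqrt 2 * (eps / sqrt 2)) by (field; lra).
apply Rmult_lt_compat_l; [lra|]. apply Rmax_case; assumption.
Qed.

Lemma lipschitz_polar (F : C -> C) R L r t : lipschitz_on_disc F R L -> Rabs r <= R ->
  forall eps, 0 < eps -> exists d : posreal, forall r' t', Rabs r' <= R ->
    Rabs (r' - r) < d -> Rabs (t' - t) < d ->
    Rabs (fst (F (polar r' t')) - fst (F (polar r t))) < eps /\
    Rabs (snd (F (polar r' t')) - snd (F (polar r t))) < eps.
Proof.
intros HF Hr eps He.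
pose proof (Rabs_pos L) as HL.
destruct (polar_continuous r t (eps / (Rabs L + 1))) as [d Hd].
{ apply Rdiv_lt_0_compat; lra. }
exists d; intros r' t' Hr' H1 H2; specialize (Hd r' t' H1 H2).
assert (HB : Cmod (F (polar r' t') - F (polar r t)) < eps).
{ eapply Rle_lt_trans; [apply HF; rewrite Cmod_polar; assumption|].
  pose proof (Cmod_ge_0 (polar r' t' - polar r t)); pose proof (Rle_abs L).
  apply Rle_lt_trans with ((Rabs L + 1) * Cmod (polar r' t' - polar r t)); [nra|].
  apply (Rmult_lt_compat_l (Rabs L + 1)) in Hd; [|lra].
  replace ((Rabs L + 1) * (eps / (Rabs L + 1))) with eps in Hd by (field; lra). exact Hd. }
pose proof (Rmax_Cmod (F (polar r' t') - F (polar r t))%C) as M; simpl in M.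
change (fst (F (polar r' t')) + - fst (F (polar r t))) with (fst (F (polar r' t')) - fst (F (polar r t))) in M.
change (snd (F (polar r' t')) + - snd (F (polar r t))) with (snd (F (polar r' t')) - snd (F (polar r t))) in M.
split; (eapply Rle_lt_trans; [|exact HB]); (eapply Rle_trans; [|exact M]); [apply Rmax_l|apply Rmax_r].
Qed.

Lemma lipschitz_polar_continuity (F : C -> C) R L r t : lipschitz_on_disc F R L -> Rabs r < R ->
  continuity_2d_pt (fun r t => fst (F (polar r t))) r t /\
  continuity_2d_pt (fun r t => snd (F (polar r t))) r t.
Proof.
intros HF Hr; split; intros eps;
  (destruct (lipschitz_polar F R L r t HF ltac:(lra) eps (cond_pos eps)) as [d Hd]);
  (assert (Hm : 0 < Rmin d (R - Rabs r)) by (apply Rmin_case; [apply (cond_pos d)|lra]));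
  exists (mkposreal _ Hm); simpl; intros r' t' H1 H2;
  pose proof (Rmin_l d (R - Rabs r)); pose proof (Rmin_r d (R - Rabs r));
  (assert (Rabs r' <= R) by (pose proof (Rabs_triang (r' - r) r) as T; replace (r' - r + r) with r' in T by ring; lra));
  apply Hd; lra.
Qed.

(** For continuity in the angle alone, [Rabs r = R] is allowed. This is needed on the unit circle,
    up to which [P_k] and [Q_k] are controlled. *)
Lemma lipschitz_circle_continuous (F : C -> C) R L r t : lipschitz_on_disc F R L -> Rabs r <= R ->
  continuous (fun t => fst (F (polar r t))) t /\ continuous (fun t => snd (F (polar r t))) t.
Proof.
intros HF Hr; split; apply filterlim_locally; intros eps;
  destruct (lipschitz_polar F R L r t HF Hr eps (cond_pos eps)) as [d Hd];
  exists d; intros t' Ht; apply Hd;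
  first [exact Hr | rewrite Rminus_diag, Rabs_R0; apply cond_pos | exact Ht].
Qed.

Lemma lipschitz_circle_norm (F : C -> C) R L r t : lipschitz_on_disc F R L -> Rabs r <= R ->
  continuous (fun t => Cmod (F (polar r t)) ^ 2) t.
Proof.
intros HF Hr; destruct (lipschitz_circle_continuous F R L r t HF Hr) as [H1 H2].
apply (continuous_ext (fun t => fst (F (polar r t)) * fst (F (polar r t)) + snd (F (polar r t)) * snd (F (polar r t)))).
{ intros u; rewrite Cmod2_alt; unfold Re, Im; simpl; ring. }
apply (continuous_plus (V := R_NormedModule)); apply (continuous_mult (K := R_AbsRing)); assumption.
Qed.

(** The derivatives are recorded beside the functions and follow the recursion by the product rule,
    so that they can be estimated as explicit functions. *)
Record stage := Stage { stP : C -> C; stQ : C -> C; stdP : C -> C; stdQ : C -> C }.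

(** Successive quotients are [4^(2k+1)] and outgrow every power of [k]. Thus the derivatives of all
    earlier terms, of order [n_(k-1)], are negligible against [a_k n_k] although [a_k] tends to 0; a
    constant quotient would not ensure this. *)
Definition freq (k : nat) : nat := (4 ^ (k * k))%nat.

Definition cross (P Q : C -> C) (n : nat) (t : R) : R :=
  Re (P (polar 1 t) * Cconj (polar 1 t ^ n * Q (polar 1 t)))%C.

(** The cross term in the mean of [|P_(k+1)|^2] would vanish by orthogonality, [P_k] having degree
    below [n_k]. A sign that makes it nonpositive serves as well and avoids Fourier coefficients. *)
Definition rs_sign (P Q : C -> C) (n : nat) : R :=
  if Rle_dec (RInt (cross P Q n) 0 (2 * PI)) 0 then 1 else -1.

Definition rs_step (b : R) (n : nat) (s : stage) : stage :=
  let X := fun z => (z ^ n * stQ s z)%C in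
  let dX := fun z => (RtoC (INR n) * z ^ (n - 1) * stQ s z + z ^ n * stdQ s z)%C in
  Stage (fun z => stP s z + RtoC b * X z)%C (fun z => X z + RtoC (- b) * stP s z)%C
        (fun z => stdP s z + RtoC b * dX z)%C (fun z => dX z + RtoC (- b) * stdP s z)%C.

(* Rudin-Shapiro recursion; the signs make the mean of [|P|^2] on the unit circle subadditive. *)
Fixpoint rs (a : nat -> R) (k : nat) : stage :=
  match k with
  | O => Stage (fun _ => RtoC 0) (fun _ => RtoC 1) (fun _ => RtoC 0) (fun _ => RtoC 0)
  | S k => let s := rs a k in rs_step (rs_sign (stP s) (stQ s) (freq k) * a k) (freq k) s
  end.

(** Comparable to the degree of [P_k] and [Q_k]; the value 0 at the start fits their being constant
    there. *)
Definition prev_freq (k : nat) : R := match k with O => 0 | S k => INR (freq k) end.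

Lemma freq_pos k : (1 <= freq k)%nat.
Proof. unfold freq; pose proof (Nat.pow_nonzero 4 (k * k)); lia. Qed.

Lemma INR_freq k : INR (freq k) = 4 ^ (k * k).
Proof. unfold freq; rewrite pow_INR; f_equal; simpl; lra. Qed.

Lemma INR_freq_ge1 k : 1 <= INR (freq k).
Proof. apply (le_INR 1), freq_pos. Qed.

(** The exponents satisfy [(k - 1)^2 + 2 k = k^2 + 1]. This is where the error scale [(1 / 16) ^ k]
    used later comes from. *)
Lemma prev_freq_pow k : prev_freq k * 16 ^ k <= 4 * INR (freq k).
Proof.
destruct k as [|k]; [simpl; lra|].
unfold prev_freq; rewrite !INR_freq.
replace 16 with (4 ^ 2) by ring; rewrite <- pow_mult, <- pow_add.
replace (k * k + 2 * S k)%nat with (S (S k * S k)) by lia.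
rewrite <- tech_pow_Rmult; lra.
Qed.

Lemma prev_freq_le k : 4 * prev_freq k <= INR (freq k).
Proof.
destruct k as [|k]; [simpl; lra|].
pose proof (prev_freq_pow (S k)) as H.
assert (16 <= 16 ^ S k) by (simpl; pose proof (pow_R1_Rle 16 k ltac:(lra)); lra).
assert (0 <= prev_freq (S k)) by apply pos_INR. nra.
Qed.

Lemma prev_freq_nonneg k : 0 <= prev_freq k.
Proof. destruct k; simpl; [lra|apply pos_INR]. Qed.

Fixpoint psum (u : nat -> R) (K : nat) : R :=
  match K with O => 0 | S K => psum u K + u K end.

Section RudinShapiro.
Variable a : nat -> R.
Hypothesis Ha : forall k, 0 < a k <= 1.
Hypothesis Hsum : forall K, psum (fun k => a k ^ 2) K <= 1.

Let P k := stP (rs a k).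
Let Q k := stQ (rs a k).
Let dP k := stdP (rs a k).
Let dQ k := stdQ (rs a k).
Let b k := rs_sign (P k) (Q k) (freq k) * a k.

Lemma rs_sign_cases P0 Q0 n : rs_sign P0 Q0 n = 1 \/ rs_sign P0 Q0 n = -1.
Proof. unfold rs_sign; destruct Rle_dec; auto. Qed.

Lemma Rabs_b k : Rabs (b k) = a k.
Proof.
unfold b; pose proof (Ha k); destruct (rs_sign_cases (P k) (Q k) (freq k)) as [-> | ->];
  [rewrite Rabs_right|rewrite Rabs_left]; lra.
Qed.

Lemma b_sqr k : b k ^ 2 = a k ^ 2.
Proof. rewrite <- (Rabs_b k), pow2_abs; reflexivity. Qed.

(** The matrix with rows [(1, c)] and [(-c, 1)] is a rotation times [sqrt (1 + c^2)]. *)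
Lemma energy_identity (p x : C) (c : R) :
  Cmod (p + RtoC c * x) ^ 2 + Cmod (x + RtoC (- c) * p) ^ 2 = (1 + c ^ 2) * (Cmod p ^ 2 + Cmod x ^ 2).
Proof. rewrite !Cmod2_alt; destruct p, x; unfold Re, Im, RtoC, Cplus, Cmult; simpl; ring. Qed.

(** The factors [1 + a_k^2] are bounded by exponentials. Inside the disc [z ^ n] only decreases the
    energy, so the estimate holds there directly, without the maximum principle. *)
Lemma rs_energy_le k z : Cmod z <= 1 ->
  Cmod (P k z) ^ 2 + Cmod (Q k z) ^ 2 <= exp (psum (fun k => a k ^ 2) k).
Proof.
intros Hz; induction k as [|k IH].
- unfold P, Q; simpl. rewrite exp_0, Cmod_0, Cmod_1; lra.
- change (P (S k) z) with (P k z + RtoC (b k) * (z ^ freq k * Q k z))%C.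
  change (Q (S k) z) with (z ^ freq k * Q k z + RtoC (- b k) * P k z)%C.
  rewrite energy_identity, b_sqr; change (psum (fun k => a k ^ 2) (S k)) with (psum (fun k => a k ^ 2) k + a k ^ 2); rewrite exp_plus, Rmult_comm.
  apply Rmult_le_compat.
  + apply Rplus_le_le_0_compat; apply pow2_ge_0.
  + pose proof (pow2_ge_0 (a k)); lra.
  + eapply Rle_trans; [|exact IH]. apply Rplus_le_compat_l, pow_incr; split; [apply Cmod_ge_0|].
    rewrite Cmod_mult, Cmod_pow.
    assert (Cmod z ^ freq k <= 1) by (rewrite <- (pow1 (freq k)); apply pow_incr; split; [apply Cmod_ge_0|exact Hz]).
    pose proof (Cmod_ge_0 (Q k z)); nra.
  + apply exp_ineq1_le.
Qed.

Lemma rs_sup k z : Cmod z <= 1 -> Cmod (P k z) <= 2 /\ Cmod (Q k z) <= 2.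
Proof.
intros Hz; pose proof (rs_energy_le k z Hz) as H.
assert (HE : exp (psum (fun k => a k ^ 2) k) <= 4).
{ apply Rle_trans with (exp 1); [|pose proof exp_le_3; lra].
  destruct (Req_dec (psum (fun k => a k ^ 2) k) 1) as [->|]; [lra|].
  left; apply exp_increasing; pose proof (Hsum k); lra. }
pose proof (Cmod_ge_0 (P k z)); pose proof (Cmod_ge_0 (Q k z)); split; nra.
Qed.

(** On the unit circle [z ^ n] is unimodular, so the energy never falls below its initial value;
    this prevents [P_k] and [Q_k] from being small together. *)
Lemma rs_energy_circle k t : 1 <= Cmod (P k (polar 1 t)) ^ 2 + Cmod (Q k (polar 1 t)) ^ 2.
Proof.
set (z := polar 1 t); assert (Hz : Cmod z = 1) by (unfold z; rewrite Cmod_polar; apply Rabs_R1).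
induction k as [|k IH].
- unfold P, Q; simpl. rewrite Cmod_0, Cmod_1; lra.
- change (P (S k) z) with (P k z + RtoC (b k) * (z ^ freq k * Q k z))%C.
  change (Q (S k) z) with (z ^ freq k * Q k z + RtoC (- b k) * P k z)%C.
  rewrite energy_identity, Cmod_mult, Cmod_pow, Hz, pow1, Rmult_1_l.
  pose proof (pow2_ge_0 (b k)); nra.
Qed.

(** The new increment has derivative bounds of order [n_k] and [n_k^2], and the old ones are
    dominated because [4 n_(k-1) <= n_k]. The constants 4 and 20 leave room for the induction to
    close. *)
Lemma rs_c2_bounded k :
  c2_bounded (P k) (dP k) 1 2 (4 * prev_freq k) (20 * prev_freq k ^ 2) /\
  c2_bounded (Q k) (dQ k) 1 2 (4 * prev_freq k) (20 * prev_freq k ^ 2).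
Proof.
induction k as [|k [IHP IHQ]].
- split; intros z w Hz Hw; unfold P, Q, dP, dQ; simpl;
    [replace (0 - 0 - 0 * (w - z))%C with (RtoC 0) by ring; replace (0 - 0)%C with (RtoC 0) by ring
    |replace (1 - 1 - 0 * (w - z))%C with (RtoC 0) by ring; replace (1 - 1)%C with (RtoC 0) by ring];
    rewrite ?Cmod_0, ?Cmod_1; repeat split; lra.
- pose proof (c2_bounded_mult _ _ _ _ _ _ _ _ _ _ _ (c2_bounded_pow (freq k) 1 ltac:(lra)) IHQ) as HX.
  rewrite !pow1 in HX.
  pose proof (prev_freq_le k) as H4; pose proof (prev_freq_nonneg k) as H0; pose proof (INR_freq_ge1 k) as H1.
  pose proof (Ha k) as Hak.
  set (m := prev_freq k) in *; set (n := INR (freq k)) in *.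
  change (prev_freq (S k)) with n.
  pose proof (c2_bounded_plus _ _ _ _ _ _ _ _ _ _ _ IHP (c2_bounded_scal (b k) _ _ _ _ _ _ HX)) as HP.
  pose proof (c2_bounded_plus _ _ _ _ _ _ _ _ _ _ _ HX (c2_bounded_scal (- b k) _ _ _ _ _ _ IHP)) as HQ.
  rewrite Rabs_b in HP; rewrite Rabs_Ropp, Rabs_b in HQ.
  assert (U1 : 0 <= m * m) by nra. assert (U2 : 16 * (m * m) <= n * n) by nra.
  assert (U3 : 4 * (n * m) <= n * n) by nra. assert (U4 : 0 <= n * m) by nra.
  (* The supremum bound from the sum rule would grow with [k]; it is replaced by the uniform bound 2
     of [rs_sup]. *)
  assert (C2 : forall F F' s L E, c2_bounded F F' 1 s L E -> (forall z, Cmod z <= 1 -> Cmod (F z) <= 2) ->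
     L <= 4 * n -> E <= 20 * n ^ 2 -> c2_bounded F F' 1 2 (4 * n) (20 * n ^ 2)).
  { intros F F' s L E HF Hs HL HE z w Hz Hw.
    destruct (c2_bounded_weaken _ _ _ _ _ _ s _ _ HF (Rle_refl _) HL HE z w Hz Hw) as (_ & V).
    split; [apply Hs, Hz|exact V]. }
  assert (W : forall x y, 0 <= y -> x <= y -> a k * x <= y) by (intros; nra).
  split.
  + refine (C2 _ _ _ _ _ HP (fun z Hz => proj1 (rs_sup (S k) z Hz)) _ _).
    * pose proof (W (n * 1 * 2 + 1 * (4 * m)) (2 * n + 4 * m) ltac:(lra) ltac:(lra)); lra.
    * pose proof (W (4 * n ^ 2 * 1 * 2 + n * 1 * (4 * m) + 1 * (20 * m ^ 2)) (8 * (n * n) + 4 * (n * m) + 20 * (m * m)) ltac:(lra) ltac:(lra)); lra.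
  + refine (C2 _ _ _ _ _ HQ (fun z Hz => proj2 (rs_sup (S k) z Hz)) _ _).
    * pose proof (W (4 * m) (4 * m) ltac:(lra) ltac:(lra)); lra.
    * pose proof (W (20 * m ^ 2) (20 * (m * m)) ltac:(lra) ltac:(lra)); lra.
Qed.

(** The powers of [R] are kept explicit: for [R < 1] they make the increments summable, while
    [R = 1] gives continuity on the unit circle. *)
Lemma c2_bounded_increment k R : 1 / 2 <= R <= 1 ->
  c2_bounded (fun z => z ^ freq k * Q k z)%C
    (fun z => RtoC (INR (freq k)) * z ^ (freq k - 1) * Q k z + z ^ freq k * dQ k z)%C R
    (R ^ freq k * 2) (INR (freq k) * R ^ (freq k - 1) * 2 + R ^ freq k * (4 * prev_freq k))
    (4 * INR (freq k) ^ 2 * R ^ freq k * 2 + INR (freq k) * R ^ (freq k - 1) * (4 * prev_freq k)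
      + R ^ freq k * (20 * prev_freq k ^ 2)).
Proof.
intros HR; apply c2_bounded_mult; [apply c2_bounded_pow, HR|].
apply (c2_bounded_restrict _ _ 1); [lra|apply rs_c2_bounded].
Qed.

Lemma lipschitz_c2 F F' R s L E : c2_bounded F F' R s L E -> lipschitz_on_disc F R L.
Proof. intros H z w Hz Hw; apply H; assumption. Qed.

(** The sign removes the cross term, so a step adds at most the integral of
    [a_k^2 |Q_k|^2 <= 4 a_k^2] over an interval of length [2 * PI]. *)
Lemma rs_mean_P k :
  ex_RInt (fun t => Cmod (P k (polar 1 t)) ^ 2) 0 (2 * PI) /\
  RInt (fun t => Cmod (P k (polar 1 t)) ^ 2) 0 (2 * PI) <= 8 * PI * psum (fun k => a k ^ 2) k.
Proof.
pose proof PI_RGT_0 as Hpi.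
assert (Hex : forall j, ex_RInt (fun t => Cmod (P j (polar 1 t)) ^ 2) 0 (2 * PI)).
{ intros j; apply (ex_RInt_continuous (V := R_CompleteNormedModule)); intros t _.
  apply (lipschitz_circle_norm (P j) 1 (4 * prev_freq j) 1); [|rewrite Rabs_R1; lra].
  eapply lipschitz_c2, rs_c2_bounded. }
split; [apply Hex|].
induction k as [|k IH].
- rewrite (RInt_ext _ (fun _ => 0)).
  + rewrite RInt_const; unfold scal; simpl; unfold mult; simpl; lra.
  + intros t _; unfold P; simpl; rewrite Cmod_0; ring.
- set (X := fun z => (z ^ freq k * Q k z)%C).
  pose proof (lipschitz_c2 _ _ _ _ _ _ (proj1 (rs_c2_bounded k))) as LP.
  pose proof (lipschitz_c2 _ _ _ _ _ _ (c2_bounded_increment k 1 ltac:(lra))) as LX; fold X in LX.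
  assert (HJ : ex_RInt (cross (P k) (Q k) (freq k)) 0 (2 * PI)).
  { apply (ex_RInt_continuous (V := R_CompleteNormedModule)); intros t _.
    apply (continuous_ext (fun t => fst (P k (polar 1 t)) * fst (X (polar 1 t)) + snd (P k (polar 1 t)) * snd (X (polar 1 t)))).
    { intros u; unfold cross; fold (X (polar 1 u)); unfold Re, Cconj; simpl; ring. }
    destruct (lipschitz_circle_continuous (P k) 1 _ 1 t LP ltac:(rewrite Rabs_R1; lra)).
    destruct (lipschitz_circle_continuous X 1 _ 1 t LX ltac:(rewrite Rabs_R1; lra)).
    apply (continuous_plus (V := R_NormedModule)); apply (continuous_mult (K := R_AbsRing)); assumption. }
  apply Rle_trans with (RInt (fun t => Cmod (P k (polar 1 t)) ^ 2 + 2 * b k * cross (P k) (Q k) (freq k) t + a k ^ 2 * 4) 0 (2 * PI)).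
  + apply RInt_le; [lra|apply Hex| |].
    * apply (ex_RInt_plus (V := R_CompleteNormedModule)
        (fun t => Cmod (P k (polar 1 t)) ^ 2 + 2 * b k * cross (P k) (Q k) (freq k) t) (fun _ => a k ^ 2 * 4)); [|apply ex_RInt_const].
      apply (ex_RInt_plus (V := R_CompleteNormedModule) (fun t => Cmod (P k (polar 1 t)) ^ 2)); [apply Hex|].
      apply (ex_RInt_scal (V := R_CompleteNormedModule)); exact HJ.
    * intros t _; unfold cross; set (z := polar 1 t); fold (X z).
      change (P (S k) z) with (P k z + RtoC (b k) * X z)%C.
      assert (HX : Cmod (X z) <= 2).
      { assert (Hz : Cmod z = 1) by (unfold z; rewrite Cmod_polar; apply Rabs_R1).
        unfold X; rewrite Cmod_mult, Cmod_pow, Hz, pow1, Rmult_1_l; apply rs_sup; lra. }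
      rewrite <- b_sqr.
      replace (Cmod (P k z + RtoC (b k) * X z) ^ 2) with
        (Cmod (P k z) ^ 2 + 2 * b k * Re (P k z * Cconj (X z))%C + b k ^ 2 * Cmod (X z) ^ 2).
      -- apply Rplus_le_compat_l, Rmult_le_compat_l; [apply pow2_ge_0|].
         pose proof (Cmod_ge_0 (X z)); nra.
      -- rewrite !Cmod2_alt; destruct (P k z), (X z); unfold Re, Im, Cconj, RtoC, Cplus, Cmult; simpl; ring.
  + rewrite (RInt_plus (V := R_CompleteNormedModule)
        (fun t => Cmod (P k (polar 1 t)) ^ 2 + 2 * b k * cross (P k) (Q k) (freq k) t) (fun _ => a k ^ 2 * 4));
      [|apply (ex_RInt_plus (V := R_CompleteNormedModule) (fun t => Cmod (P k (polar 1 t)) ^ 2)); [apply Hex|];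
        apply (ex_RInt_scal (V := R_CompleteNormedModule)); exact HJ|apply ex_RInt_const].
    rewrite (RInt_plus (V := R_CompleteNormedModule) (fun t => Cmod (P k (polar 1 t)) ^ 2));
      [|apply Hex|apply (ex_RInt_scal (V := R_CompleteNormedModule)); exact HJ].
    rewrite (RInt_scal (V := R_CompleteNormedModule) (cross (P k) (Q k) (freq k))) by exact HJ.
    rewrite RInt_const; unfold plus, scal; simpl; unfold mult; simpl.
    assert (b k * RInt (cross (P k) (Q k) (freq k)) 0 (2 * PI) <= 0).
    { pose proof (Ha k) as Hak; unfold b, rs_sign; destruct Rle_dec; nra. }
    simpl in IH. nra.
Qed.

End RudinShapiro.

(** * The limit function *)


Definition limC (u : nat -> C) : C :=
  (real (Lim_seq (fun n => fst (u n))), real (Lim_seq (fun n => snd (u n)))).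

Definition is_limC (u : nat -> C) (l : C) : Prop :=
  is_lim_seq (fun n => fst (u n)) (fst l) /\ is_lim_seq (fun n => snd (u n)) (snd l).

Lemma is_limC_const c : is_limC (fun _ => c) c.
Proof. split; apply is_lim_seq_const. Qed.

Lemma is_limC_minus u v l m : is_limC u l -> is_limC v m -> is_limC (fun n => u n - v n)%C (l - m)%C.
Proof. intros [H1 H2] [K1 K2]; split; apply is_lim_seq_minus'; assumption. Qed.

Lemma is_limC_mult u v l m : is_limC u l -> is_limC v m -> is_limC (fun n => u n * v n)%C (l * m)%C.
Proof.
intros [H1 H2] [K1 K2]; split; [apply is_lim_seq_minus'|apply is_lim_seq_plus']; apply is_lim_seq_mult'; assumption.
Qed.

Lemma is_limC_Cmod_le u l K tau : is_limC u l -> (forall J, (K <= J)%nat -> Cmod (u J) <= tau) -> Cmod l <= tau.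
Proof.
intros [H1 H2] Hu.
assert (Ht : 0 <= tau) by (eapply Rle_trans; [apply Cmod_ge_0|apply (Hu K), Nat.le_refl]).
assert (HS : Rbar_le (fst l * fst l + snd l * snd l) (tau ^ 2)).
{ apply (is_lim_seq_le_loc (fun n => fst (u n) * fst (u n) + snd (u n) * snd (u n)) (fun _ => tau ^ 2)).
  - exists K; intros n Hn; specialize (Hu n Hn).
    replace (fst (u n) * fst (u n) + snd (u n) * snd (u n)) with (Cmod (u n) ^ 2) by (rewrite Cmod2_alt; unfold Re, Im; ring).
    apply pow_incr; split; [apply Cmod_ge_0|exact Hu].
  - apply is_lim_seq_plus'; apply is_lim_seq_mult'; assumption.
  - apply is_lim_seq_const. }
simpl in HS.
replace (fst l * fst l + snd l * snd l) with (Cmod l ^ 2) in HS by (rewrite Cmod2_alt; unfold Re, Im; ring).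
pose proof (Cmod_ge_0 l); nra.
Qed.

Lemma geometric_tail (u : nat -> C) B K J :
  (forall k, (K <= k)%nat -> Cmod (u (S k) - u k) <= B * (1 / 4) ^ k) -> (K <= J)%nat ->
  Cmod (u J - u K) <= 4 / 3 * B * ((1 / 4) ^ K - (1 / 4) ^ J).
Proof.
intros Hu HJ; induction HJ as [|J HJ IH].
- replace (u K - u K)%C with (RtoC 0) by ring; rewrite Cmod_0; lra.
- replace (u (S J) - u K)%C with ((u (S J) - u J) + (u J - u K))%C by ring.
  eapply Rle_trans; [apply Cmod_triangle|]. specialize (Hu J HJ); simpl pow; lra.
Qed.

Lemma pow_quarter_small eps : 0 < eps -> exists K, (1 / 4) ^ K < eps.
Proof.
intros He; destruct (pow_lt_1_zero (1 / 4) ltac:(rewrite Rabs_right; lra) eps He) as [K HK].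
exists K; specialize (HK K (Nat.le_refl K)); rewrite Rabs_right in HK; [exact HK|].
apply Rle_ge, pow_le; lra.
Qed.

Lemma geometric_is_limC (u : nat -> C) B :
  (forall k, Cmod (u (S k) - u k) <= B * (1 / 4) ^ k) -> is_limC u (limC u).
Proof.
intros Hu.
assert (HB : 0 <= B) by (specialize (Hu 0%nat); simpl in Hu; pose proof (Cmod_ge_0 (u 1%nat - u 0%nat)); lra).
assert (HC : forall eps : posreal, exists N, forall n m, (N <= n)%nat -> (N <= m)%nat -> Cmod (u n - u m) < eps).
{ intros eps; destruct (pow_quarter_small (eps / (3 * (B + 1)))) as [N HN].
  { apply Rdiv_lt_0_compat; [apply cond_pos|lra]. }
  exists N; intros n m Hn Hm.
  pose proof (geometric_tail u B N n (fun k _ => Hu k) Hn) as T1.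
  pose proof (geometric_tail u B N m (fun k _ => Hu k) Hm) as T2.
  pose proof (pow_lt (1 / 4) n ltac:(lra)); pose proof (pow_lt (1 / 4) m ltac:(lra)).
  pose proof (pow_lt (1 / 4) N ltac:(lra)).
  replace (u n - u m)%C with ((u n - u N) + - (u m - u N))%C by ring.
  eapply Rle_lt_trans; [apply Cmod_triangle|]; rewrite Cmod_opp.
  apply Rle_lt_trans with (3 * (B + 1) * (1 / 4) ^ N); [nra|].
  apply (Rmult_lt_compat_l (3 * (B + 1))) in HN; [|lra].
  replace (3 * (B + 1) * (eps / (3 * (B + 1)))) with (pos eps) in HN by (field; lra). exact HN. }
split; apply Lim_seq_correct', ex_lim_seq_cauchy_corr; intros eps; destruct (HC eps) as [N HN];
  exists N; intros n m Hn Hm; (eapply Rle_lt_trans; [|apply (HN n m Hn Hm)]);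
  (eapply Rle_trans; [|apply Rmax_Cmod]); [apply Rmax_l|apply Rmax_r].
Qed.

Lemma geometric_limC_tail (u : nat -> C) l B K : is_limC u l ->
  (forall k, (K <= k)%nat -> Cmod (u (S k) - u k) <= B * (1 / 4) ^ k) -> Cmod (l - u K) <= 4 / 3 * B * (1 / 4) ^ K.
Proof.
intros Hl Hu; apply (is_limC_Cmod_le (fun n => u n - u K)%C _ K).
- apply is_limC_minus; [exact Hl|apply is_limC_const].
- intros J HJ; pose proof (geometric_tail u B K J Hu HJ).
  assert (0 <= B).
  { specialize (Hu K (Nat.le_refl K)); pose proof (Cmod_ge_0 (u (S K) - u K)).
    pose proof (pow_lt (1 / 4) K ltac:(lra)); nra. }
  pose proof (pow_lt (1 / 4) J ltac:(lra)); nra.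
Qed.

(** From [(1 - u) * (1 + u) <= 1] and Bernoulli: powers of [1 - u] decay once [n] exceeds the scale
    [1 / u], with no use of exponentials. *)
Lemma bernoulli_inv u n : 0 <= u <= 1 -> (1 - u) ^ n * (1 + INR n * u) <= 1.
Proof.
intros Hu; induction n as [|n IH]; [simpl; lra|].
rewrite S_INR; simpl pow.
pose proof (pow_le (1 - u) n ltac:(lra)); pose proof (pos_INR n).
assert ((1 - u) * (1 + (INR n + 1) * u) <= 1 + INR n * u) by nra. nra.
Qed.

(** Induction on the degree: with [R = S0 * S0], one factor [S0 ^ n] absorbs a single [INR n] by
    [bernoulli_inv], and the other goes to the induction hypothesis. *)
Lemma pow_decay M : forall R, 0 <= R < 1 -> exists D, 0 < D /\ forall n, INR n ^ M * R ^ n <= D.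
Proof.
induction M as [|M IH]; intros R HR.
- exists 1; split; [lra|]; intros n; simpl. rewrite Rmult_1_l, <- (pow1 n); apply pow_incr; lra.
- set (S0 := sqrt R).
  assert (HS : 0 <= S0 < 1).
  { split; [apply sqrt_pos|]. rewrite <- sqrt_1; apply sqrt_lt_1; lra. }
  assert (HSS : S0 * S0 = R) by (apply sqrt_def; lra).
  destruct (IH S0 HS) as [D [HD H]].
  assert (HD' : 0 < D * / (1 - S0)) by (apply Rmult_lt_0_compat; [exact HD|apply Rinv_0_lt_compat; lra]).
  exists (D * / (1 - S0)); split; [exact HD'|]; intros n.
  rewrite <- HSS, Rpow_mult_distr; simpl pow.
  replace (INR n * INR n ^ M * (S0 ^ n * S0 ^ n)) with (INR n ^ M * S0 ^ n * (INR n * S0 ^ n)) by ring.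
  pose proof (pow_le S0 n ltac:(lra)); pose proof (pos_INR n).
  apply Rmult_le_compat; [apply Rmult_le_pos; [apply pow_le|]; lra|apply Rmult_le_pos; lra|apply H|].
  apply (Rmult_le_reg_r (1 - S0)); [lra|]. rewrite Rinv_l by lra.
  pose proof (bernoulli_inv (1 - S0) n ltac:(lra)) as BI. replace (1 - (1 - S0)) with S0 in BI by ring. nra.
Qed.

Section Limit.
Variable a : nat -> R.
Hypothesis Ha : forall k, 0 < a k <= 1.
Hypothesis Hsum : forall K, psum (fun k => a k ^ 2) K <= 1.

Let P k := stP (rs a k).
Let Q k := stQ (rs a k).
Let dP k := stdP (rs a k).
Let dQ k := stdQ (rs a k).
Let b k := rs_sign (P k) (Q k) (freq k) * a k.
Let X k := fun z => (z ^ freq k * Q k z)%C.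
Let dX k := fun z => (RtoC (INR (freq k)) * z ^ (freq k - 1) * Q k z + z ^ freq k * dQ k z)%C.

(** All three constants are at most [12 n_k^2 R^n_k]. The bound on [n^3 R^n] leaves a spare factor
    [1 / n_k], which is at most [(1 / 4) ^ k]. *)
Lemma increment_geometric R : 1 / 2 <= R < 1 -> exists B, 0 < B /\ forall k,
  c2_bounded (X k) (dX k) R (B * (1 / 4) ^ k) (B * (1 / 4) ^ k) (B * (1 / 4) ^ k).
Proof.
intros HR; destruct (pow_decay 3 R ltac:(lra)) as [D [HD H]].
exists (12 * D); split; [lra|]; intros k.
pose proof (INR_freq_ge1 k) as N1; pose proof (prev_freq_le k) as N2; pose proof (prev_freq_nonneg k) as N3.
specialize (H (freq k)).
assert (N4 : 4 ^ k <= INR (freq k)).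
{ rewrite INR_freq; apply Rle_pow; [lra|nia]. }
assert (HE : 12 * (INR (freq k) ^ 2 * R ^ freq k) <= 12 * D * (1 / 4) ^ k).
{ replace ((1 / 4) ^ k) with (/ 4 ^ k) by (rewrite <- pow_inv; f_equal; lra).
  pose proof (pow_lt 4 k ltac:(lra)) as P4; pose proof (pow_le R (freq k) ltac:(lra)).
  apply (Rmult_le_reg_r (4 ^ k)); [lra|]. rewrite (Rmult_assoc (12 * D)), Rinv_l by lra.
  assert (INR (freq k) ^ 2 * R ^ freq k * 4 ^ k <= INR (freq k) ^ 2 * R ^ freq k * INR (freq k)).
  { apply Rmult_le_compat_l; [apply Rmult_le_pos; [apply pow2_ge_0|lra]|lra]. }
  simpl in H |- *; simpl in H0; lra. }
assert (HR1 : R ^ (freq k - 1) <= 2 * R ^ freq k).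
{ pose proof (freq_pos k). replace (freq k) with (S (freq k - 1)) at 2 by lia; simpl.
  pose proof (pow_le R (freq k - 1) ltac:(lra)); nra. }
pose proof (pow_le R (freq k) ltac:(lra)) as HR0.
pose proof (pow_le R (freq k - 1) ltac:(lra)) as HR2.
eapply c2_bounded_weaken; [apply (c2_bounded_increment a Ha Hsum); lra| | |];
  (eapply Rle_trans; [|exact HE]); set (n := INR (freq k)) in *; set (m := prev_freq k) in *;
  set (x := R ^ freq k) in *; set (y := R ^ (freq k - 1)) in *.
- assert (1 <= n * n) by nra. nra.
- assert (n * y <= n * (2 * x)) by (apply Rmult_le_compat_l; lra).
  assert (x * (4 * m) <= x * n) by (apply Rmult_le_compat_l; lra).
  assert (n * x <= n * (n * x)) by (assert (0 <= n * x) by nra; nra). nra.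
- assert (n * y * (4 * m) <= n * (2 * x) * n).
  { apply Rmult_le_compat; try nra. }
  assert (x * (m * m) * 16 <= x * (n * n)) by (assert (16 * (m * m) <= n * n) by nra; nra).
  assert (0 <= x * (n * n)) by nra. nra.
Qed.

Lemma increment_P k z : P (S k) z = (P k z + RtoC (b k) * X k z)%C.
Proof. reflexivity. Qed.

Lemma increment_dP k z : dP (S k) z = (dP k z + RtoC (b k) * dX k z)%C.
Proof. reflexivity. Qed.

Lemma disc_radius (z : C) : Cmod z < 1 -> exists R, Cmod z < R /\ 1 / 2 <= R < 1.
Proof. intros H; exists ((1 + Cmod z) / 2); pose proof (Cmod_ge_0 z); lra. Qed.

Definition rs_lim (z : C) : C := limC (fun k => P k z).
Definition rs_dlim (z : C) : C := limC (fun k => dP k z).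

Lemma Cmod_b_mult k (x : C) y : Cmod x <= y -> Cmod (RtoC (b k) * x) <= a k * y.
Proof.
intros H; rewrite Cmod_mult, Cmod_R.
replace (Rabs (b k)) with (a k) by (symmetry; exact (Rabs_b a Ha k)).
apply Rmult_le_compat_l; [pose proof (Ha k); lra|exact H].
Qed.

Lemma rs_limits z : Cmod z < 1 -> is_limC (fun k => P k z) (rs_lim z) /\ is_limC (fun k => dP k z) (rs_dlim z).
Proof.
intros Hz; destruct (disc_radius z Hz) as [R [HzR HR]].
destruct (increment_geometric R HR) as [B [HB H]].
assert (HP4 : forall k, 0 <= B * (1 / 4) ^ k) by (intros; apply Rmult_le_pos; [lra|apply pow_le; lra]).
split; apply (geometric_is_limC _ B); intros k; pose proof (Ha k); specialize (HP4 k);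
  destruct (H k z z ltac:(lra) ltac:(lra)) as (H1 & H2 & _).
- rewrite increment_P; replace (P k z + b k * X k z - P k z)%C with (b k * X k z)%C by ring.
  apply (Cmod_b_mult k) in H1; nra.
- rewrite increment_dP; replace (dP k z + b k * dX k z - dP k z)%C with (b k * dX k z)%C by ring.
  apply (Cmod_b_mult k) in H2; nra.
Qed.

Lemma rs_lim_bounded z : Cmod z < 1 -> Cmod (rs_lim z) <= 2.
Proof.
intros Hz; apply (is_limC_Cmod_le (fun k => P k z) _ 0); [exact (proj1 (rs_limits z Hz))|].
intros J _; exact (proj1 (rs_sup a Ha Hsum J z (Rlt_le _ _ Hz))).
Qed.

(** The Taylor inequality passes from the partial sums to the limit. It gives both the
    differentiability of [rs_lim] and the Lipschitz continuity of [rs_dlim]. *)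
Lemma rs_lim_quadratic R : 1 / 2 <= R < 1 -> exists B, forall z w, Cmod z <= R -> Cmod w <= R ->
  Cmod (rs_lim w - rs_lim z - rs_dlim z * (w - z)) <= B * Cmod (w - z) ^ 2.
Proof.
intros HR; destruct (increment_geometric R HR) as [B [HB H]].
exists (4 / 3 * B); intros z w Hz Hw.
set (h := Cmod (w - z) ^ 2); assert (Hh : 0 <= h) by apply pow2_ge_0.
apply (is_limC_Cmod_le (fun k => P k w - P k z - dP k z * (w - z))%C _ 0).
- destruct (rs_limits z ltac:(lra)) as [L1 L2]; destruct (rs_limits w ltac:(lra)) as [L3 _].
  apply is_limC_minus; [apply is_limC_minus; assumption|].
  apply is_limC_mult; [assumption|apply is_limC_const].
- intros J _.
  (* The factor [1 - (1 / 4) ^ J] is the exact geometric partial sum, which lets the induction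
     close. *)
  assert (HJ : Cmod (P J w - P J z - dP J z * (w - z)) <= 4 / 3 * B * (1 - (1 / 4) ^ J) * h).
  { induction J as [|J IH].
    - unfold P, dP; simpl. replace (0 - 0 - 0 * (w - z))%C with (RtoC 0) by ring. rewrite Cmod_0; lra.
    - rewrite !increment_P, increment_dP.
      replace (P J w + b J * X J w - (P J z + b J * X J z) - (dP J z + b J * dX J z) * (w - z))%C
        with ((P J w - P J z - dP J z * (w - z)) + b J * (X J w - X J z - dX J z * (w - z)))%C by ring.
      eapply Rle_trans; [apply Cmod_triangle|].
      destruct (H J z w Hz Hw) as (_ & _ & _ & H4); fold h in H4.
      apply (Cmod_b_mult J) in H4; pose proof (Ha J).
      assert (0 <= B * (1 / 4) ^ J * h) by (apply Rmult_le_pos; [apply Rmult_le_pos; [lra|apply pow_le; lra]|lra]).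
      simpl pow. nra. }
  eapply Rle_trans; [exact HJ|]. apply Rmult_le_compat_r; [exact Hh|].
  pose proof (pow_lt (1 / 4) J ltac:(lra)); nra.
Qed.

Lemma rs_lim_has_cderiv z : Cmod z < 1 -> has_cderiv rs_lim z (rs_dlim z).
Proof.
intros Hz; destruct (disc_radius z Hz) as [R [HzR HR]].
destruct (rs_lim_quadratic R HR) as [B HB].
apply has_cderiv_at; intros eps He; pose proof (Rabs_pos B).
assert (He' : 0 < eps / (Rabs B + 1)) by (apply Rdiv_lt_0_compat; lra).
exists (Rmin (R - Cmod z) (eps / (Rabs B + 1))); split; [apply Rmin_case; lra|].
intros w Hw; apply Rmin_Rgt in Hw; destruct Hw as [Hw1 Hw2].
eapply Rle_trans; [apply HB; [lra|]|].
- replace w with (z + (w - z))%C by ring. eapply Rle_trans; [apply Cmod_triangle|lra].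
- set (h := Cmod (w - z)) in *; assert (Hh : 0 <= h) by apply Cmod_ge_0.
  replace (B * h ^ 2) with (B * h * h) by ring. apply Rmult_le_compat_r; [exact Hh|].
  apply (Rmult_gt_compat_l (Rabs B + 1)) in Hw2; [|lra].
  replace ((Rabs B + 1) * (eps / (Rabs B + 1))) with eps in Hw2 by (field; lra).
  pose proof (Rle_abs B); nra.
Qed.

(** Adding the Taylor remainders at [z] and at [w] leaves [(f'(w) - f'(z)) (w - z)]. The continuity
    of the derivative is thus obtained without Cauchy's integral formula. *)
Lemma rs_dlim_lipschitz R : 1 / 2 <= R < 1 -> exists L, lipschitz_on_disc rs_dlim R L.
Proof.
intros HR; destruct (rs_lim_quadratic R HR) as [B HB].
exists (2 * B); intros z w Hz Hw.
pose proof (HB z w Hz Hw) as H1; pose proof (HB w z Hw Hz) as H2.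
destruct (excluded_middle_informative (w = z)) as [->|Hne].
{ replace (rs_dlim z - rs_dlim z)%C with (RtoC 0) by ring; replace (z - z)%C with (RtoC 0) by ring.
  rewrite Cmod_0; lra. }
apply Cminus_neq_0, Cmod_gt_0 in Hne.
replace (Cmod (z - w)) with (Cmod (w - z)) in H2.
2:{ rewrite <- Cmod_opp; f_equal; ring. }
set (h := Cmod (w - z)) in *.
apply (Rmult_le_reg_r h); [exact Hne|]. unfold h at 1; rewrite <- Cmod_mult.
replace ((rs_dlim w - rs_dlim z) * (w - z))%C with
  ((rs_lim w - rs_lim z - rs_dlim z * (w - z)) + (rs_lim z - rs_lim w - rs_dlim w * (z - w)))%C by ring.
eapply Rle_trans; [apply Cmod_triangle|lra].
Qed.

Lemma dX_le k z : Cmod z <= 1 -> Cmod (dX k z) <= 3 * (INR (freq k) * Cmod z ^ (freq k - 1)).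
Proof.
intros Hz; destruct (rs_sup a Ha Hsum k z Hz) as [_ HQ].
destruct (rs_c2_bounded a Ha Hsum k) as [_ HC]; destruct (HC z z Hz Hz) as (_ & HdQ & _).
pose proof (prev_freq_le k) as N2; pose proof (INR_freq_ge1 k) as N1.
pose proof (Cmod_ge_0 z) as Hz0; pose proof (pow_le (Cmod z) (freq k - 1) Hz0) as Hx.
unfold dX; eapply Rle_trans; [apply Cmod_triangle|].
rewrite !Cmod_mult, !Cmod_pow, Cmod_R, Rabs_right by lra.
assert (E : Cmod z ^ freq k = Cmod z * Cmod z ^ (freq k - 1)).
{ pose proof (freq_pos k); replace (freq k) with (S (freq k - 1)) at 1 by lia; reflexivity. }
rewrite E; set (x := Cmod z ^ (freq k - 1)) in *; set (n := INR (freq k)) in *.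
assert (n * x * Cmod (Q k z) <= n * x * 2).
{ apply Rmult_le_compat_l; [nra|exact HQ]. }
assert (Cmod z * x * Cmod (dQ k z) <= 1 * x * n).
{ apply Rmult_le_compat; try apply Cmod_ge_0; [nra| |].
  - apply Rmult_le_compat_r; assumption.
  - eapply Rle_trans; [exact HdQ|exact N2]. }
lra.
Qed.

Lemma dP_majorant K z : Cmod z <= 1 ->
  Cmod (dP K z) <= 3 * psum (fun j => a j * (INR (freq j) * Cmod z ^ (freq j - 1))) K.
Proof.
intros Hz; induction K as [|K IH].
- unfold dP; simpl; rewrite Cmod_0; lra.
- rewrite increment_dP; simpl psum; eapply Rle_trans; [apply Cmod_triangle|].
  pose proof (Cmod_b_mult K _ _ (dX_le K z Hz)); lra.
Qed.

Lemma psum_ge_first u K : (forall j, 0 <= u j) -> (1 <= K)%nat -> u 0%nat <= psum u K.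
Proof.
intros Hu HK; induction HK as [|K HK IH]; [simpl; lra|]. simpl; specialize (Hu K); lra.
Qed.

(** On a smaller disc the tail of the series for the derivative is at most the first term of the
    majorant, so finitely many terms suffice when the constant 3 is raised to 4. Only [K] depends on
    [R], which keeps the later integral bounds uniform. *)
Lemma rs_dlim_majorant R : R < 1 -> exists K, forall z, Cmod z <= R ->
  Cmod (rs_dlim z) <= 4 * psum (fun j => a j * (INR (freq j) * Cmod z ^ (freq j - 1))) K.
Proof.
intros HR1; set (R' := Rmax R (1 / 2)).
assert (HR : 1 / 2 <= R' < 1) by (split; [apply Rmax_r|apply Rmax_case; lra]).
destruct (increment_geometric R' HR) as [B [HB H]].
destruct (pow_quarter_small (a 0%nat / (2 * B))) as [K HK].
{ pose proof (Ha 0%nat); apply Rdiv_lt_0_compat; lra. }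
exists (S K); intros z Hz.
assert (Hz' : Cmod z <= R') by (eapply Rle_trans; [exact Hz|apply Rmax_l]).
assert (HT : Cmod (rs_dlim z - dP (S K) z) <= 4 / 3 * B * (1 / 4) ^ S K).
{ apply (geometric_limC_tail (fun k => dP k z)); [exact (proj2 (rs_limits z ltac:(lra)))|].
  intros k _; rewrite increment_dP; replace (dP k z + b k * dX k z - dP k z)%C with (b k * dX k z)%C by ring.
  destruct (H k z z Hz' Hz') as (_ & H2 & _). apply (Cmod_b_mult k) in H2; pose proof (Ha k).
  assert (0 <= B * (1 / 4) ^ k) by (apply Rmult_le_pos; [lra|apply pow_le; lra]). nra. }
pose proof (dP_majorant (S K) z ltac:(lra)) as HM.
set (u := fun j => a j * (INR (freq j) * Cmod z ^ (freq j - 1))) in *.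
assert (Hu : a 0%nat <= psum u (S K)).
(* Since [freq 0 = 1], the first term is the constant [a 0] and does not degenerate at [z = 0]. *)
{ replace (a 0%nat) with (u 0%nat) by (unfold u; simpl; ring).
  apply psum_ge_first; [|lia]. intros j; unfold u; pose proof (Ha j).
  apply Rmult_le_pos; [lra|apply Rmult_le_pos; [apply pos_INR|apply pow_le, Cmod_ge_0]]. }
apply (Rmult_lt_compat_l (2 * B)) in HK; [|lra].
replace (2 * B * (a 0%nat / (2 * B))) with (a 0%nat) in HK by (field; lra).
replace (rs_dlim z) with ((rs_dlim z - dP (S K) z) + dP (S K) z)%C by ring.
eapply Rle_trans; [apply Cmod_triangle|]. simpl pow in HT.
pose proof (pow_lt (1 / 4) K ltac:(lra)). nra.
Qed.

End Limit.

(** * Membership in D^p *)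


Lemma rpow_0 p : rpow 0 p = 0.
Proof. unfold rpow; destruct Req_EM_T; [reflexivity|lra]. Qed.

Lemma rpow_Rpower x p : 0 < x -> rpow x p = Rpower x p.
Proof. intros H; unfold rpow; destruct Req_EM_T; [lra|reflexivity]. Qed.

Lemma rpow_nonneg x p : 0 <= rpow x p.
Proof. unfold rpow; destruct Req_EM_T; [lra|left; apply exp_pos]. Qed.

Lemma rpow_pos x p : 0 < x -> 0 < rpow x p.
Proof. intros H; rewrite rpow_Rpower by exact H; apply exp_pos. Qed.

Lemma rpow_1 x : 0 <= x -> rpow x 1 = x.
Proof. intros [H|<-]; [rewrite rpow_Rpower, Rpower_1 by exact H; reflexivity|apply rpow_0]. Qed.

Lemma rpow_2 x : 0 <= x -> rpow x 2 = x ^ 2.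
Proof.
intros [H|<-]; [|rewrite rpow_0; ring].
rewrite rpow_Rpower by exact H. replace 2 with (INR 2) by (simpl; lra). rewrite Rpower_pow by exact H. reflexivity.
Qed.

Lemma rpow_le x y p : 0 <= p -> 0 <= x <= y -> rpow x p <= rpow y p.
Proof.
intros Hp [[Hx|<-] Hy]; [|rewrite rpow_0; apply rpow_nonneg].
rewrite !rpow_Rpower by lra; apply Rle_Rpower_l; lra.
Qed.

Lemma rpow_mult x y p : 0 <= x -> 0 <= y -> rpow (x * y) p = rpow x p * rpow y p.
Proof.
intros [Hx|<-] [Hy|<-]; rewrite ?Rmult_0_l, ?Rmult_0_r, ?rpow_0; try ring.
rewrite !rpow_Rpower by (try apply Rmult_lt_0_compat; assumption).
symmetry; apply Rpower_mult_distr; assumption.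
Qed.

Lemma rpow_plus x p q : 0 <= x -> rpow x (p + q) = rpow x p * rpow x q.
Proof.
intros [Hx|<-]; [|rewrite !rpow_0; ring].
rewrite !rpow_Rpower by exact Hx; apply Rpower_plus.
Qed.

Lemma rpow_ge_self x s : 0 <= x <= 1 -> s <= 1 -> x <= rpow x s.
Proof.
intros [[Hx|<-] H1] Hs; [|rewrite rpow_0; lra].
rewrite rpow_Rpower by exact Hx; unfold Rpower.
rewrite <- (exp_ln x) at 1 by exact Hx.
assert (ln x <= 0) by (rewrite <- ln_1; destruct H1 as [H1| ->]; [left; apply ln_increasing; lra|lra]).
assert (H2 : ln x <= s * ln x) by nra. exact (exp_le_compat _ _ H2).
Qed.

(** The shares [x / (x + y)] and [y / (x + y)] lie in [[0, 1]], so each is at most its own s-th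
    power, and they sum to 1. *)
Lemma rpow_subadd x y s : 0 <= x -> 0 <= y -> s <= 1 -> rpow (x + y) s <= rpow x s + rpow y s.
Proof.
intros Hx Hy Hs.
destruct (Req_dec (x + y) 0) as [E|E].
{ rewrite E, rpow_0; pose proof (rpow_nonneg x s); pose proof (rpow_nonneg y s); lra. }
assert (Hp : 0 < x + y) by lra.
assert (Hfrac : forall z, 0 <= z <= x + y -> z / (x + y) * rpow (x + y) s <= rpow z s).
{ intros z Hz.
  assert (Hq : 0 <= z / (x + y) <= 1).
  { split; [apply Rmult_le_pos; [lra|left; apply Rinv_0_lt_compat; lra]|].
    apply (Rmult_le_reg_r (x + y)); [lra|]. unfold Rdiv; rewrite Rmult_assoc, Rinv_l; lra. }
  replace (rpow z s) with (rpow (z / (x + y)) s * rpow (x + y) s).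
  - apply Rmult_le_compat_r; [apply rpow_nonneg|apply rpow_ge_self; assumption].
  - rewrite <- rpow_mult by lra; f_equal; field; lra. }
pose proof (Hfrac x ltac:(lra)) as H1; pose proof (Hfrac y ltac:(lra)) as H2.
replace (rpow (x + y) s) with (x / (x + y) * rpow (x + y) s + y / (x + y) * rpow (x + y) s) by (field; lra).
lra.
Qed.

(** * Finite sums and the lacunary majorant *)

Lemma psum_S u K : psum u (S K) = psum u K + u K.
Proof. reflexivity. Qed.

Lemma psum_nonneg u K : (forall j, 0 <= u j) -> 0 <= psum u K.
Proof. intros Hu; induction K as [|K IH]; simpl; [lra|specialize (Hu K); lra]. Qed.

Lemma psum_le u v K : (forall j, u j <= v j) -> psum u K <= psum v K.
Proof. intros Hu; induction K as [|K IH]; simpl; [lra|specialize (Hu K); lra]. Qed.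

Lemma psum_scal c u K : psum (fun j => c * u j) K = c * psum u K.
Proof. induction K as [|K IH]; simpl; [ring|rewrite IH; ring]. Qed.

Lemma rpow_psum_subadd u s K : (forall j, 0 <= u j) -> s <= 1 ->
  rpow (psum u K) s <= psum (fun j => rpow (u j) s) K.
Proof.
intros Hu Hs; induction K as [|K IH]; simpl; [rewrite rpow_0; lra|].
pose proof (rpow_subadd (psum u K) (u K) s (psum_nonneg u K Hu) (Hu K) Hs); lra.
Qed.

Lemma psum_cauchy_schwarz u y K : (forall j, 0 <= y j) ->
  psum (fun j => u j * y j) K ^ 2 <= psum (fun j => u j ^ 2 * y j) K * psum y K.
Proof.
intros Hy; induction K as [|K IH]; [simpl; lra|]; rewrite !psum_S.
set (A := psum (fun j => u j * y j) K) in *; set (B := psum (fun j => u j ^ 2 * y j) K) in *.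
set (D := psum y K) in *.
assert (HB : 0 <= B) by (apply psum_nonneg; intros j; apply Rmult_le_pos; [apply pow2_ge_0|apply Hy]).
assert (HD : 0 <= D) by (apply psum_nonneg, Hy).
pose proof (Hy K) as HyK; set (t := u K) in *; set (w := y K) in *.
(* AM-GM in the form [2 A t <= B + t^2 D], multiplied by [w] *)
assert (HG : 2 * A * t <= B + t ^ 2 * D).
{ destruct (Req_dec D 0) as [E|E].
  - rewrite E, Rmult_0_r in IH; assert (A = 0) by nra. nra.
  - assert (0 < D) by lra. apply (Rmult_le_reg_r D); [assumption|].
    pose proof (pow2_ge_0 (A - t * D)); nra. }
assert (w * (2 * A * t) <= w * (B + t ^ 2 * D)) by (apply Rmult_le_compat_l; assumption).
assert ((B + t ^ 2 * w) * (D + w) - (A + t * w) ^ 2 = (B * D - A ^ 2) + (w * (B + t ^ 2 * D) - w * (2 * A * t))) by ring.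
lra.
Qed.

(** The difference is [1 - r] times a sum of [d] powers of [r], the last of which is the
    smallest. *)
Lemma pow_gap m d r : 0 <= r <= 1 -> INR d * r ^ (m + d - 1) * (1 - r) <= r ^ m - r ^ (m + d).
Proof.
intros Hr; induction d as [|d IH]; [simpl; rewrite Nat.add_0_r; lra|].
replace (m + S d - 1)%nat with (m + d)%nat by lia; replace (m + S d)%nat with (S (m + d)) by lia.
rewrite S_INR; simpl pow.
assert (INR d * r ^ (m + d) <= INR d * r ^ (m + d - 1)).
{ destruct d as [|d]; [simpl; lra|]. apply Rmult_le_compat_l; [apply pos_INR|].
  replace (m + S d)%nat with (S (m + S d - 1)) at 1 by lia; simpl pow.
  pose proof (pow_le r (m + S d - 1) ltac:(lra)); nra. }
nra.
Qed.

Definition lacunary (j : nat) (r : R) : R := INR (freq j) * r ^ (freq j - 1).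

Lemma lacunary_nonneg j r : 0 <= r -> 0 <= lacunary j r.
Proof. intros Hr; apply Rmult_le_pos; [apply pos_INR|apply pow_le, Hr]. Qed.

(** Lacunarity gives [n_j <= 2 (n_j - n_(j-1))], so by [pow_gap] each term is at most twice a
    telescoping difference of powers. Consequently [(1 - |z|) |f'(z)|] is bounded. *)
Lemma psum_lacunary_le K r : 0 <= r <= 1 -> (1 - r) * psum (fun j => lacunary j r) K <= 2.
Proof.
intros Hr.
assert (HK : (1 - r) * psum (fun j => lacunary j r) K <= 2 * (1 - r ^ (match K with O => 0 | S k => freq k end))).
{ induction K as [|K IH]; [simpl; lra|]. simpl psum.
  set (m := match K with O => 0%nat | S k => freq k end) in *.
  assert (Hm : (2 * m <= freq K)%nat).
  { unfold m; destruct K as [|k]; [simpl; lia|].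
    apply INR_le; rewrite mult_INR; simpl (INR 2). pose proof (prev_freq_le (S k)) as H; unfold prev_freq in H.
    pose proof (INR_freq_ge1 k); lra. }
  pose proof (pow_gap m (freq K - m) r Hr) as G.
  replace (m + (freq K - m))%nat with (freq K) in G by lia.
  assert (INR (freq K) <= 2 * INR (freq K - m)).
  { rewrite minus_INR by lia; apply le_INR in Hm; rewrite mult_INR in Hm; simpl (INR 2) in Hm; lra. }
  pose proof (pow_le r (freq K - 1) ltac:(lra)).
  unfold lacunary at 2.
  assert ((1 - r) * (INR (freq K) * r ^ (freq K - 1)) <= 2 * (INR (freq K - m) * r ^ (freq K - 1) * (1 - r))).
  { assert (0 <= r ^ (freq K - 1) * (1 - r)) by (apply Rmult_le_pos; lra). nra. }
  lra. }
pose proof (pow_le r (match K with O => 0 | S k => freq k end) ltac:(lra)); lra.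
Qed.

Lemma rpow_pow_le r k i s : 0 <= r < 1 -> INR i <= s * INR k -> rpow (r ^ k) s <= r ^ i.
Proof.
intros [[Hr|<-] H1] Hi.
- rewrite rpow_Rpower by (apply pow_lt, Hr). rewrite <- (Rpower_pow k r), <- (Rpower_pow i r) by exact Hr.
  rewrite Rpower_mult; unfold Rpower.
  assert (ln r < 0) by (rewrite <- ln_1; apply ln_increasing; lra).
  assert (H2 : INR k * s * ln r <= INR i * ln r) by nra.
  exact (exp_le_compat _ _ H2).
- destruct k as [|k].
  + simpl in Hi |- *. rewrite Rmult_0_r in Hi. destruct i as [|i]; [|rewrite S_INR in Hi; pose proof (pos_INR i); lra].
    simpl; rewrite rpow_Rpower by lra; unfold Rpower; rewrite ln_1, Rmult_0_r, exp_0; lra.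
  + simpl; rewrite Rmult_0_l, rpow_0. apply pow_le; lra.
Qed.

Lemma Rpower_le_neg x y s : 0 < x <= y -> s <= 0 -> Rpower y s <= Rpower x s.
Proof.
intros [Hx Hy] Hs; unfold Rpower.
assert (ln x <= ln y) by (destruct Hy as [Hy| ->]; [left; apply ln_increasing; lra|lra]).
assert (H2 : s * ln y <= s * ln x) by nra.
exact (exp_le_compat _ _ H2).
Qed.

(* The primitive is a multiple of [-(1 - x^m)^s] with [m] an integer close to [s n]. *)
Lemma lacunary_power_primitive s : 0 < s <= 1 -> exists M, 0 < M /\ forall j, exists psi dpsi : R -> R,
  (forall r, 0 <= r < 1 -> is_derive psi r (dpsi r) /\ continuous dpsi r /\ psi r - psi 0 <= M /\
     rpow (1 - r) (s - 1) * rpow (lacunary j r) s <= dpsi r).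
Proof.
(* [M * s * (s / 2)^s = 1]: this pays for the factor [s] of the derivative and for replacing [m] by
   its lower bound [s n / 2]. *)
intros Hs; set (M := / (s * Rpower (s / 2) s)).
assert (HM : 0 < M) by (apply Rinv_0_lt_compat, Rmult_lt_0_compat; [lra|apply exp_pos]).
exists M; split; [exact HM|]; intros j; set (n := freq j).
pose proof (INR_freq_ge1 j) as Hn; fold n in Hn.
assert (En : INR (n - 1) = INR n - 1) by (rewrite minus_INR; [reflexivity|apply freq_pos]).
(* With this floor [i], the power [r ^ i] dominates [r^(s (n - 1))], and [i + 1 >= s n / 2] still
   holds; the case [n = 1] is checked separately. *)
destruct (nfloor_ex (s * INR (n - 1))) as [i [Hi1 Hi2]].
{ apply Rmult_le_pos; [lra|apply pos_INR]. }
assert (Hi0 := pos_INR i).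
assert (Hm : s / 2 * INR n <= INR i + 1).
{ destruct (Req_dec (INR n) 1) as [E|E]; [rewrite E; lra|].
  assert (2 <= INR n).
  { assert (n <> 1%nat) by (intros E'; apply E; rewrite E'; reflexivity).
    pose proof (freq_pos j) as F; fold n in F. apply (le_INR 2); lia. }
  rewrite En in Hi2; nra. }
set (m := INR i + 1) in *.
exists (fun r => - M * Rpower (1 - r ^ (S i)) s),
  (fun r => M * s * m * Rpower (1 - r ^ (S i)) (s - 1) * r ^ i).
intros r Hr.
assert (Hri : 0 <= r ^ i <= 1) by (split; [apply pow_le|apply pow_le_one]; lra).
assert (HrS : 0 <= r ^ S i < 1) by (simpl; nra).
assert (Hlnb : 0 < 1 - r ^ S i) by lra.
split; [|split; [|split]].
- replace (Rpower (1 - r ^ S i) (s - 1)) with (Rpower (1 - r ^ S i) s * / (1 - r ^ S i)).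
  2:{ unfold Rminus at 4; rewrite Rpower_plus, Rpower_Ropp, Rpower_1 by exact Hlnb; reflexivity. }
  unfold Rpower, m; auto_derive; [simpl in *; lra|].
  change (match i with 0%nat => 1 | S _ => INR i + 1 end) with (INR (S i)).
  rewrite S_INR; unfold Rminus; simpl pow; field; simpl in Hlnb; lra.
- apply (ex_derive_continuous (K := R_AbsRing) (V := R_NormedModule)); unfold Rpower; auto_derive; simpl in *; lra.
- assert (0 < Rpower (1 - r ^ S i) s) by apply exp_pos.
  replace (1 - 0 ^ S i) with 1 by (simpl; ring).
  replace (Rpower 1 s) with 1 by (unfold Rpower; rewrite ln_1, Rmult_0_r, exp_0; reflexivity).
  nra.
- rewrite rpow_Rpower by lra. unfold lacunary; fold n. rewrite rpow_mult by (try apply pow_le; lra).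
  rewrite (rpow_Rpower (INR n)) by lra.
  pose proof (rpow_pow_le r (n - 1) i s Hr Hi1) as H1.
  (* Since [1 - r^m <= m (1 - r)] and the exponent [s - 1] is nonpositive, the inequality is
     reversed. *)
  assert (H2 : Rpower (m * (1 - r)) (s - 1) <= Rpower (1 - r ^ S i) (s - 1)).
  { apply Rpower_le_neg; [|lra]. split; [exact Hlnb|].
    assert (HB : forall k, 1 - r ^ k <= INR k * (1 - r)).
    { induction k as [|k IH]; [simpl; lra|]. rewrite S_INR; simpl pow.
      assert (0 <= r ^ k <= 1) by (split; [apply pow_le|apply pow_le_one]; lra). nra. }
    specialize (HB (S i)); rewrite S_INR in HB; exact HB. }
  rewrite <- Rpower_mult_distr in H2 by lra.
  assert (H3 : Rpower (s / 2) s * Rpower (INR n) s <= m * Rpower m (s - 1)).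
  { rewrite Rpower_mult_distr by lra.
    replace (m * Rpower m (s - 1)) with (Rpower m s).
    - apply Rle_Rpower_l; [lra|]. split; [|exact Hm]. apply Rmult_lt_0_compat; lra.
    - rewrite <- (Rpower_1 m) at 2 by lra. rewrite <- Rpower_plus; f_equal; ring. }
  assert (P1 : 0 < Rpower (1 - r) (s - 1)) by apply exp_pos.
  assert (P2 : 0 < Rpower (INR n) s) by apply exp_pos.
  assert (P3 : 0 < Rpower (s / 2) s) by apply exp_pos.
  apply Rle_trans with (Rpower (1 - r) (s - 1) * (Rpower (INR n) s * r ^ i)).
  { apply Rmult_le_compat_l; [lra|]. apply Rmult_le_compat_l; lra. }
  replace (Rpower (1 - r) (s - 1) * (Rpower (INR n) s * r ^ i))
    with ((Rpower (1 - r) (s - 1) * Rpower (INR n) s) * r ^ i) by ring.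
  apply Rmult_le_compat_r; [lra|].
  replace (Rpower (1 - r) (s - 1) * Rpower (INR n) s)
    with (M * s * (Rpower (1 - r) (s - 1) * (Rpower (s / 2) s * Rpower (INR n) s)))
    by (unfold M; field; split; lra).
  replace (M * s * m * Rpower (1 - r ^ S i) (s - 1)) with (M * s * (m * Rpower (1 - r ^ S i) (s - 1))) by ring.
  apply Rmult_le_compat_l; [nra|].
  apply Rle_trans with (Rpower (1 - r) (s - 1) * (m * Rpower m (s - 1))); [apply Rmult_le_compat_l; lra|].
  assert (0 < m) by (unfold m; lra). nra.
Qed.

Lemma psum_primitive (h : nat -> R -> R) (c : nat -> R) M K :
  (forall j, 0 <= c j) ->
  (forall j, exists psi dpsi : R -> R, forall r, 0 <= r < 1 ->
     is_derive psi r (dpsi r) /\ continuous dpsi r /\ psi r - psi 0 <= M /\ h j r <= dpsi r) ->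
  exists psi dpsi : R -> R, forall r, 0 <= r < 1 ->
     is_derive psi r (dpsi r) /\ continuous dpsi r /\ psi r - psi 0 <= M * psum c K /\
     psum (fun j => c j * h j r) K <= dpsi r.
Proof.
intros Hc H; induction K as [|K [psi [dpsi IH]]].
- exists (fun _ => 0), (fun _ => 0); intros r Hr; simpl.
  split; [apply (is_derive_const (K := R_AbsRing) (V := R_NormedModule))|]; split; [apply continuous_const|]; lra.
- destruct (H K) as [ph [dph HK]].
  exists (fun r => psi r + c K * ph r), (fun r => dpsi r + c K * dph r); intros r Hr.
  destruct (IH r Hr) as (I1 & I2 & I3 & I4); destruct (HK r Hr) as (K1 & K2 & K3 & K4).
  split; [|split; [|split]].
  + apply (is_derive_plus (K := R_AbsRing) (V := R_NormedModule)); [exact I1|].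
    apply (is_derive_scal ph r (c K)); exact K1.
  + apply (continuous_plus (V := R_NormedModule)); [exact I2|].
    apply (continuous_scal_r (V := R_NormedModule) (c K)); exact K2.
  + rewrite psum_S. pose proof (Rmult_le_compat_l (c K) _ _ (Hc K) K3); lra.
  + rewrite psum_S. pose proof (Rmult_le_compat_l (c K) _ _ (Hc K) K4); lra.
Qed.

(** The integrand splits as [((1 - r) x)^(p - s)] times [(1 - r)^(s - 1) x^s], and the first factor
    is bounded by [psum_lacunary_le]. In the second the sum comes out by subadditivity if [s <= 1]
    and by Cauchy-Schwarz if [s = 2]. The increments of the primitive are bounded independently of
    [K]. *)
Lemma radial_primitive p s (a : nat -> R) T : 0 < s -> s <= 1 \/ s = 2 -> s <= p ->
  (forall j, 0 < a j <= 1) -> (forall K, psum (fun j => rpow (a j) s) K <= T) ->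
  exists M, forall K, exists psi dpsi : R -> R, forall r, 0 <= r < 1 ->
    is_derive psi r (dpsi r) /\ continuous dpsi r /\ psi r - psi 0 <= M /\
    forall x, 0 <= x <= 4 * psum (fun j => a j * lacunary j r) K ->
      rpow (1 - r) (p - 1) * rpow x p <= dpsi r.
Proof.
intros Hs Hcase Hsp Ha HT.
assert (Hbase : exists c M (h : nat -> R -> R), 0 <= c /\ 0 <= M /\
  (forall j, exists psi dpsi : R -> R, forall r, 0 <= r < 1 ->
     is_derive psi r (dpsi r) /\ continuous dpsi r /\ psi r - psi 0 <= M /\ h j r <= dpsi r) /\
  forall K r, 0 <= r < 1 -> rpow (1 - r) (s - 1) * rpow (4 * psum (fun j => a j * lacunary j r) K) s <=
    c * psum (fun j => rpow (a j) s * h j r) K).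
{ destruct Hcase as [Hs1| ->].
  - destruct (lacunary_power_primitive s ltac:(lra)) as [M [HM H]].
    exists (rpow 4 s), M, (fun j r => rpow (1 - r) (s - 1) * rpow (lacunary j r) s).
    split; [apply rpow_nonneg|]; split; [lra|]; split; [exact H|].
    intros K r Hr.
    assert (Hy : forall j, 0 <= lacunary j r) by (intros; apply lacunary_nonneg; lra).
    assert (Hay : forall j, 0 <= a j * lacunary j r) by (intros j; pose proof (Ha j); apply Rmult_le_pos; [lra|apply Hy]).
    rewrite rpow_mult by first [lra | apply psum_nonneg, Hay].
    pose proof (rpow_psum_subadd _ s K Hay Hs1) as H1.
    rewrite <- Rmult_assoc, (Rmult_comm (rpow (1 - r) (s - 1))), Rmult_assoc.
    apply Rmult_le_compat_l; [apply rpow_nonneg|].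
    eapply Rle_trans; [apply Rmult_le_compat_l; [apply rpow_nonneg|exact H1]|].
    rewrite <- psum_scal; apply psum_le; intros j; pose proof (Ha j).
    rewrite rpow_mult by first [lra | apply Hy]. right; ring.
  (* 32 is [4 ^ 2] times the 2 of [psum_lacunary_le]; [lacunary j] has the primitive [r ^ freq j],
     which rises by at most 1. *)
  - exists 32, 1, lacunary; split; [lra|]; split; [lra|]; split.
    + intros j; exists (fun r => r ^ freq j), (fun r => lacunary j r); intros r Hr; split; [|split; [|split]].
      * unfold lacunary; auto_derive; [exact I|]. rewrite Rmult_1_l; f_equal; f_equal; lia.
      * apply (ex_derive_continuous (K := R_AbsRing) (V := R_NormedModule)); unfold lacunary; auto_derive; exact I.
      * rewrite pow_i by apply freq_pos.
        assert (r ^ freq j <= 1) by (apply pow_le_one; lra). lra.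
      * lra.
    + intros K r Hr.
      assert (Hy : forall j, 0 <= lacunary j r) by (intros; apply lacunary_nonneg; lra).
      assert (Hay : forall j, 0 <= a j * lacunary j r) by (intros j; pose proof (Ha j); apply Rmult_le_pos; [lra|apply Hy]).
      replace (2 - 1) with 1 by ring. rewrite rpow_1 by lra.
      rewrite rpow_2 by (apply Rmult_le_pos; [lra|apply psum_nonneg, Hay]).
      pose proof (psum_cauchy_schwarz a (fun j => lacunary j r) K Hy) as CS.
      pose proof (psum_lacunary_le K r ltac:(lra)) as HL.
      assert (E : psum (fun j => a j ^ 2 * lacunary j r) K <= psum (fun j => rpow (a j) 2 * lacunary j r) K).
      { apply psum_le; intros j; pose proof (Ha j); rewrite rpow_2 by lra; lra. }
      assert (HB : 0 <= psum (fun j => a j ^ 2 * lacunary j r) K).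
      { apply psum_nonneg; intros j; apply Rmult_le_pos; [apply pow2_ge_0|apply Hy]. }
      set (A := psum (fun j => a j * lacunary j r) K) in *; set (B := psum (fun j => a j ^ 2 * lacunary j r) K) in *.
      set (D := psum (fun j => lacunary j r) K) in *.
      assert ((1 - r) * A ^ 2 <= (1 - r) * (B * D)) by (apply Rmult_le_compat_l; lra).
      assert (B * ((1 - r) * D) <= B * 2) by (apply Rmult_le_compat_l; lra).
      nra. }
destruct Hbase as (c & M & h & Hc & HM & Hh & Hb).
(* 8 is the factor 4 of the majorant times the 2 of [psum_lacunary_le]. *)
exists (rpow 8 (p - s) * c * (M * T)); intros K.
destruct (psum_primitive h (fun j => rpow (a j) s) M K (fun j => rpow_nonneg _ _) Hh) as (psi & dpsi & HP).
assert (H8 : 0 <= rpow 8 (p - s)) by apply rpow_nonneg.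
assert (H8c : 0 <= rpow 8 (p - s) * c) by (apply Rmult_le_pos; assumption).
exists (fun r => rpow 8 (p - s) * c * psi r), (fun r => rpow 8 (p - s) * c * dpsi r).
intros r Hr; destruct (HP r Hr) as (P1 & P2 & P3 & P4); split; [|split; [|split]].
- apply (is_derive_scal psi r); exact P1.
- apply (continuous_scal_r (V := R_NormedModule) (rpow 8 (p - s) * c)); exact P2.
- assert (M * psum (fun j => rpow (a j) s) K <= M * T) by (apply Rmult_le_compat_l; auto).
  rewrite <- Rmult_minus_distr_l; apply Rmult_le_compat_l; lra.
- intros x Hx; set (W := 4 * psum (fun j => a j * lacunary j r) K) in *.
  apply Rle_trans with (rpow (1 - r) (p - 1) * rpow W p).
  { apply Rmult_le_compat_l; [apply rpow_nonneg|apply rpow_le; lra]. }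
  replace (p - 1) with ((p - s) + (s - 1)) by ring; replace p with ((p - s) + s) at 2 by ring.
  rewrite !rpow_plus by lra.
  replace (rpow (1 - r) (p - s) * rpow (1 - r) (s - 1) * (rpow W (p - s) * rpow W s))
    with (rpow ((1 - r) * W) (p - s) * (rpow (1 - r) (s - 1) * rpow W s)) by (rewrite rpow_mult by lra; ring).
  rewrite (Rmult_assoc _ c); apply Rmult_le_compat; [apply rpow_nonneg|apply Rmult_le_pos; apply rpow_nonneg| |].
  + apply rpow_le; [lra|]. split; [apply Rmult_le_pos; lra|].
    pose proof (psum_lacunary_le K r ltac:(lra)) as HL.
    assert (psum (fun j => a j * lacunary j r) K <= psum (fun j => lacunary j r) K).
    { apply psum_le; intros j; pose proof (Ha j); pose proof (lacunary_nonneg j r ltac:(lra)); nra. }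
    unfold W; nra.
  + eapply Rle_trans; [apply Hb, Hr|]. apply Rmult_le_compat_l; assumption.
Qed.

(** The absolute value is essential at 0: [ln] is 0 on negative numbers, so [rpow] itself is not
    continuous there from the left. *)
Lemma continuity_pt_rpow_abs p x : 0 < p -> continuity_pt (fun x => rpow (Rabs x) p) x.
Proof.
intros Hp; apply continuity_pt_filterlim.
destruct (Req_dec x 0) as [->|Hx].
- apply filterlim_locally; intros eps; rewrite Rabs_R0, rpow_0.
  assert (Hd : 0 < Rpower eps (/ p)) by apply exp_pos.
  exists (mkposreal _ Hd); intros y Hy.
  assert (Hy' : Rabs y < Rpower eps (/ p)) by (rewrite <- (Rminus_0_r y); exact Hy).
  change (Rabs (rpow (Rabs y) p - 0) < eps).
  rewrite Rminus_0_r, Rabs_right by (apply Rle_ge, rpow_nonneg).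
  destruct (Req_dec y 0) as [->|Hy0]; [rewrite Rabs_R0, rpow_0; apply cond_pos|].
  rewrite rpow_Rpower by (apply Rabs_pos_lt; exact Hy0).
  replace (pos eps) with (Rpower (Rpower eps (/ p)) p).
  + apply Rlt_Rpower_l; [exact Hp|]. split; [apply Rabs_pos_lt; exact Hy0|exact Hy'].
  + rewrite Rpower_mult, Rinv_l by lra; apply Rpower_1, cond_pos.
- change (continuous (fun x => rpow (Rabs x) p) x).
  apply (continuous_ext_loc _ (fun x => Rpower (Rabs x) p)).
  + assert (Hd : 0 < Rabs x) by (apply Rabs_pos_lt; exact Hx).
    exists (mkposreal _ Hd); intros y Hy; symmetry; apply rpow_Rpower.
    change (Rabs (y - x) < Rabs x) in Hy. apply Rabs_pos_lt; intros ->.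
    rewrite <- Rabs_Ropp in Hy; replace (- (0 - x)) with x in Hy by ring; lra.
  + apply continuity_pt_filterlim. unfold Rpower.
    apply (continuity_pt_comp Rabs (fun y => exp (p * ln y))); [apply Rcontinuity_abs|].
    apply derivable_continuous_pt, ex_derive_Reals_0; auto_derive. apply Rabs_pos_lt; exact Hx.
Qed.

Lemma continuity_pt_rpow_pos p x : 0 < x -> continuity_pt (fun x => rpow x p) x.
Proof.
intros Hx; apply continuity_pt_filterlim.
change (continuous (fun x => rpow x p) x).
apply (continuous_ext_loc _ (fun x => Rpower x p)).
- exists (mkposreal _ Hx); intros y Hy; symmetry; apply rpow_Rpower.
  change (Rabs (y - x) < x) in Hy; apply Rabs_lt_between in Hy; lra.
- apply continuity_pt_filterlim; unfold Rpower.
  apply derivable_continuous_pt, ex_derive_Reals_0; auto_derive; exact Hx.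
Qed.

Lemma continuous_RInt_param (H : R -> R -> R) r a b : a <= b ->
  (exists d : posreal, forall r', Rabs (r' - r) < d -> ex_RInt (H r') a b) ->
  (forall t, a <= t <= b -> continuity_2d_pt H r t) ->
  continuous (fun r => RInt (H r) a b) r.
Proof.
intros Hab [d0 Hex] HC; apply filterlim_locally; intros eps.
assert (He : 0 < eps / (2 * (b - a + 1))) by (apply Rdiv_lt_0_compat; [apply cond_pos|lra]).
destruct (uniform_continuity_2d_1d' H a b r HC (mkposreal _ He)) as [d Hd]; simpl in Hd.
assert (Hm : 0 < Rmin d0 d) by (apply Rmin_case; [apply (cond_pos d0)|apply (cond_pos d)]).
exists (mkposreal _ Hm); intros r' Hr'; change (Rabs (r' - r) < Rmin d0 d) in Hr'.
pose proof (Rmin_l d0 d); pose proof (Rmin_r d0 d); pose proof (cond_pos d) as Hdp.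
assert (E1 : ex_RInt (H r') a b) by (apply Hex; lra).
assert (E2 : ex_RInt (H r) a b) by (apply Hex; rewrite Rminus_diag, Rabs_R0; apply cond_pos).
change (Rabs (RInt (H r') a b - RInt (H r) a b) < eps).
rewrite <- (RInt_minus (V := R_CompleteNormedModule) (H r') (H r)) by assumption.
eapply Rle_lt_trans.
- apply (abs_RInt_le_const _ a b (eps / (2 * (b - a + 1)))); [exact Hab| |].
  + apply (ex_RInt_minus (V := R_CompleteNormedModule) (H r') (H r)); assumption.
  + intros t Ht; left; apply Rabs_lt_between in Hr' as Hr''.
    apply (Hd t r t r'); try lra. rewrite Rminus_diag, Rabs_R0; exact Hdp.
- apply (Rmult_lt_reg_r (2 * (b - a + 1))); [lra|].
  replace ((b - a) * (eps / (2 * (b - a + 1))) * (2 * (b - a + 1))) with ((b - a) * eps) by (field; lra).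
  pose proof (cond_pos eps); nra.
Qed.

Lemma is_RInt_Reals f a b : ex_RInt f a b -> Defs.is_RInt f a b (RInt f a b).
Proof. intros H; exists (ex_RInt_Reals_0 f a b H); symmetry; apply RInt_Reals. Qed.

Lemma is_RInt_Reals_inv f a b v : Defs.is_RInt f a b v -> ex_RInt f a b /\ RInt f a b = v.
Proof. intros [pr <-]; split; [apply ex_RInt_Reals_1, pr|apply RInt_Reals]. Qed.

Lemma continuity_Cmod_polar (F : C -> C) R L r t : lipschitz_on_disc F R L -> Rabs r < R ->
  continuity_2d_pt (fun r t => Cmod (F (polar r t))) r t.
Proof.
intros HF Hr; destruct (lipschitz_polar_continuity F R L r t HF Hr) as [H1 H2].
apply (continuity_1d_2d_pt_comp sqrt (fun r t => fst (F (polar r t)) ^ 2 + snd (F (polar r t)) ^ 2)).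
- apply continuity_pt_sqrt, Rplus_le_le_0_compat; apply pow2_ge_0.
- apply continuity_2d_pt_plus.
  + apply (continuity_2d_pt_ext (fun r t => fst (F (polar r t)) * fst (F (polar r t)))); [intros; ring|].
    apply continuity_2d_pt_mult; exact H1.
  + apply (continuity_2d_pt_ext (fun r t => snd (F (polar r t)) * snd (F (polar r t)))); [intros; ring|].
    apply continuity_2d_pt_mult; exact H2.
Qed.

(** As the area factor [r] is at most 1, the circle integral is at most [2 * PI * dpsi r];
    integrating [dpsi] and dividing by [PI] gives [2 * M]. The primitive may vary with [rho], but
    [M] may not. *)
Lemma disc_integral_finite_of_majorant p (F : C -> C) (M : R) : 0 < p ->
  (forall rho, 1 / 2 <= rho < 1 -> exists L, lipschitz_on_disc F rho L) ->
  (forall rho, 0 < rho < 1 -> exists psi dpsi : R -> R, forall r, 0 <= r <= rho ->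
     is_derive psi r (dpsi r) /\ continuous dpsi r /\ psi r - psi 0 <= M /\
     forall t, rpow (1 - r) (p - 1) * rpow (Cmod (F (polar r t))) p <= dpsi r) ->
  disc_integral_finite (fun z => rpow (1 - Cnorm z) (p - 1) * rpow (Cnorm (F z)) p).
Proof.
intros Hp HL HM; pose proof PI_RGT_0 as Hpi.
(* The absolute values make [H] continuous on both sides of [r = 0]. *)
set (H := fun r t => rpow (1 - Rabs r) (p - 1) * rpow (Rabs (Cmod (F (polar r t)))) p * r).
assert (HE : forall r t, rpow (1 - Cnorm (r * cos t, r * sin t)) (p - 1) *
  rpow (Cnorm (F (r * cos t, r * sin t))) p * r = H r t).
{ intros r t; unfold H; rewrite !Cnorm_Cmod; fold (polar r t); rewrite Cmod_polar.
  rewrite (Rabs_right (Cmod _)) by (apply Rle_ge, Cmod_ge_0); reflexivity. }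
assert (HC : forall r t, Rabs r < 1 -> continuity_2d_pt H r t).
{ intros r t Hr; unfold H.
  apply continuity_2d_pt_mult; [apply continuity_2d_pt_mult|apply continuity_2d_pt_id1].
  - apply (continuity_1d_2d_pt_comp (fun x => rpow x (p - 1)) (fun r _ => 1 - Rabs r)).
    + apply continuity_pt_rpow_pos; lra.
    + apply continuity_2d_pt_minus; [apply continuity_2d_pt_const|].
      apply (continuity_1d_2d_pt_comp Rabs (fun r _ => r)); [apply Rcontinuity_abs|apply continuity_2d_pt_id1].
  - apply (continuity_1d_2d_pt_comp (fun x => rpow (Rabs x) p) (fun r t => Cmod (F (polar r t)))).
    + apply continuity_pt_rpow_abs, Hp.
    + pose proof (Rabs_pos r).
      destruct (HL ((1 + Rabs r) / 2) ltac:(lra)) as [L HL'].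
      apply (continuity_Cmod_polar F _ L r t HL'); lra. }
assert (HX : forall r, Rabs r < 1 -> ex_RInt (H r) 0 (2 * PI)).
{ intros r Hr; apply ex_RInt_continuity_2d; intros t; apply HC, Hr. }
exists (2 * M); intros rho Hrho.
exists (fun r => RInt (H r) 0 (2 * PI)); split.
- intros r Hr.
  rewrite (RInt_ext (H r) (fun t => rpow (1 - Cnorm (r * cos t, r * sin t)) (p - 1) *
    rpow (Cnorm (F (r * cos t, r * sin t))) p * r)) by (intros t _; symmetry; apply HE).
  apply is_RInt_Reals, (ex_RInt_ext (H r)); [intros t _; symmetry; apply HE|].
  apply HX; rewrite Rabs_right; lra.
- assert (HG : ex_RInt (fun r => RInt (H r) 0 (2 * PI)) 0 rho).
  { apply (ex_RInt_continuous (V := R_CompleteNormedModule)); intros r.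
    rewrite Rmin_left, Rmax_right by lra; intros Hr.
    apply continuous_RInt_param; [lra| |intros t _; apply HC; rewrite Rabs_right; lra].
    assert (Hd : 0 < 1 - r) by lra. exists (mkposreal _ Hd); simpl; intros r' Hr'.
    apply HX. pose proof (Rabs_triang (r' - r) r) as T; replace (r' - r + r) with r' in T by ring.
    rewrite (Rabs_right r) in T by lra; lra. }
  eexists; split; [apply is_RInt_Reals, HG|].
  destruct (HM rho Hrho) as (psi & dpsi & K).
  assert (HI : is_RInt dpsi 0 rho (psi rho - psi 0)).
  { apply (is_RInt_derive (V := R_CompleteNormedModule)); intros x;
      rewrite Rmin_left, Rmax_right by lra; intros Hx; apply K, Hx. }
  assert (HI' : RInt dpsi 0 rho = psi rho - psi 0) by (apply is_RInt_unique, HI).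
  assert (HB : RInt (fun r => RInt (H r) 0 (2 * PI)) 0 rho <= 2 * PI * (psi rho - psi 0)).
  { rewrite <- HI'.
    replace (2 * PI * RInt dpsi 0 rho) with (RInt (fun r => 2 * PI * dpsi r) 0 rho)
      by (apply (RInt_scal (V := R_CompleteNormedModule) dpsi 0 rho (2 * PI)); eexists; exact HI).
    apply RInt_le; [lra|exact HG| |].
    - apply (ex_RInt_scal (V := R_CompleteNormedModule)); eexists; exact HI.
    - intros r Hr.
      destruct (K r ltac:(lra)) as (_ & _ & _ & K4).
      replace (2 * PI * dpsi r) with (RInt (fun _ => dpsi r) 0 (2 * PI)).
      2:{ rewrite RInt_const; unfold scal; simpl; unfold mult; simpl; ring. }
      apply RInt_le; [lra|apply HX; rewrite Rabs_right; lra|apply ex_RInt_const|].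
      intros t _; eapply Rle_trans; [|apply (K4 t)]. unfold H.
      rewrite (Rabs_right (Cmod _)) by (apply Rle_ge, Cmod_ge_0); rewrite (Rabs_right r) by lra.
      assert (0 <= rpow (1 - r) (p - 1) * rpow (Cmod (F (polar r t))) p) by (apply Rmult_le_pos; apply rpow_nonneg).
      nra. }
  destruct (K rho ltac:(lra)) as (_ & _ & K3 & _).
  apply (Rmult_le_reg_r PI); [lra|]. unfold Rdiv; rewrite Rmult_assoc, Rinv_l by lra. nra.
Qed.

Lemma rs_lim_DpHinf p s (a : nat -> R) T : 0 < s -> s <= 1 \/ s = 2 -> s <= p ->
  (forall j, 0 < a j <= 1) -> (forall K, psum (fun k => a k ^ 2) K <= 1) ->
  (forall K, psum (fun j => rpow (a j) s) K <= T) -> DpHinf p (rs_lim a).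
Proof.
intros Hs Hcase Hsp Ha Hsum HT.
assert (HD : forall z, inD z -> has_cderiv (rs_lim a) z (rs_dlim a z)).
{ intros z Hz; apply rs_lim_has_cderiv; auto. unfold inD in Hz; rewrite Cnorm_Cmod in Hz; exact Hz. }
assert (HA : analytic_D (rs_lim a)) by (intros z Hz; eexists; apply HD, Hz).
split; [split; [exact HA|]|split; [exact HA|]].
- exists (rs_dlim a); split; [exact HD|].
  destruct (radial_primitive p s a T Hs Hcase Hsp Ha HT) as [M HM].
  apply (disc_integral_finite_of_majorant p (rs_dlim a) M); [lra|apply rs_dlim_lipschitz; assumption|].
  intros rho Hrho; destruct (rs_dlim_majorant a Ha Hsum rho ltac:(lra)) as [K HK].
  destruct (HM K) as (psi & dpsi & HP); exists psi, dpsi; intros r Hr.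
  destruct (HP r ltac:(lra)) as (P1 & P2 & P3 & P4).
  split; [exact P1|]; split; [exact P2|]; split; [exact P3|].
  intros t; apply P4; split; [apply Cmod_ge_0|].
  assert (Hz : Cmod (polar r t) = r) by (rewrite Cmod_polar, Rabs_right; lra).
  specialize (HK (polar r t)); rewrite Hz in HK; apply HK; lra.
- exists 2; intros z Hz; unfold inD in Hz; rewrite Cnorm_Cmod in *; apply rs_lim_bounded; auto.
Qed.

(** * Lower bound for the derivative *)


Lemma ln_1_minus_le u : 0 <= u < 1 -> ln (1 - u) <= - u.
Proof.
intros Hu; rewrite <- (ln_exp (- u)); pose proof (exp_ineq1_le (- u)) as H.
destruct (Req_dec (1 - u) (exp (- u))) as [E|E]; [rewrite E; lra|left; apply ln_increasing; lra].
Qed.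

(** Comparison with an integral in telescoping form: with [tau = theta - 1], the bound
    [(1 - 1/x)^(-tau) >= 1 + tau / x] makes each term at most [1 / tau] times a difference of
    consecutive values of [x^(-tau)]. *)
Lemma p_series_bounded theta : 1 < theta ->
  exists T, 0 < T /\ forall K, psum (fun k => Rpower (INR k + 1) (- theta)) K <= T.
Proof.
intros Ht; set (tau := theta - 1); assert (Htau : 0 < tau) by (unfold tau; lra).
exists (1 + / tau); split; [pose proof (Rinv_0_lt_compat tau Htau); lra|].
assert (Hterm : forall k, Rpower (INR (S k) + 1) (- theta) <=
   / tau * (Rpower (INR k + 1) (- tau) - Rpower (INR (S k) + 1) (- tau))).
{ intros k; rewrite S_INR; pose proof (pos_INR k) as Hk; set (x := INR k + 1 + 1).
  assert (Hx : 2 <= x) by (unfold x; lra).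
  assert (Hix : 0 < / x) by (apply Rinv_0_lt_compat; lra).
  assert (Hix1 : / x <= / 2) by (apply Rinv_le_contravar; lra).
  replace (INR k + 1) with (x * (1 - / x)) by (unfold x; field; lra).
  rewrite <- Rpower_mult_distr by lra.
  replace (- theta) with (- tau + - (1)) by (unfold tau; ring).
  rewrite Rpower_plus, (Rpower_Ropp x 1), Rpower_1 by lra.
  assert (H1 : 1 + tau * / x <= Rpower (1 - / x) (- tau)).
  { unfold Rpower; pose proof (ln_1_minus_le (/ x) ltac:(lra)) as HL.
    eapply Rle_trans; [apply exp_ineq1_le|].
    assert (H2 : tau * / x <= - tau * ln (1 - / x)) by nra.
    exact (exp_le_compat _ _ H2). }
  assert (Hp : 0 < Rpower x (- tau)) by apply exp_pos.
  apply (Rmult_le_reg_l tau); [exact Htau|].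
  rewrite <- (Rmult_assoc tau (/ tau)), Rinv_r, Rmult_1_l by lra. nra. }
assert (HK : forall K, psum (fun k => Rpower (INR k + 1) (- theta)) (S K) <=
   1 + / tau * (1 - Rpower (INR K + 1) (- tau))).
{ assert (E1 : forall y, Rpower 1 y = 1) by (intros y; unfold Rpower; rewrite ln_1, Rmult_0_r; apply exp_0).
  induction K as [|K IH].
  - simpl; rewrite !Rplus_0_l, !E1; lra.
  - rewrite psum_S; specialize (Hterm K); lra. }
intros K; destruct K as [|K]; [simpl; pose proof (Rinv_0_lt_compat tau Htau); lra|].
eapply Rle_trans; [apply HK|].
assert (0 < Rpower (INR K + 1) (- tau)) by apply exp_pos. pose proof (Rinv_0_lt_compat tau Htau); nra.
Qed.

(** Each term dominates a difference of logarithms. The sum starts at [k0] because the annulus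
    estimates hold only from some index on. *)
Lemma harmonic_unbounded k0 X : exists J, X < psum (fun i => / (INR (k0 + i) + 1)) J.
Proof.
assert (H : forall J, ln (INR (k0 + J) + 1) - ln (INR k0 + 1) <= psum (fun i => / (INR (k0 + i) + 1)) J).
{ induction J as [|J IH]; [rewrite Nat.add_0_r; simpl; lra|]. rewrite psum_S.
  rewrite Nat.add_succ_r, S_INR; pose proof (pos_INR (k0 + J)) as Hp; set (x := INR (k0 + J) + 1) in *.
  assert (Hx : 0 < / x) by (apply Rinv_0_lt_compat; unfold x; lra).
  replace (x + 1) with (x * (1 + / x)) by (field; unfold x; lra).
  rewrite ln_mult by (unfold x in *; lra).
  assert (ln (1 + / x) <= / x).
  { rewrite <- (ln_exp (/ x)) at 2. pose proof (exp_ineq1_le (/ x)).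
    destruct (Req_dec (1 + / x) (exp (/ x))) as [E|E]; [rewrite E; lra|left; apply ln_increasing; lra]. }
  lra. }
destruct (INR_unbounded (exp (X + ln (INR k0 + 1)))) as [J HJ].
exists J; eapply Rlt_le_trans; [|apply H].
assert (X + ln (INR k0 + 1) < ln (INR (k0 + J) + 1)).
{ rewrite <- (ln_exp (X + ln (INR k0 + 1))); apply ln_increasing; [apply exp_pos|].
  rewrite plus_INR; pose proof (pos_INR k0); lra. }
lra.
Qed.

Definition coef (eps q : R) (k : nat) : R := eps * Rpower (INR k + 1) (- / q).

Lemma coef_pos eps q k : 0 < eps -> 0 < coef eps q k.
Proof. intros H; apply Rmult_lt_0_compat; [exact H|apply exp_pos]. Qed.

Lemma coef_decr eps q j k : 0 < eps -> 0 < q -> (k <= j)%nat -> coef eps q j <= coef eps q k.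
Proof.
intros He Hq Hkj; apply Rmult_le_compat_l; [lra|].
apply Rpower_le_neg; [apply le_INR in Hkj; pose proof (pos_INR k); lra|].
pose proof (Rinv_0_lt_compat q Hq); lra.
Qed.

Lemma coef_le eps q k : 0 < eps -> 0 < q -> coef eps q k <= eps.
Proof.
intros He Hq; eapply Rle_trans; [apply (coef_decr eps q k 0 He Hq); lia|].
unfold coef, Rpower; simpl; rewrite Rplus_0_l, ln_1, Rmult_0_r, exp_0; lra.
Qed.

Lemma rpow_coef eps q s k : 0 < eps -> rpow (coef eps q k) s = rpow eps s * Rpower (INR k + 1) (- (s / q)).
Proof.
intros He; unfold coef; rewrite rpow_mult by (left; first [exact He|apply exp_pos]).
f_equal; rewrite rpow_Rpower by apply exp_pos. rewrite Rpower_mult; f_equal; unfold Rdiv; ring.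
Qed.

Lemma rpow_coef_q eps q k : 0 < eps -> 0 < q -> rpow (coef eps q k) q = rpow eps q * / (INR k + 1).
Proof.
intros He Hq; rewrite rpow_coef by exact He; f_equal.
replace (q / q) with 1 by (field; lra). pose proof (pos_INR k).
rewrite Rpower_Ropp, Rpower_1 by lra; reflexivity.
Qed.

(** Of the two factors [(1 / 4) ^ k] in [(1 / 16) ^ k], one absorbs the constants and the other,
    already as [(1 / 2) ^ k], the power [(k + 1)^(1/q)]. *)
Lemma coef_dominates eps q e : 0 < eps -> 0 < q -> 0 < e ->
  exists k0, forall k, (k0 <= k)%nat -> (1 / 16) ^ k <= e * coef eps q k.
Proof.
intros Heps Hq He.
destruct (INR_unbounded (/ q)) as [N HN].
destruct (pow_decay N (1 / 2) ltac:(lra)) as [D [HD H]].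
destruct (pow_quarter_small (e * eps / (2 * D))) as [k0 Hk0].
{ apply Rdiv_lt_0_compat; [apply Rmult_lt_0_compat|]; lra. }
exists k0; intros k Hk.
specialize (H (S k)); rewrite S_INR in H; pose proof (pos_INR k) as Pk.
assert (P2 : 0 < (1 / 2) ^ k) by (apply pow_lt; lra).
assert (HR : Rpower (INR k + 1) (/ q) <= (INR k + 1) ^ N).
{ rewrite <- Rpower_pow by lra. apply Rle_Rpower; lra. }
assert (HR0 : 0 < Rpower (INR k + 1) (/ q)) by apply exp_pos.
assert (Hc : eps * (1 / 2) ^ k <= 2 * D * coef eps q k).
{ unfold coef; rewrite Rpower_Ropp. apply (Rmult_le_reg_r (Rpower (INR k + 1) (/ q))); [exact HR0|].
  replace (2 * D * (eps * / Rpower (INR k + 1) (/ q)) * Rpower (INR k + 1) (/ q)) with (eps * (2 * D)) by (field; lra).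
  rewrite Rmult_assoc; apply Rmult_le_compat_l; [lra|]. simpl pow in H.
  apply Rle_trans with ((1 / 2) ^ k * (INR k + 1) ^ N); [apply Rmult_le_compat_l; lra|lra]. }
assert (H4 : (1 / 4) ^ k <= e * eps / (2 * D)).
{ left; eapply Rle_lt_trans; [|exact Hk0].
  replace k with (k0 + (k - k0))%nat by lia; rewrite pow_add.
  pose proof (pow_lt (1 / 4) k0 ltac:(lra)).
  assert ((1 / 4) ^ (k - k0) <= 1) by (apply pow_le_one; lra). nra. }
replace (1 / 16) with ((1 / 4) * (1 / 4)) by lra; rewrite Rpow_mult_distr.
assert (H2 : (1 / 4) ^ k <= (1 / 2) ^ k) by (apply pow_incr; lra).
pose proof (pow_lt (1 / 4) k ltac:(lra)).
apply Rle_trans with (e * eps / (2 * D) * (1 / 2) ^ k); [apply Rmult_le_compat; lra|].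
apply (Rmult_le_reg_l (2 * D)); [lra|].
replace (2 * D * (e * eps / (2 * D) * (1 / 2) ^ k)) with (e * (eps * (1 / 2) ^ k)) by (field; lra).
nra.
Qed.

Lemma bernoulli_lower u n : 0 <= u <= 1 -> 1 - INR n * u <= (1 - u) ^ n.
Proof.
intros Hu; induction n as [|n IH]; [simpl; lra|]. rewrite S_INR; simpl pow.
assert ((1 - u) ^ n <= 1) by (apply pow_le_one; lra). nra.
Qed.

Lemma pow_le_exponent r m n : 0 <= r <= 1 -> (m <= n)%nat -> r ^ n <= r ^ m.
Proof.
intros Hr Hmn; replace n with (m + (n - m))%nat by lia; rewrite pow_add.
pose proof (pow_le r m ltac:(lra)).
assert (r ^ (n - m) <= 1) by (apply pow_le_one; lra). nra.
Qed.

(** With [n_j = 4 m] and [u = 1 / (4 n_k)], the power is at most [(1 - u)^(2 m)], and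
    [bernoulli_inv] applied twice bounds the term by [256 n_k^2 / n_j]. Finally
    [n_j >= n_k 4^k 4^j], because [j^2 >= k^2 + k + j] for [j > k]. *)
Lemma lacunary_tail k j r : (k < j)%nat -> 0 <= r <= 1 - / (4 * INR (freq k)) ->
  lacunary j r <= 256 * INR (freq k) * (1 / 4) ^ k * (1 / 4) ^ j.
Proof.
intros Hkj Hr; unfold lacunary.
pose proof (INR_freq_ge1 k) as Hn; set (n := INR (freq k)) in *.
set (u := / (4 * n)) in *.
assert (Hu : 0 < u) by (apply Rinv_0_lt_compat; lra).
assert (Hu1 : u <= 1) by (unfold u; rewrite <- Rinv_1; apply Rinv_le_contravar; lra).
set (m := (4 ^ (j * j - 1))%nat).
assert (Hm : freq j = (4 * m)%nat).
{ unfold freq, m; rewrite <- Nat.pow_succ_r'; f_equal; nia. }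
assert (Hm0 : (1 <= m)%nat) by (unfold m; pose proof (Nat.pow_nonzero 4 (j * j - 1)); lia).
assert (Hm1 : 1 <= INR m) by (apply (le_INR 1), Hm0).
assert (HN : n * 4 ^ k * 4 ^ j <= INR (freq j)).
{ unfold n; rewrite !INR_freq, <- !pow_add; apply Rle_pow; [lra|nia]. }
assert (H4m : INR (freq j) = 4 * INR m) by (rewrite Hm, mult_INR; simpl; lra).
assert (HB : (1 - u) ^ m * (INR m * u) <= 1).
{ pose proof (bernoulli_inv u m ltac:(lra)); pose proof (pow_le (1 - u) m ltac:(lra)); nra. }
assert (Hpow : r ^ (freq j - 1) <= (1 - u) ^ m * (1 - u) ^ m).
{ rewrite <- pow_add; apply Rle_trans with (r ^ (m + m)).
  - apply pow_le_exponent; [lra|lia].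
  - apply pow_incr; lra. }
pose proof (pow_le (1 - u) m ltac:(lra)) as Hx; set (x := (1 - u) ^ m) in *.
assert (Hmu : 0 < INR m * u) by (apply Rmult_lt_0_compat; lra).
assert (Hxx : x * x * ((INR m * u) * (INR m * u)) <= 1).
{ replace (x * x * ((INR m * u) * (INR m * u))) with ((x * (INR m * u)) * (x * (INR m * u))) by ring.
  assert (0 <= x * (INR m * u)) by (apply Rmult_le_pos; lra). nra. }
assert (E : INR m * u = INR (freq j) / (16 * n)) by (rewrite H4m; unfold u; field; lra).
rewrite E in Hxx; set (NN := INR (freq j)) in *.
assert (HNN : 0 < NN) by (rewrite H4m; lra).
assert (HA : NN * (x * x) * NN <= 256 * n * n).
{ replace (x * x * (NN / (16 * n) * (NN / (16 * n)))) with (NN * (x * x) * NN / (256 * n * n)) in Hxx by (field; lra).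
  apply (Rmult_le_compat_r (256 * n * n)) in Hxx; [|nra].
  unfold Rdiv in Hxx; rewrite Rmult_assoc, Rinv_l in Hxx; nra. }
assert (P1 : 0 < 4 ^ k) by (apply pow_lt; lra). assert (P2 : 0 < 4 ^ j) by (apply pow_lt; lra).
replace ((1 / 4) ^ k) with (/ 4 ^ k) by (rewrite <- pow_inv; f_equal; lra).
replace ((1 / 4) ^ j) with (/ 4 ^ j) by (rewrite <- pow_inv; f_equal; lra).
apply Rle_trans with (NN * (x * x)); [apply Rmult_le_compat_l; lra|].
apply (Rmult_le_reg_r (4 ^ k * 4 ^ j)); [apply Rmult_lt_0_compat; lra|].
replace (256 * n * / 4 ^ k * / 4 ^ j * (4 ^ k * 4 ^ j)) with (256 * n) by (field; lra).
apply (Rmult_le_reg_r n); [lra|].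
apply Rle_trans with (NN * (x * x) * NN); [|exact HA].
rewrite Rmult_assoc; apply Rmult_le_compat_l; [apply Rmult_le_pos; [lra|nra]|nra].
Qed.

Section Lower.
Variable a : nat -> R.
Hypothesis Ha : forall k, 0 < a k <= 1.
Hypothesis Hsum : forall K, psum (fun k => a k ^ 2) K <= 1.
Hypothesis Hdec : forall k j, (k <= j)%nat -> a j <= a k.

(** The main term is [b n z^(n - 1) Q_k], with [r^(n - 1) >= 1 / 2] by Bernoulli. In units of
    [a_k n_k e], moving [Q_k] to the unit circle, where [rs_energy_circle] applies, costs 4, the
    tail 256, and the derivatives of [P_k] and [Q_k] 32: together less than 300. *)
Lemma rs_dlim_lower k e r t : (1 / 16) ^ k <= e * a k ->
  1 - / (2 * INR (freq k)) <= r <= 1 - / (4 * INR (freq k)) ->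
  a k * INR (freq k) * (1 / 2 * Cmod (stQ (rs a k) (polar 1 t)) - 300 * e) <= Cmod (rs_dlim a (polar r t)).
Proof.
intros He Hr; pose proof (Ha k) as Hak; pose proof (INR_freq_ge1 k) as Hn.
set (n := INR (freq k)) in *; set (w := (1 / 16) ^ k) in *.
assert (Hw : 0 < w) by (apply pow_lt; lra).
assert (Hinv2 : / (2 * n) <= 1 / 2).
{ replace (1 / 2) with (/ 2) by lra; apply Rinv_le_contravar; lra. }
assert (Hinv4 : 0 < / (4 * n)) by (apply Rinv_0_lt_compat; lra).
assert (Hr1 : 1 / 2 <= r < 1) by lra.
set (z := polar r t); set (zeta := polar 1 t).
assert (Hz : Cmod z = r) by (unfold z; rewrite Cmod_polar, Rabs_right; lra).
assert (Hzeta : Cmod zeta = 1) by (unfold zeta; rewrite Cmod_polar; apply Rabs_R1).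
assert (Hm : prev_freq k <= 4 * n * w).
{ pose proof (prev_freq_pow k) as H; fold n in H.
  assert (E : 16 ^ k * w = 1) by (unfold w; rewrite <- Rpow_mult_distr; replace (16 * (1 / 16)) with 1 by lra; apply pow1).
  apply (Rmult_le_compat_r w) in H; [|lra]. rewrite Rmult_assoc, E in H; lra. }
pose proof (prev_freq_nonneg k) as Hm0; set (m := prev_freq k) in *.
destruct (rs_c2_bounded a Ha Hsum k) as [CP CQ].
destruct (CP z z ltac:(lra) ltac:(lra)) as (_ & HdP & _).
destruct (CQ z z ltac:(lra) ltac:(lra)) as (_ & HdQ & _).
destruct (CQ z zeta ltac:(lra) ltac:(lra)) as (_ & _ & HLip & _).
fold m in HdP, HdQ, HLip.
assert (Hdist : Cmod (zeta - z) = 1 - r).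
{ replace (zeta - z)%C with (polar (1 - r) t); [rewrite Cmod_polar, Rabs_right; lra|].
  unfold zeta, z, polar, Cminus, Cplus, Copp; simpl; f_equal; ring. }
rewrite Hdist in HLip.
assert (HQz : Cmod (stQ (rs a k) zeta) - 8 * w <= Cmod (stQ (rs a k) z)).
{ assert (4 * m * (1 - r) <= 8 * w).
  { apply Rle_trans with (4 * (4 * n * w) * (/ (2 * n))); [apply Rmult_le_compat; lra|right; field; lra]. }
  pose proof (Cmod_triangle (stQ (rs a k) zeta - stQ (rs a k) z)%C (stQ (rs a k) z)) as T.
  replace (stQ (rs a k) zeta - stQ (rs a k) z + stQ (rs a k) z)%C with (stQ (rs a k) zeta) in T by ring. lra. }
assert (Hlt : Cmod z < 1) by lra.
assert (HT : Cmod (rs_dlim a z - stdP (rs a (S k)) z) <= 4 / 3 * (a k * 3 * (256 * n * (1 / 4) ^ k)) * (1 / 4) ^ S k).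
{ apply (geometric_limC_tail (fun k => stdP (rs a k) z)); [exact (proj2 (rs_limits a Ha Hsum z Hlt))|].
  intros j Hj; rewrite (increment_dP a).
  match goal with |- Cmod (?x + ?y - ?x) <= _ => replace (x + y - x)%C with y by ring end.
  eapply Rle_trans; [apply (Cmod_b_mult a Ha j), (dX_le a Ha Hsum j z); lra|].
  pose proof (lacunary_tail k j r ltac:(lia) ltac:(fold n; lra)) as HL; unfold lacunary in HL; fold n in HL.
  rewrite Hz. pose proof (Ha j); pose proof (Hdec k j ltac:(lia)).
  apply Rle_trans with (a k * (3 * (256 * n * (1 / 4) ^ k * (1 / 4) ^ j))); [|right; ring].
  apply Rmult_le_compat; [lra| |lra|lra].
  apply Rmult_le_pos; [lra|apply Rmult_le_pos; [apply pos_INR|apply pow_le; lra]]. }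
assert (Ew : (1 / 4) ^ k * (1 / 4) ^ k = w) by (unfold w; rewrite <- Rpow_mult_distr; f_equal; lra).
assert (HT' : Cmod (rs_dlim a z - stdP (rs a (S k)) z) <= 256 * (a k * n) * w).
{ eapply Rle_trans; [exact HT|]. rewrite <- Ew; simpl pow; right; field. }
rewrite (increment_dP a) in HT'.
set (b := rs_sign (stP (rs a k)) (stQ (rs a k)) (freq k) * a k) in *.
assert (Hb : Cmod (RtoC b) = a k) by (rewrite Cmod_R; exact (Rabs_b a Ha k)).
set (main := (RtoC b * (RtoC n * z ^ (freq k - 1) * stQ (rs a k) z))%C).
assert (Hmain : a k * n * (1 / 2 * Cmod (stQ (rs a k) z)) <= Cmod main).
{ unfold main; rewrite !Cmod_mult, Hb, Cmod_pow, Hz, Cmod_R, (Rabs_right n), <- !Rmult_assoc by lra.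
  apply Rmult_le_compat_r; [apply Cmod_ge_0|]. apply Rmult_le_compat_l; [nra|].
  apply Rle_trans with (r ^ freq k); [|apply pow_le_exponent; [lra|lia]].
  apply Rle_trans with ((1 - / (2 * n)) ^ freq k); [|apply pow_incr; lra].
  assert (0 < / (2 * n)) by (apply Rinv_0_lt_compat; lra).
  pose proof (bernoulli_lower (/ (2 * n)) (freq k) ltac:(lra)) as HB; fold n in HB.
  replace (n * / (2 * n)) with (1 / 2) in HB by (field; lra). lra. }
assert (Hrest : Cmod (rs_dlim a z - main) <= 256 * (a k * n) * w + (4 * m + a k * (4 * m))).
{ match type of HT' with Cmod (?d - (?x + ?b0 * (?u + ?v))) <= _ =>
    replace (rs_dlim a z - main)%C with ((d - (x + b0 * (u + v))) + (x + b0 * v))%C by (unfold main, n; ring) end.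
  eapply Rle_trans; [apply Cmod_triangle|]. apply Rplus_le_compat; [exact HT'|].
  eapply Rle_trans; [apply Cmod_triangle|]. apply Rplus_le_compat; [exact HdP|].
  rewrite Cmod_mult, Hb. apply Rmult_le_compat_l; [lra|].
  rewrite Cmod_mult, Cmod_pow, Hz. apply Rle_trans with (1 * (4 * m)); [|lra].
  apply Rmult_le_compat; [apply pow_le; lra|apply Cmod_ge_0| |exact HdQ].
  apply pow_le_one; lra. }
pose proof (Cmod_triangle (rs_dlim a z) (- (rs_dlim a z - main))%C) as T.
replace (rs_dlim a z + - (rs_dlim a z - main))%C with main in T by ring.
rewrite Cmod_opp in T.
assert (A1 : a k * n * (1 / 2 * (Cmod (stQ (rs a k) zeta) - 8 * w)) <= a k * n * (1 / 2 * Cmod (stQ (rs a k) z))).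
{ apply Rmult_le_compat_l; [nra|lra]. }
assert (A2 : a k * (4 * m) <= 4 * m) by nra.
assert (A3 : n * w <= n * (e * a k)) by (apply Rmult_le_compat_l; lra).
assert (A4 : a k * n * w <= n * w) by (assert (0 <= n * w) by (apply Rmult_le_pos; lra); nra).
assert (He0 : 0 < e) by (apply (Rmult_lt_reg_r (a k)); lra).
assert (A5 : w <= e) by nra.
assert (A6 : a k * n * w <= a k * n * e) by (apply Rmult_le_compat_l; [nra|lra]).
nra.
Qed.

End Lower.

(** * Divergence of the D^q integral *)


Lemma rpow_ge_sqr x q : 0 <= x <= 1 -> 0 < q <= 2 -> x ^ 2 <= rpow x q.
Proof.
intros [[Hx|<-] H1] Hq; [|rewrite rpow_0; simpl; lra].
rewrite <- (rpow_2 x), !rpow_Rpower by lra; unfold Rpower.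
assert (ln x <= 0) by (rewrite <- ln_1; destruct H1 as [H1| ->]; [left; apply ln_increasing; lra|lra]).
assert (H2 : 2 * ln x <= q * ln x) by nra.
exact (exp_le_compat _ _ H2).
Qed.

Lemma rpow_ge_1 x q : 1 <= x -> 0 < q -> 1 <= rpow x q.
Proof.
intros Hx Hq; rewrite rpow_Rpower by lra. rewrite <- (Rpower_O x) by lra. apply Rle_Rpower; lra.
Qed.

Lemma rpow_2_le q : 0 < q <= 2 -> rpow 2 q <= 4.
Proof.
intros Hq; replace 4 with (rpow 2 2) by (rewrite rpow_2; lra).
rewrite !rpow_Rpower by lra; apply Rle_Rpower; lra.
Qed.

Lemma rpow_add_le x y q : 0 <= x -> 0 <= y -> 0 < q <= 2 -> rpow (x + y) q <= 4 * (rpow x q + rpow y q).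
Proof.
intros Hx Hy Hq; pose proof (rpow_nonneg x q); pose proof (rpow_nonneg y q); pose proof (rpow_2_le q Hq).
destruct (Rle_dec x y).
- apply Rle_trans with (rpow (2 * y) q); [apply rpow_le; lra|]. rewrite rpow_mult by lra; nra.
- apply Rle_trans with (rpow (2 * x) q); [apply rpow_le; lra|]. rewrite rpow_mult by lra; nra.
Qed.

(** Only quadratic means are controlled, so the q-th power is bounded below by a square:
    [(Y / M)^2 <= (Y / M)^q] for [0 <= Y <= M] and [q <= 2]. The square is expanded with [Qv <= 2],
    and [Qv^2 >= 1 - Pv^2] brings in [P_k]. For [Y <= 0] the left side is not positive. *)
Lemma rpow_lower_square q M e y x Qv Pv A :
  0 < q <= 2 -> 1 <= M -> 0 <= y <= M -> 0 <= Qv <= 2 -> 1 <= Pv ^ 2 + Qv ^ 2 -> 0 < e -> 0 < A ->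
  A * (1 / 2 * Qv - 300 * e) <= x -> 0 <= x ->
  rpow A q / M ^ 2 * (1 / 4 * y ^ 2 - M ^ 2 / 4 * Pv ^ 2 - 600 * e * M ^ 2) <= rpow (x * y) q.
Proof.
intros Hq HM Hy HQ HPQ He HA HAx Hx.
assert (HM2 : 1 <= M ^ 2) by nra.
assert (Hy2 : y ^ 2 <= M ^ 2) by (apply pow_incr; lra).
assert (HrA : 0 < rpow A q) by (apply rpow_pos, HA).
assert (HU : 1 / 4 * y ^ 2 - M ^ 2 / 4 * Pv ^ 2 - 600 * e * M ^ 2 <= y ^ 2 * (1 / 4 * Qv ^ 2 - 600 * e)).
{ assert (y ^ 2 * Pv ^ 2 <= M ^ 2 * Pv ^ 2) by (apply Rmult_le_compat_r; [apply pow2_ge_0|exact Hy2]).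
  assert (e * y ^ 2 <= e * M ^ 2) by (apply Rmult_le_compat_l; lra).
  assert (y ^ 2 * 1 <= y ^ 2 * (Pv ^ 2 + Qv ^ 2)) by (apply Rmult_le_compat_l; [apply pow2_ge_0|exact HPQ]). lra. }
set (U := 1 / 4 * y ^ 2 - M ^ 2 / 4 * Pv ^ 2 - 600 * e * M ^ 2) in *.
assert (HrM : 0 < rpow A q / M ^ 2) by (apply Rdiv_lt_0_compat; lra).
set (Y := (1 / 2 * Qv - 300 * e) * y).
destruct (Rle_lt_dec Y 0) as [HY|HY].
- apply Rle_trans with 0; [|apply rpow_nonneg].
  assert (U <= 0); [|nra].
  eapply Rle_trans; [exact HU|].
  destruct (Req_dec y 0) as [->|Hy0]; [lra|].
  assert (1 / 2 * Qv <= 300 * e) by (unfold Y in HY; nra).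
  assert (1 / 4 * Qv ^ 2 - 600 * e <= 0) by nra. pose proof (pow2_ge_0 y); nra.
- assert (Hy0 : 0 < y) by (unfold Y in HY; nra).
  assert (Hf : 0 < 1 / 2 * Qv - 300 * e) by (unfold Y in HY; nra).
  assert (HYM : Y <= M) by (unfold Y; nra).
  apply Rle_trans with (rpow (A * Y) q).
  2:{ apply rpow_le; [lra|]. split; [apply Rmult_le_pos; lra|].
      unfold Y; rewrite <- Rmult_assoc; apply Rmult_le_compat_r; lra. }
  rewrite rpow_mult by lra. unfold Rdiv; rewrite Rmult_assoc; apply Rmult_le_compat_l; [lra|].
  assert (HYq : (Y / M) ^ 2 <= rpow Y q).
  { assert (Hq1 : 0 <= Y / M <= 1).
    { split; [left; apply Rdiv_lt_0_compat; lra|]. apply (Rmult_le_reg_r M); [lra|].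
      unfold Rdiv; rewrite Rmult_assoc, Rinv_l; lra. }
    replace Y with (M * (Y / M)) at 2 by (field; lra). rewrite rpow_mult by lra.
    pose proof (rpow_ge_sqr (Y / M) q Hq1 Hq); pose proof (rpow_ge_1 M q HM ltac:(lra)).
    pose proof (pow2_ge_0 (Y / M)); nra. }
  eapply Rle_trans; [|exact HYq].
  replace ((Y / M) ^ 2) with (/ M ^ 2 * Y ^ 2) by (field; lra).
  apply Rmult_le_compat_l; [left; apply Rinv_0_lt_compat; lra|].
  eapply Rle_trans; [exact HU|].
  unfold Y. replace (((1 / 2 * Qv - 300 * e) * y) ^ 2) with (y ^ 2 * (1 / 2 * Qv - 300 * e) ^ 2) by ring.
  apply Rmult_le_compat_l; [apply pow2_ge_0|]. nra.
Qed.

Lemma is_RInt_Reals_zero f a b : (forall t, f t = 0) -> a <= b -> Defs.is_RInt f a b 0.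
Proof.
intros Hf Hab.
assert (E : RInt f a b = 0).
{ rewrite (RInt_ext f (fun _ => 0)) by (intros; apply Hf).
  rewrite RInt_const; unfold scal; simpl; unfold mult; simpl; ring. }
rewrite <- E; apply is_RInt_Reals, (ex_RInt_ext (fun _ => 0)); [intros; symmetry; apply Hf|apply ex_RInt_const].
Qed.

Lemma disc_integral_finite_zero F : (forall z, inD z -> F z = 0) -> disc_integral_finite F.
Proof.
intros HF; pose proof PI_RGT_0; exists 0; intros r Hr; exists (fun _ => 0); split.
- intros rho Hrho; apply is_RInt_Reals_zero; [|lra]; intros t.
  rewrite HF; [ring|]. unfold inD; rewrite Cnorm_Cmod; fold (polar rho t); rewrite Cmod_polar, Rabs_right; lra.
- exists 0; split; [apply is_RInt_Reals_zero; [reflexivity|lra]|lra].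
Qed.

(** A hypothesis on the derivative in the disc covers both the constant 1 and a product that
    vanishes in the disc but is arbitrary outside. *)
Lemma DpHinf_locally_constant p f M :
  (forall z, inD z -> has_cderiv f z (RtoC 0)) -> (forall z, inD z -> Cnorm (f z) <= M) -> DpHinf p f.
Proof.
intros HD HM; assert (HA : analytic_D f) by (intros z Hz; eexists; apply HD, Hz).
split; split; try exact HA; [|exists M; exact HM].
exists (fun _ => RtoC 0); split; [exact HD|].
apply disc_integral_finite_zero; intros z _; rewrite (Cnorm_Cmod (RtoC 0)), Cmod_0, rpow_0; ring.
Qed.

Lemma DpHinf_one p : DpHinf p (fun _ => RtoC 1).
Proof.
apply (DpHinf_locally_constant p _ 1); [intros z _; apply has_cderiv_const|].
intros z _; rewrite Cnorm_Cmod, Cmod_1; lra.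
Qed.

Lemma zero_is_multiplier (X : (Cplx -> Cplx) -> Prop) q g :
  analytic_D g -> zero_on_D g -> Mult X (DpHinf q) g.
Proof.
intros Hg H0; split; [exact Hg|]; intros f _.
assert (E : forall z, Cmod z < 1 -> Cmul (f z) (g z) = RtoC 0).
{ intros z Hz; rewrite (H0 z) by (unfold inD; rewrite Cnorm_Cmod; exact Hz).
  unfold Cmul, C0, RtoC; simpl; f_equal; ring. }
apply (DpHinf_locally_constant q _ 0); intros z Hz; unfold inD in Hz; rewrite Cnorm_Cmod in *.
- apply has_cderiv_at; intros eps He.
  exists (1 - Cmod z); split; [lra|]; intros w Hw.
  rewrite (E z Hz), (E w).
  + replace (RtoC 0 - RtoC 0 - RtoC 0 * (w - z))%C with (RtoC 0) by ring.
    rewrite Cmod_0; apply Rmult_le_pos; [lra|apply Cmod_ge_0].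
  + replace w with (z + (w - z))%C by ring; eapply Rle_lt_trans; [apply Cmod_triangle|lra].
- rewrite (E z Hz), Cmod_0; lra.
Qed.

Lemma quarter_freq k : / INR (freq k) <= (1 / 4) ^ k.
Proof.
replace ((1 / 4) ^ k) with (/ 4 ^ k) by (rewrite <- pow_inv; f_equal; lra).
apply Rinv_le_contravar; [apply pow_lt; lra|]. rewrite INR_freq; apply Rle_pow; [lra|nia].
Qed.

(** As [f' g = (f g)' - f g'] with [|f| <= 2], a lower bound for [f' g] yields one for the sum of
    the two circle integrals. The factor [n_k] comes from [(1 - r)^(q - 1) (a_k n_k)^q], which is of
    order [n_k a_k^q] on the annulus. *)
Lemma annulus_lower_bound (a : nat -> R) q M c0 eta e (g : C -> C) (h g1 : C -> C) k r :
  (forall k, 0 < a k <= 1) -> (forall K, psum (fun k => a k ^ 2) K <= 1) ->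
  (forall K, psum (fun k => a k ^ 2) K <= eta) -> (forall k j, (k <= j)%nat -> a j <= a k) ->
  0 < q <= 2 -> 1 <= M -> 0 < e -> 0 < c0 ->
  2 * PI * M ^ 2 * eta <= c0 / 16 -> 1200 * PI * M ^ 2 * e <= c0 / 16 ->
  (1 / 16) ^ k <= e * a k ->
  1 - / (2 * INR (freq k)) <= r <= 1 - / (4 * INR (freq k)) ->
  (forall z, Cmod z < 1 -> has_cderiv g z (g1 z)) -> (forall z, Cmod z < 1 -> Cmod (g z) <= M) ->
  (forall z, Cmod z < 1 -> has_cderiv (fun z => rs_lim a z * g z)%C z (h z)) ->
  c0 <= RInt (fun t => Cmod (g (polar r t)) ^ 2) 0 (2 * PI) ->
  forall Gh G1,
  is_RInt (fun t => rpow (1 - r) (q - 1) * rpow (Cmod (h (polar r t))) q * r) 0 (2 * PI) Gh ->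
  is_RInt (fun t => rpow (1 - r) (q - 1) * rpow (Cmod (g1 (polar r t))) q * r) 0 (2 * PI) G1 ->
  c0 / (2048 * M ^ 2) * INR (freq k) * rpow (a k) q <= Gh + G1.
Proof.
intros Ha Hsum Heta Hdec Hq HM He Hc0 Hpeta Hpe Hk Hr Hg HgM Hh Hc Gh G1 HGh HG1.
pose proof PI_RGT_0 as Hpi; pose proof (Ha k) as Hak; pose proof (INR_freq_ge1 k) as Hn.
set (n := INR (freq k)) in *.
assert (Hinv2 : / (2 * n) <= 1 / 2).
{ replace (1 / 2) with (/ 2) by lra; apply Rinv_le_contravar; lra. }
assert (Hinv4 : 0 < / (4 * n)) by (apply Rinv_0_lt_compat; lra).
assert (Hr1 : 1 / 2 <= r < 1) by lra.
assert (Hz : forall t, Cmod (polar r t) < 1) by (intros t; rewrite Cmod_polar, Rabs_right; lra).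
assert (HM2 : 1 <= M ^ 2) by nra.
set (w := rpow (1 - r) (q - 1)) in *.
assert (Hw : 0 < w) by (apply rpow_pos; lra).
set (A := a k * n). assert (HA : 0 < A) by (apply Rmult_lt_0_compat; lra).
set (kap := rpow A q / M ^ 2).
assert (Hkap : 0 < kap) by (apply Rdiv_lt_0_compat; [apply rpow_pos, HA|lra]).
(* 16 is the loss from splitting a q-th power of a sum and from the bound 2 for the limit
   function. *)
set (K1 := w * r * kap / 16).
assert (HK1 : 0 < K1) by (unfold K1; apply Rdiv_lt_0_compat; [apply Rmult_lt_0_compat; [apply Rmult_lt_0_compat; lra|exact Hkap]|lra]).
set (P := stP (rs a k)).
set (low := fun t => 1 / 4 * Cmod (g (polar r t)) ^ 2 - M ^ 2 / 4 * Cmod (P (polar 1 t)) ^ 2 - 600 * e * M ^ 2).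
assert (Hpt : forall t, K1 * low t <= w * rpow (Cmod (h (polar r t))) q * r + w * rpow (Cmod (g1 (polar r t))) q * r).
{ intros t; set (z := polar r t).
  assert (Hhz : h z = (rs_dlim a z * g z + rs_lim a z * g1 z)%C).
  { apply (has_cderiv_unique (fun z => rs_lim a z * g z)%C z); [apply Hh, Hz|].
    apply has_cderiv_mult; [exact (rs_lim_has_cderiv a Ha Hsum z (Hz t))|apply Hg, Hz]. }
  assert (Hl : kap * low t <= rpow (Cmod (rs_dlim a z) * Cmod (g z)) q).
  { assert (H1 : Cmod (polar 1 t) <= 1) by (rewrite Cmod_polar, Rabs_R1; lra).
    apply (rpow_lower_square q M e (Cmod (g z)) (Cmod (rs_dlim a z)) (Cmod (stQ (rs a k) (polar 1 t))) (Cmod (P (polar 1 t))) A);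
      auto using Cmod_ge_0.
    - split; [apply Cmod_ge_0|apply HgM, Hz].
    - split; [apply Cmod_ge_0|exact (proj2 (rs_sup a Ha Hsum k _ H1))].
    - apply (rs_energy_circle a).
    - apply (rs_dlim_lower a Ha Hsum Hdec k e r t Hk Hr). }
  assert (Hle : rpow (Cmod (rs_dlim a z) * Cmod (g z)) q <= 16 * (rpow (Cmod (h z)) q + rpow (Cmod (g1 z)) q)).
  { pose proof (rpow_nonneg (Cmod (h z)) q); pose proof (rpow_nonneg (Cmod (g1 z)) q).
    assert (HT : Cmod (rs_dlim a z) * Cmod (g z) <= Cmod (h z) + 2 * Cmod (g1 z)).
    { rewrite <- Cmod_mult. replace (rs_dlim a z * g z)%C with (h z + - (rs_lim a z * g1 z))%C by (rewrite Hhz; ring).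
      eapply Rle_trans; [apply Cmod_triangle|]. rewrite Cmod_opp, Cmod_mult.
      apply Rplus_le_compat_l, Rmult_le_compat_r; [apply Cmod_ge_0|exact (rs_lim_bounded a Ha Hsum z (Hz t))]. }
    apply Rle_trans with (rpow (Cmod (h z) + 2 * Cmod (g1 z)) q).
    { apply rpow_le; [lra|]. split; [apply Rmult_le_pos; apply Cmod_ge_0|exact HT]. }
    eapply Rle_trans; [apply rpow_add_le; [apply Cmod_ge_0|apply Rmult_le_pos; [lra|apply Cmod_ge_0]|exact Hq]|].
    rewrite rpow_mult by (try apply Cmod_ge_0; lra). pose proof (rpow_2_le q Hq). nra. }
  assert (Hwr : 0 < w * r) by (apply Rmult_lt_0_compat; lra).
  assert (H1 : w * r * (kap * low t) <= w * r * (16 * (rpow (Cmod (h z)) q + rpow (Cmod (g1 z)) q))).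
  { apply Rmult_le_compat_l; lra. }
  unfold K1; lra. }
assert (HIg : ex_RInt (fun t => Cmod (g (polar r t)) ^ 2) 0 (2 * PI)).
{ apply (ex_RInt_continuity_2d (fun r t => Cmod (g (polar r t)) ^ 2)); intros t.
  apply Cmod2_polar_continuous; eexists; apply Hg, Hz. }
destruct (rs_mean_P a Ha Hsum k) as [HIP HP]; fold P in HIP, HP.
pose proof (RInt_correct _ _ _ HIg) as IG; pose proof (RInt_correct _ _ _ HIP) as IP.
set (Ig := RInt (fun t => Cmod (g (polar r t)) ^ 2) 0 (2 * PI)) in *.
set (Ip := RInt (fun t => Cmod (P (polar 1 t)) ^ 2) 0 (2 * PI)) in *.
assert (IL : is_RInt low 0 (2 * PI) (1 / 4 * Ig - M ^ 2 / 4 * Ip - (2 * PI - 0) * (600 * e * M ^ 2))).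
{ apply (is_RInt_minus (V := R_NormedModule)); [apply (is_RInt_minus (V := R_NormedModule))|].
  - apply (is_RInt_scal (V := R_NormedModule)); exact IG.
  - apply (is_RInt_scal (V := R_NormedModule)); exact IP.
  - apply (is_RInt_const (V := R_NormedModule)). }
assert (HLow : c0 / 8 <= 1 / 4 * Ig - M ^ 2 / 4 * Ip - (2 * PI - 0) * (600 * e * M ^ 2)).
{ assert (M ^ 2 / 4 * Ip <= M ^ 2 / 4 * (8 * PI * eta)).
  { apply Rmult_le_compat_l; [lra|]. eapply Rle_trans; [exact HP|]. apply Rmult_le_compat_l; [lra|apply Heta]. }
  lra. }
set (LL := 1 / 4 * Ig - M ^ 2 / 4 * Ip - (2 * PI - 0) * (600 * e * M ^ 2)) in *.
assert (HInt : K1 * LL <= Gh + G1).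
{ apply (is_RInt_le (fun t => K1 * low t)
   (fun t => w * rpow (Cmod (h (polar r t))) q * r + w * rpow (Cmod (g1 (polar r t))) q * r) 0 (2 * PI)); [lra| | |].
  - apply (is_RInt_scal (V := R_NormedModule) low); exact IL.
  - apply (is_RInt_plus (V := R_NormedModule)); assumption.
  - intros t _; apply Hpt. }
assert (HK : K1 * (c0 / 8) <= Gh + G1) by (eapply Rle_trans; [|exact HInt]; apply Rmult_le_compat_l; lra).
eapply Rle_trans; [|exact HK].
(* Writing [w] as [(1 - r)^q / (1 - r)] and estimating numerator and denominator at opposite ends of
   the annulus avoids a case distinction on the sign of [q - 1]. *)
assert (Hww : rpow (/ (4 * n)) q * (2 * n) <= w).
{ assert (E : rpow (1 - r) q = w * (1 - r)).
  { unfold w; rewrite <- (rpow_1 (1 - r)) at 3 by lra. rewrite <- rpow_plus by lra; f_equal; ring. }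
  assert (E1 : rpow (/ (4 * n)) q <= rpow (1 - r) q) by (apply rpow_le; lra).
  assert (E2 : w * (1 - r) <= w * / (2 * n)) by (apply Rmult_le_compat_l; lra).
  apply (Rmult_le_reg_r (/ (2 * n))); [apply Rinv_0_lt_compat; lra|].
  rewrite Rmult_assoc, Rinv_r by lra. lra. }
assert (HwA : 2 * n * (rpow (a k) q / 16) <= w * rpow A q).
{ apply Rle_trans with (rpow (/ (4 * n)) q * (2 * n) * rpow A q).
  2:{ apply Rmult_le_compat_r; [apply rpow_nonneg|exact Hww]. }
  replace (rpow (/ (4 * n)) q * (2 * n) * rpow A q) with (2 * n * (rpow (/ (4 * n)) q * rpow A q)) by ring.
  apply Rmult_le_compat_l; [lra|]. rewrite <- rpow_mult by lra.
  replace (/ (4 * n) * A) with (a k * (1 / 4)) by (unfold A; field; lra).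
  rewrite rpow_mult by lra. unfold Rdiv at 1; apply Rmult_le_compat_l; [apply rpow_nonneg|].
  pose proof (rpow_ge_sqr (1 / 4) q ltac:(lra) Hq); lra. }
unfold K1, kap.
replace (w * r * (rpow A q / M ^ 2) / 16 * (c0 / 8)) with (c0 / (128 * M ^ 2) * (r * (w * rpow A q))) by (field; lra).
replace (c0 / (2048 * M ^ 2) * n * rpow (a k) q) with (c0 / (128 * M ^ 2) * (1 / 2 * (2 * n * (rpow (a k) q / 16)))) by (field; lra).
apply Rmult_le_compat_l; [left; apply Rdiv_lt_0_compat; lra|].
assert (0 <= 2 * n * (rpow (a k) q / 16)) by (pose proof (rpow_nonneg (a k) q); apply Rmult_le_pos; lra).
apply Rmult_le_compat; lra.
Qed.


Lemma disc_integral_finite_circles q (F : C -> C) :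
  disc_integral_finite (fun z => rpow (1 - Cnorm z) (q - 1) * rpow (Cnorm (F z)) q) ->
  exists M, forall rho, 0 < rho < 1 -> exists G : R -> R,
    (forall r, 0 <= r <= rho ->
       is_RInt (fun t => rpow (1 - r) (q - 1) * rpow (Cmod (F (polar r t))) q * r) 0 (2 * PI) (G r)) /\
    ex_RInt G 0 rho /\ RInt G 0 rho <= PI * M.
Proof.
intros [M HM]; exists M; intros rho Hrho; destruct (HM rho Hrho) as [G [HG [v [Hv HvM]]]].
apply is_RInt_Reals_inv in Hv; destruct Hv as [Hex Hv].
exists G; split; [|split; [exact Hex|]].
- intros r Hr; destruct (is_RInt_Reals_inv _ _ _ _ (HG r Hr)) as [X1 X2].
  apply (is_RInt_ext (fun t => rpow (1 - Cnorm (r * cos t, r * sin t)) (q - 1) * rpow (Cnorm (F (r * cos t, r * sin t))) q * r)).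
  + intros t _; rewrite !Cnorm_Cmod; fold (polar r t); rewrite Cmod_polar, Rabs_right by lra; reflexivity.
  + rewrite <- X2; apply (RInt_correct (V := R_CompleteNormedModule)), X1.
- rewrite Hv; pose proof PI_RGT_0; apply (Rmult_le_reg_r (/ PI)); [apply Rinv_0_lt_compat; lra|].
  replace (PI * M * / PI) with M by (field; lra). exact HvM.
Qed.

Lemma exists_coef_scale T eta : 0 < T -> 0 < eta -> exists eps, 0 < eps <= 1 /\ eps ^ 2 * T <= eta.
Proof.
intros HT He; assert (H : 0 < eta / T) by (apply Rdiv_lt_0_compat; assumption).
exists (Rmin 1 (eta / T)); pose proof (Rmin_l 1 (eta / T)) as H1; pose proof (Rmin_r 1 (eta / T)) as H2.
assert (H0 : 0 < Rmin 1 (eta / T)) by (apply Rmin_case; lra).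
split; [lra|]. apply Rle_trans with (eta / T * T); [|right; field; lra].
apply Rmult_le_compat_r; [lra|nra].
Qed.

(** [s] is an exponent for which the s-th powers of the coefficients are summable and which
    [radial_primitive] covers; (a) and (b) differ only in its choice. *)
Lemma multiplier_eq_zero p q s g : 0 < q < 2 -> q < s -> s <= 1 \/ s = 2 -> s <= p ->
  Mult (DpHinf p) (DpHinf q) g -> zero_on_D g.
Proof.
intros Hq Hqs Hcase Hsp [Hga Hmul] z0 Hz0.
destruct (excluded_middle_informative (g z0 = C0)) as [|Hne]; [assumption|exfalso].
unfold inD in Hz0; rewrite Cnorm_Cmod in Hz0.
pose proof PI_RGT_0 as Hpi.
destruct (Hmul _ (DpHinf_one p)) as [[_ [g1 [Hg1 Hfin1]]] [_ [M0 HM0]]].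
assert (E1 : forall z, Cmul (RtoC 1) (g z) = g z).
{ intros z; destruct (g z) as [x y]; unfold Cmul, RtoC; simpl; f_equal; ring. }
assert (HD : forall z, Cmod z < 1 -> inD z) by (intros z Hz; unfold inD; rewrite Cnorm_Cmod; exact Hz).
assert (Hg : forall z, Cmod z < 1 -> has_cderiv g z (g1 z)).
{ intros z Hz; apply (has_cderiv_ext (fun z => Cmul (RtoC 1) (g z))); [exact E1|apply Hg1, HD, Hz]. }
destruct (circle_mean_lower_bound g z0 (fun z Hz => ex_intro _ _ (Hg z Hz)) Hz0 Hne) as (c0 & r0 & Hc0 & Hr0 & Hc).
set (M := Rmax 1 M0). assert (HM : 1 <= M) by apply Rmax_l.
assert (HgM : forall z, Cmod z < 1 -> Cmod (g z) <= M).
{ intros z Hz; specialize (HM0 z (HD z Hz)); rewrite E1, Cnorm_Cmod in HM0.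
  eapply Rle_trans; [exact HM0|apply Rmax_r]. }
assert (HM2 : 1 <= M ^ 2) by nra.
destruct (p_series_bounded (s / q)) as [T [HT HTs]].
{ apply (Rmult_lt_reg_r q); [lra|]. unfold Rdiv; rewrite Rmult_assoc, Rinv_l; lra. }
destruct (p_series_bounded (2 / q)) as [T2 [HT2 HTs2]].
{ apply (Rmult_lt_reg_r q); [lra|]. unfold Rdiv; rewrite Rmult_assoc, Rinv_l; lra. }
(* [eta] here and [e] below each cost at most [c0 / 16] in [annulus_lower_bound], so half of the
   [c0 / 4] coming from [g] survives. *)
set (eta := Rmin 1 (c0 / (32 * PI * M ^ 2))).
assert (HPM : 0 < PI * M ^ 2) by (apply Rmult_lt_0_compat; lra).
assert (Heta : 0 < eta) by (apply Rmin_case; [lra|apply Rdiv_lt_0_compat; lra]).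
destruct (exists_coef_scale T2 eta HT2 Heta) as [eps [Heps HepsT]].
set (a := coef eps q).
assert (Ha : forall k, 0 < a k <= 1).
{ intros k; split; [apply coef_pos; lra|]. eapply Rle_trans; [apply coef_le; lra|lra]. }
assert (Hdec : forall k j, (k <= j)%nat -> a j <= a k) by (intros k j Hkj; apply coef_decr; lra || exact Hkj).
assert (Hsum : forall K, psum (fun k => a k ^ 2) K <= eta).
{ intros K; eapply Rle_trans; [|exact HepsT].
  apply Rle_trans with (psum (fun k => eps ^ 2 * Rpower (INR k + 1) (- (2 / q))) K).
  - apply psum_le; intros k. rewrite <- (rpow_2 (a k)) by (left; apply Ha).
    unfold a; rewrite rpow_coef, rpow_2 by lra; lra.
  - rewrite psum_scal; apply Rmult_le_compat_l; [apply pow2_ge_0|apply HTs2]. }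
assert (Hsum1 : forall K, psum (fun k => a k ^ 2) K <= 1).
{ intros K; eapply Rle_trans; [apply Hsum|apply Rmin_l]. }
assert (HTa : forall K, psum (fun k => rpow (a k) s) K <= rpow eps s * T).
{ intros K; apply Rle_trans with (psum (fun k => rpow eps s * Rpower (INR k + 1) (- (s / q))) K).
  - apply psum_le; intros k; unfold a; rewrite rpow_coef by lra; lra.
  - rewrite psum_scal; apply Rmult_le_compat_l; [apply rpow_nonneg|apply HTs]. }
pose proof (rs_lim_DpHinf p s a _ ltac:(lra) Hcase Hsp Ha Hsum1 HTa) as Hf.
destruct (Hmul _ Hf) as [[_ [h [Hh Hfinh]]] _].
assert (Hh' : forall z, Cmod z < 1 -> has_cderiv (fun z => rs_lim a z * g z)%C z (h z)).
{ intros z Hz; apply Hh, HD, Hz. }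
set (e := c0 / (19200 * (PI * M ^ 2))).
assert (He : 0 < e) by (apply Rdiv_lt_0_compat; lra).
assert (Hpe : 1200 * PI * M ^ 2 * e <= c0 / 16) by (unfold e; right; field; lra).
assert (Hpeta : 2 * PI * M ^ 2 * eta <= c0 / 16).
{ apply Rle_trans with (2 * PI * M ^ 2 * (c0 / (32 * PI * M ^ 2))); [|right; field; lra].
  apply Rmult_le_compat_l; [lra|apply Rmin_r]. }
destruct (coef_dominates eps q e ltac:(lra) ltac:(lra) He) as [k1 Hk1].
destruct (pow_quarter_small (1 - r0) ltac:(lra)) as [k2 Hk2].
set (k0 := Nat.max k1 k2).
destruct (disc_integral_finite_circles q g1 Hfin1) as [M1 HM1].
destruct (disc_integral_finite_circles q h Hfinh) as [Mh HMh].
set (c2 := c0 / (2048 * M ^ 2)). assert (Hc2 : 0 < c2) by (apply Rdiv_lt_0_compat; lra).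
assert (Hre : 0 < rpow eps q) by (apply rpow_pos; lra).
(* The number [J] of annuli is fixed before [rho]: the circle means are provided only up to [rho]
   and may depend on it, whereas [M1] and [Mh] do not. *)
destruct (harmonic_unbounded k0 (PI * (M1 + Mh) / (c2 / 4 * rpow eps q))) as [J HJ].
set (rr := fun k => 1 - / (4 * INR (freq k))).
assert (Hfreq : forall i j, (i <= j)%nat -> INR (freq i) <= INR (freq j)).
{ intros i j Hij; rewrite !INR_freq; apply Rle_pow; [lra|nia]. }
assert (Hrr1 : forall k, 0 < / (4 * INR (freq k)) <= / 4).
{ intros k; pose proof (INR_freq_ge1 k); split; [apply Rinv_0_lt_compat; lra|apply Rinv_le_contravar; lra]. }
assert (Hrr : forall i j, (i <= j)%nat -> rr i <= rr j).
{ intros i j Hij; unfold rr; pose proof (INR_freq_ge1 i); pose proof (Hfreq i j Hij).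
  assert (/ (4 * INR (freq j)) <= / (4 * INR (freq i))) by (apply Rinv_le_contravar; lra). lra. }
set (rho := rr (k0 + J)%nat).
assert (Hrho : 0 < rho < 1) by (unfold rho, rr; pose proof (Hrr1 (k0 + J)%nat); lra).
destruct (HM1 rho Hrho) as (G1 & HG1 & HG1x & HG1b).
destruct (HMh rho Hrho) as (Gh & HGh & HGhx & HGhb).
set (GG := fun r => Gh r + G1 r).
assert (HGx : ex_RInt GG 0 rho) by (apply (ex_RInt_plus (V := R_CompleteNormedModule)); assumption).
assert (HGb : RInt GG 0 rho <= PI * (M1 + Mh)).
{ unfold GG; rewrite (RInt_plus (V := R_CompleteNormedModule)) by assumption.
  change (RInt Gh 0 rho + RInt G1 0 rho <= PI * (M1 + Mh)); lra. }
assert (HGpos : forall r, 0 <= r <= rho -> 0 <= GG r).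
{ assert (Hp : forall F G, (forall r, 0 <= r <= rho ->
     is_RInt (fun t => rpow (1 - r) (q - 1) * rpow (Cmod (F (polar r t))) q * r) 0 (2 * PI) (G r)) ->
     forall r, 0 <= r <= rho -> 0 <= G r).
  { intros F G HG r Hr; rewrite <- (is_RInt_unique _ _ _ _ (HG r Hr)).
    apply RInt_ge_0; [lra|eexists; apply HG, Hr|]. intros t _.
    repeat apply Rmult_le_pos; [apply rpow_nonneg|apply rpow_nonneg|lra]. }
  intros r Hr; pose proof (Hp h Gh HGh r Hr); pose proof (Hp g1 G1 HG1 r Hr); unfold GG; lra. }
assert (Hsub : forall x y, 0 <= x -> x <= y -> y <= rho -> ex_RInt GG x y).
{ intros x y Hx Hxy Hy; apply (ex_RInt_Chasles_2 (V := R_CompleteNormedModule) GG 0 x y); [lra|].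
  apply (ex_RInt_Chasles_1 (V := R_CompleteNormedModule) GG 0 y rho); [lra|exact HGx]. }
(* Outer radius of the last of the first [j] annuli, or 0 if there is none. *)
set (ep := fun j => match j with O => 0 | S i => rr (k0 + i)%nat end).
assert (Hind : forall j, (j <= J)%nat ->
  c2 / 4 * psum (fun i => rpow (a (k0 + i)%nat) q) j <= RInt GG 0 (ep j)).
{ induction j as [|j IH]; intros Hj.
  - simpl; rewrite RInt_point; unfold zero; simpl; lra.
  - specialize (IH ltac:(lia)); rewrite psum_S.
    set (k := (k0 + j)%nat) in *; change (ep (S j)) with (rr k).
    pose proof (INR_freq_ge1 k) as Hn.
    (* Consecutive annuli do not overlap because the frequencies at least quadruple. *)
    assert (Hst : ep j <= 1 - / (2 * INR (freq k))).
    { destruct j as [|i]; [simpl|].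
      - assert (/ (2 * INR (freq k)) <= / 1) by (apply Rinv_le_contravar; lra). lra.
      - change (ep (S i)) with (1 - / (4 * INR (freq (k0 + i)))).
        pose proof (prev_freq_le k) as H4. unfold k in H4 |- *; rewrite Nat.add_succ_r in H4 |- *. unfold prev_freq in H4.
        pose proof (INR_freq_ge1 (k0 + i)).
        assert (/ (2 * INR (freq (S (k0 + i)))) <= / (4 * INR (freq (k0 + i)))) by (apply Rinv_le_contravar; lra). lra. }
    assert (Hep0 : 0 <= ep j).
    { destruct j; simpl; [lra|]. unfold rr; pose proof (Hrr1 (k0 + j)%nat); lra. }
    assert (Hlast : rr k <= rho) by (apply Hrr; unfold k; lia).
    assert (Hhalf : / (2 * INR (freq k)) = 2 * / (4 * INR (freq k))) by (field; lra).
    pose proof (Hrr1 k) as Hrk.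
    set (st := 1 - / (2 * INR (freq k))) in *.
    assert (Hse : st <= rr k) by (unfold st, rr; lra).
    assert (C1 : RInt GG 0 (rr k) = RInt GG 0 (ep j) + RInt GG (ep j) st + RInt GG st (rr k)).
    { rewrite <- (RInt_Chasles (V := R_CompleteNormedModule) GG 0 st (rr k)) by (apply Hsub; lra).
      rewrite <- (RInt_Chasles (V := R_CompleteNormedModule) GG 0 (ep j) st) by (apply Hsub; lra). reflexivity. }
    assert (C2 : 0 <= RInt GG (ep j) st).
    { apply RInt_ge_0; [exact Hst|apply Hsub; lra|]. intros x Hx; apply HGpos; lra. }
    (* The width [1 / (4 n_k)] of the annulus cancels the factor [n_k] and leaves the quarter. *)
    assert (C3 : c2 / 4 * rpow (a k) q <= RInt GG st (rr k)).
    { replace (c2 / 4 * rpow (a k) q) with (RInt (fun _ => c2 * INR (freq k) * rpow (a k) q) st (rr k)).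
      2:{ rewrite RInt_const; unfold scal; simpl; unfold mult; simpl; unfold st, rr; field; lra. }
      apply RInt_le; [exact Hse|apply ex_RInt_const|apply Hsub; lra|].
      intros r Hr. unfold GG, c2.
      apply (annulus_lower_bound a q M c0 eta e g h g1 k r); auto; try lra.
      - apply Hk1; unfold k, k0; lia.
      - unfold st, rr in Hr; lra.
      - apply Hc. assert (/ INR (freq k) <= 1 - r0).
        { apply Rle_trans with ((1 / 4) ^ k); [apply quarter_freq|].
          left; eapply Rle_lt_trans; [|exact Hk2]. apply pow_le_exponent; [lra|unfold k, k0; lia]. }
        assert (/ (2 * INR (freq k)) <= / INR (freq k)) by (apply Rinv_le_contravar; lra).
        unfold st, rr in Hr; lra.
      - apply HGh; lra.
      - apply HG1; lra. }
    rewrite C1; lra. }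
assert (Hepr : ep J <= rho).
{ unfold ep; destruct J as [|i]; [lra|]. apply Hrr; lia. }
assert (Hep0 : 0 <= ep J).
{ unfold ep; destruct J as [|i]; [lra|]. unfold rr; pose proof (Hrr1 (k0 + i)%nat); lra. }
specialize (Hind J (Nat.le_refl J)).
assert (Htot : RInt GG 0 (ep J) <= RInt GG 0 rho).
{ rewrite <- (RInt_Chasles (V := R_CompleteNormedModule) GG 0 (ep J) rho) by (apply Hsub; lra).
  assert (0 <= RInt GG (ep J) rho) by (apply RInt_ge_0; [lra|apply Hsub; lra|intros x Hx; apply HGpos; lra]).
  change (RInt GG 0 (ep J) <= RInt GG 0 (ep J) + RInt GG (ep J) rho); lra. }
assert (Hps : rpow eps q * psum (fun i => / (INR (k0 + i) + 1)) J <= psum (fun i => rpow (a (k0 + i)%nat) q) J).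
{ rewrite <- psum_scal; apply psum_le; intros i; unfold a; rewrite rpow_coef_q by lra; lra. }
apply (Rmult_lt_compat_l (c2 / 4 * rpow eps q)) in HJ; [|apply Rmult_lt_0_compat; lra].
replace (c2 / 4 * rpow eps q * (PI * (M1 + Mh) / (c2 / 4 * rpow eps q))) with (PI * (M1 + Mh)) in HJ by (field; lra).
apply (Rmult_le_compat_l (c2 / 4)) in Hps; [|lra].
lra.
Qed.

Theorem theorem5 :
  (forall p q : R, 0 < q -> q < 1 -> q < p ->
     forall g : Cplx -> Cplx,
       Mult (DpHinf p) (DpHinf q) g <-> (analytic_D g /\ zero_on_D g)) /\
  (forall p q : R, 1 <= q -> q < 2 -> 2 <= p ->
     forall g : Cplx -> Cplx,
       Mult (DpHinf p) (DpHinf q) g <-> (analytic_D g /\ zero_on_D g)).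
Proof.
split; intros p q Hq1 Hq2 Hp g; (split; [intros H; split; [apply H|]|intros [Hg H0]; apply zero_is_multiplier; assumption]).
- apply (multiplier_eq_zero p q (Rmin p 1)); [lra|apply Rmin_case; assumption|left; apply Rmin_r|apply Rmin_l|exact H].
- apply (multiplier_eq_zero p q 2); [lra|lra|right; reflexivity|exact Hp|exact H].
Qed.
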